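(* The character sphere $\Sigma(F_{\mathrm{br}})$ is a $3$-sphere $S^3$, and the Bieri--Neumann--Strebel invariant $\Sigma^1(F_{\mathrm{br}})$ consists of all points of $\Sigma(F_{\mathrm{br}})$ except for the points $[\phi_0]$ and $[\phi_1]$; that is, $\Sigma^1(F_{\mathrm{br}})=\Sigma(F_{\mathrm{br}})\setminus\{[\phi_0],[\phi_1]\}$.
   Context: A tree means a finite rooted binary tree (every non-leaf vertex has a left and a right child; the one-vertex tree is allowed); its leaves are numbered $1,\dots,n$ from left to right. $T\cup\lambda_k$ denotes the tree obtained from $T$ by attaching a caret (a vertex with two children) to its $k$-th leaf. $PB_n$ is the pure braid group on $n$ strands, drawn top to bottom, with product $pq$ meaning $p$ stacked on top of $q$. The cloning map $\kappa_k^n\colon PB_n\to PB_{n+1}$ replaces the $k$-th strand by two parallel strands. $F_{\mathrm{br}}$ is the set of equivalence classes of triples $(T_-,p,T_+)$, with $T_\pm$ trees with the same number $n$ of leaves and $p\in PB_n$, under the equivalence relation generated by the expansions $(T_-,p,T_+)\sim(T_-\cup\lambda_k,\kappa_k^n(p),T_+\cup\lambda_k)$, $1\le k\le n$. It is a group under the multiplication determined by $(T,p,S)(S,q,U)=(T,pq,U)$ (any two elements can be expanded so that this applies). It is known to be finitely generated. For a tree $T$ let $L(T)$ (resp. $R(T)$) be the number of edges on the path from the root to the leftmost (resp. rightmost) leaf. The characters $\phi_0,\phi_1\colon F_{\mathrm{br}}\to\mathbb{R}$ are the homomorphisms $\phi_0(T_-,p,T_+)=L(T_+)-L(T_-)$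 and $\phi_1(T_-,p,T_+)=R(T_+)-R(T_-)$. For a finitely generated group $G$, a character is a homomorphism $\chi\colon G\to\mathbb{R}$; two characters are equivalent if they differ by multiplication by a positive real number. The character sphere $\Sigma(G)$ is the set of equivalence classes $[\chi]$ of non-trivial characters (the sphere of rays in the real vector space $\mathrm{Hom}(G,\mathbb{R})$). Given a finite generating set $S$ of $G$, let $\Gamma(G,S)$ be the Cayley graph, with vertex set $G$ and edges joining $g$ to $gs$ ($s\in S$), and let $\Gamma(G,S)^{\chi\ge 0}$ be the full subgraph spanned by the vertices $g$ with $\chi(g)\ge 0$. Then $\Sigma^1(G)=\{[\chi]\in\Sigma(G)\mid \Gamma(G,S)^{\chi\ge 0}\text{ is connected}\}$, which does not depend on $S$. *)

(* Defs.v *)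
From HB Require Import structures.
From Stdlib Require Import Relation_Operators.
From mathcomp Require Import all_boot all_order all_algebra fingroup perm zify.
From mathcomp Require Import all_classical all_reals all_analysis.
From mathcomp Require Import generic_quotient.

Set Implicit Arguments.
Unset Strict Implicit.
Unset Printing Implicit Defensive.

Import Order.TTheory GRing.Theory Num.Theory.
Import numFieldTopology.Exports.
Local Open Scope quotient_scope.

(* A letter (x, false) of a word is the generator x, (x, true) is its inverse. *)
Definition word (I : Type) := seq (I * bool).

Section PresentedGroup.
Context (I : choiceType) (R : word I -> word I -> Prop).

Inductive pres_eq : word I -> word I -> Prop :=
| pres_refl u : pres_eq u u
| pres_sym u v : pres_eq u v -> pres_eq v u
| pres_trans u v w : pres_eq u v -> pres_eq v w -> pres_eq u w
| pres_cat u u' v v' : pres_eq u u' -> pres_eq v v' -> pres_eq (u ++ v) (u' ++ v')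
| pres_cancel x b : pres_eq [:: (x, b); (x, ~~ b)] [::]
| pres_rel u v : R u v -> pres_eq u v.

Definition pres_eqb : rel (word I) := fun u v => `[< pres_eq u v >].

Lemma pres_eqb_refl : reflexive pres_eqb.
Proof. by move=> u; apply/asboolP; apply: pres_refl. Qed.

Lemma pres_eqb_sym : symmetric pres_eqb.
Proof. by move=> u v; apply/asboolP/asboolP; apply: pres_sym. Qed.

Lemma pres_eqb_trans : transitive pres_eqb.
Proof.
move=> v u w /asboolP uv /asboolP vw; apply/asboolP.
exact: pres_trans uv vw.
Qed.

Canonical pres_equiv :=
  EquivRel pres_eqb pres_eqb_refl pres_eqb_sym pres_eqb_trans.

Definition presented := {eq_quot pres_equiv}.
HB.instance Definition _ := Quotient.on presented.
HB.instance Definition _ := Choice.on presented.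

Definition of_word (w : word I) : presented := \pi_presented w.

Lemma of_wordP u v : of_word u = of_word v <-> pres_eq u v.
Proof. by split=> [/eqmodP/asboolP //|uv]; apply/eqmodP/asboolP. Qed.

Lemma of_wordK (x : presented) : of_word (repr x) = x.
Proof. exact: reprK. Qed.

Definition inv_word (w : word I) : word I := rev [seq (l.1, ~~ l.2) | l <- w].

Lemma inv_word_cat u v : inv_word (u ++ v) = inv_word v ++ inv_word u.
Proof. by rewrite /inv_word map_cat rev_cat. Qed.

Lemma inv_wordK : involutive inv_word.
Proof.
move=> w; rewrite /inv_word map_rev revK -map_comp -[RHS]map_id.
by apply: eq_map => -[x b] /=; rewrite negbK.
Qed.

Lemma pres_mulwV w : pres_eq (w ++ inv_word w) [::].
Proof.
elim: w => [|[x b] w IHw]; first exact: pres_refl.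
rewrite -cat1s inv_word_cat -catA; apply: pres_trans (pres_cancel x b).
rewrite -[X in pres_eq _ X]/([:: (x, b)] ++ [:: (x, ~~ b)]).
apply: pres_cat; first exact: pres_refl.
rewrite catA -[X in pres_eq _ X]/([::] ++ [:: (x, ~~ b)]).
by apply: pres_cat => //; apply: pres_refl.
Qed.

Lemma pres_mulVw w : pres_eq (inv_word w ++ w) [::].
Proof. by rewrite -{2}[w]inv_wordK; apply: pres_mulwV. Qed.

Lemma pres_inv u v : pres_eq u v -> pres_eq (inv_word u) (inv_word v).
Proof.
move=> uv; have h : pres_eq (inv_word u ++ v ++ inv_word v) (inv_word u).
  rewrite -[X in pres_eq _ X]cats0; apply: pres_cat; first exact: pres_refl.
  exact: pres_mulwV.
apply: pres_trans (pres_sym h) _; rewrite catA.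
rewrite -[X in pres_eq _ X]cat0s; apply: pres_cat; last exact: pres_refl.
apply: pres_trans (pres_mulVw u); apply: pres_cat; first exact: pres_refl.
exact: pres_sym.
Qed.

Definition pres_mul (x y : presented) := of_word (repr x ++ repr y).
Definition pres_invg (x : presented) := of_word (inv_word (repr x)).
Definition pres_one := of_word [::].

Lemma pres_mulE u v : pres_mul (of_word u) (of_word v) = of_word (u ++ v).
Proof. by apply/of_wordP; apply: pres_cat; apply/of_wordP; rewrite of_wordK. Qed.

Lemma pres_invE u : pres_invg (of_word u) = of_word (inv_word u).
Proof. by apply/of_wordP; apply: pres_inv; apply/of_wordP; rewrite of_wordK. Qed.

Lemma pres_mulA : associative pres_mul.
Proof.
move=> x y z; rewrite -[x]of_wordK -[y]of_wordK -[z]of_wordK.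
by rewrite !pres_mulE catA.
Qed.

Lemma pres_mul1 : left_id pres_one pres_mul.
Proof. by move=> x; rewrite -[x]of_wordK pres_mulE. Qed.

Lemma pres_mulr1 : right_id pres_one pres_mul.
Proof. by move=> x; rewrite -[x]of_wordK pres_mulE cats0. Qed.

Lemma pres_mulV : left_inverse pres_one pres_invg pres_mul.
Proof.
move=> x; rewrite -[x]of_wordK pres_invE pres_mulE.
by apply/of_wordP; apply: pres_mulVw.
Qed.

Lemma pres_mulrV : right_inverse pres_one pres_invg pres_mul.
Proof.
move=> x; rewrite -[x]of_wordK pres_invE pres_mulE.
by apply/of_wordP; apply: pres_mulwV.
Qed.

HB.instance Definition _ := isGroup.Build presented
  pres_mulA pres_mul1 pres_mulr1 pres_mulV pres_mulrV.

Lemma of_word_cat u v : of_word (u ++ v) = (of_word u * of_word v)%g.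
Proof. exact: esym (pres_mulE u v). Qed.

Lemma of_word_inv u : of_word (inv_word u) = ((of_word u)^-1)%g.
Proof. exact: esym (pres_invE u). Qed.

Lemma of_word_nil : of_word [::] = 1%g.
Proof. by []. Qed.

End PresentedGroup.

Arguments of_word {I} R w.

(* The generators of the braid group on [n] strands are indexed by 'I_n.-1; the
   [i]-th one crosses the strands in positions [ord_lo i] and [ord_hi i]. *)
Definition ord_lo {n} (i : 'I_n.-1) : 'I_n := widen_ord (leq_pred n) i.

Lemma ord_hi_subproof n (i : 'I_n.-1) : i.+1 < n.
Proof. by case: i => i /=; lia. Qed.

Definition ord_hi {n} (i : 'I_n.-1) : 'I_n := Ordinal (ord_hi_subproof i).

(* Artin's presentation *)
Inductive braid_rel n : word 'I_n.-1 -> word 'I_n.-1 -> Prop :=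
| braid_comm (i j : 'I_n.-1) : i.+1 < j ->
    braid_rel [:: (i, false); (j, false)] [:: (j, false); (i, false)]
| braid_braid (i j : 'I_n.-1) : i.+1 = j ->
    braid_rel [:: (i, false); (j, false); (i, false)]
              [:: (j, false); (i, false); (j, false)].

Definition braid n : Type := presented (@braid_rel n).
HB.instance Definition _ n := Group.on (braid n).

Definition braid_word {n} (w : word 'I_n.-1) : braid n := of_word _ w.

(* Braids are read from top to bottom: [word_pos w k] is the bottom position of
   the strand which starts in position [k]. *)
Definition letter_pos {n} (i : 'I_n.-1) (k : 'I_n) : 'I_n :=
  tperm (ord_lo i) (ord_hi i) k.

Fixpoint word_pos {n} (w : word 'I_n.-1) (k : 'I_n) : 'I_n :=
  if w is l :: w' then word_pos w' (letter_pos l.1 k) else k.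

Lemma letter_pos_val n (i : 'I_n.-1) (k : 'I_n) :
  letter_pos i k = (if k == i :> nat then i.+1 else if k == i.+1 :> nat then i : nat else k)
    :> nat.
Proof.
rewrite /letter_pos; case: tpermP => [->|->|]; rewrite -?[ord_lo i == _]val_eqE /=.
- by rewrite eqxx.
- by rewrite eqxx; case: ifP => // /eqP; lia.
- by move=> /eqP + /eqP; rewrite -!val_eqE /= => /negPf -> /negPf ->.
Qed.

Lemma letter_posK n (i : 'I_n.-1) : involutive (letter_pos i).
Proof. exact: tpermK. Qed.

Lemma word_pos_cat n (u v : word 'I_n.-1) k :
  word_pos (u ++ v) k = word_pos v (word_pos u k).
Proof. by elim: u k => [|l u IHu] k //=. Qed.

Lemma word_pos_pres n (u v : word 'I_n.-1) :
  pres_eq (@braid_rel n) u v -> word_pos u =1 word_pos v.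
Proof.
elim=> {u v} //.
- by move=> u v _ IH k; rewrite IH.
- by move=> u v w _ IH1 _ IH2 k; rewrite IH1.
- by move=> u u' v v' _ IH1 _ IH2 k; rewrite !word_pos_cat IH1 IH2.
- by move=> i b k /=; rewrite letter_posK.
- move=> _ _ [] i j ij k; apply/val_inj => /=; rewrite !letter_pos_val;
  by repeat (case: eqP => //=); lia.
Qed.

Definition braid_pos {n} (b : braid n) (k : 'I_n) : 'I_n := word_pos (repr b) k.

Lemma braid_posE n (w : word 'I_n.-1) k : braid_pos (braid_word w) k = word_pos w k.
Proof. by apply: word_pos_pres; apply/of_wordP; rewrite of_wordK. Qed.

Definition pure {n} (b : braid n) : bool := [forall k, braid_pos b k == k].

Lemma pureP n (w : word 'I_n.-1) :
  reflect (forall k, word_pos w k = k) (pure (braid_word w)).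
Proof.
by apply: (iffP forallP) => h k; move: (h k); rewrite braid_posE => /eqP.
Qed.

Lemma pure_group_closed n : group_closed (@pure n).
Proof.
have mulP (u v : word 'I_n.-1) : pure (braid_word u) -> pure (braid_word v) ->
    pure (braid_word (u ++ v)).
  by move=> /pureP hu /pureP hv; apply/pureP => k; rewrite word_pos_cat hu hv.
split=> [|x y]; first exact/pureP.
rewrite -[x]of_wordK -[y]of_wordK -!topredE /= => px /pureP py.
have -> : (of_word (@braid_rel n) (repr x) / of_word (@braid_rel n) (repr y))%g
    = braid_word (repr x ++ inv_word (repr y)).
  by rewrite /braid_word of_word_cat of_word_inv.
apply: mulP px _; apply/pureP => k.
have := word_pos_pres (pres_mulwV _ (repr y)) k.
by rewrite word_pos_cat py.
Qed.

Record pure_braid n := PureBraid { braid_of :> braid n; _ : pure braid_of }.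
HB.instance Definition _ n := [isSub for @braid_of n].
HB.instance Definition _ n := [Choice of pure_braid n by <:].
HB.instance Definition _ n :=
  SubChoice_isSubGroup.Build (braid n) (@pure n) (pure_braid n) (@pure_group_closed n).

(* [clone_letter k l] doubles the strand in position [k] of the one-letter braid
   [l]; [clone_word] follows that strand through a word. *)
Definition clone_letter {n} (k : 'I_n) (l : 'I_n.-1 * bool) : word 'I_n :=
  let: (i, b) := l in
  if (k < i)%N then [:: (ord_hi i, b)]
  else if k == i :> nat then [:: (ord_hi i, b); (ord_lo i, b)]
  else if k == i.+1 :> nat then [:: (ord_lo i, b); (ord_hi i, b)]
  else [:: (ord_lo i, b)].

Arguments clone_letter : simpl never.

Fixpoint clone_word {n} (k : 'I_n) (w : word 'I_n.-1) : word 'I_n :=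
  if w is l :: w' then clone_letter k l ++ clone_word (letter_pos l.1 k) w'
  else [::].

Lemma clone_word_cat n (k : 'I_n) u v :
  clone_word k (u ++ v) = clone_word k u ++ clone_word (word_pos u k) v.
Proof. by elim: u k => [|l u IHu] k //=; rewrite IHu catA. Qed.

Section BraidGenerators.
Context (n : nat).
Implicit Types i j : 'I_n.-1.

Definition sigma i b : braid n := braid_word [:: (i, b)].

Lemma braid_word_cons (l : 'I_n.-1 * bool) w :
  braid_word (l :: w) = (sigma l.1 l.2 * braid_word w)%g :> braid n.
Proof. by rewrite -of_word_cat; case: l. Qed.

Lemma braid_word1 i b : braid_word [:: (i, b)] = sigma i b.
Proof. by []. Qed.

Lemma braid_word_nil : braid_word [::] = 1%g :> braid n.
Proof. by []. Qed.

Lemma sigmaV i b : sigma i (~~ b) = ((sigma i b)^-1)%g.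
Proof. by rewrite -of_word_inv. Qed.

Lemma sigma_comm i j a b : (i.+1 < j)%N || (j.+1 < i)%N ->
  commute (sigma i a) (sigma j b).
Proof.
wlog ij : i j a b / (i.+1 < j)%N => [W|_].
  by case/orP=> ij; [|apply: commute_sym]; apply: W; rewrite ij.
have h : commute (sigma i false) (sigma j false).
  rewrite /commute -!of_word_cat /=; apply/of_wordP; apply: pres_rel.
  exact: braid_comm.
case: a b => [] []; rewrite ?(sigmaV _ false) //.
- by apply/commuteV/commute_sym/commuteV/commute_sym.
- by apply/commute_sym/commuteV/commute_sym.
- exact/commuteV.
Qed.

Lemma sigma_braid i j : i.+1 = j ->
  (sigma i false * sigma j false * sigma i false
   = sigma j false * sigma i false * sigma j false)%g.
Proof.
move=> ij.
have : braid_word [:: (i, false); (j, false); (i, false)]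
     = braid_word [:: (j, false); (i, false); (j, false)] :> braid n.
  by apply/of_wordP; apply: pres_rel; exact: braid_braid.
by rewrite !braid_word_cons braid_word_nil !mulg1 !mulgA.
Qed.

Lemma sigma_words_comm (u v : word 'I_n.-1) :
  (forall x y, x \in u -> y \in v -> (x.1.+1 < y.1)%N || (y.1.+1 < x.1)%N) ->
  braid_word (u ++ v) = braid_word (v ++ u) :> braid n.
Proof.
move=> h; rewrite /braid_word !of_word_cat.
have comm1 x : x \in u -> commute (sigma x.1 x.2) (braid_word v).
  elim: v h => [|y v IHv] h xu; first exact: commute1.
  rewrite braid_word_cons; apply: commuteM.
    by apply: sigma_comm; apply: h => //; rewrite mem_head.
  by apply: IHv => // x' z x'u zv; apply: h; rewrite // inE zv orbT.
elim: u h comm1 => [|x u IHu] h comm1; first by rewrite of_word_nil mul1g mulg1.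
rewrite -!/(braid_word _) braid_word_cons.
apply: commute_sym; apply: commuteM.
  by apply/commute_sym/comm1; rewrite mem_head.
apply/commute_sym/IHu => [z y zu|z zu]; last by apply: comm1; rewrite inE zu orbT.
by apply: h; rewrite inE zu orbT.
Qed.

End BraidGenerators.

Lemma braid3_identities (G : groupType) (a b c : G) :
  (a * b * a = b * a * b)%g -> (b * c * b = c * b * c)%g -> commute a c ->
  [/\ (b * a * c * b * a = c * b * a * c * b)%g,
      (a * b * c * b * a = c * b * a * b * c)%g &
      (a * b * c * a * b = b * c * a * b * c)%g].
Proof.
rewrite /commute => aba bcb ac.
have A x : (x * a * b * a = x * b * a * b)%g by rewrite -!mulgA (mulgA a) aba !mulgA.
have B x : (x * b * c * b = x * c * b * c)%g by rewrite -!mulgA (mulgA b) bcb !mulgA.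
have C x : (x * a * c = x * c * a)%g by rewrite -!mulgA ac.
split.
- by rewrite C A bcb -C.
- by rewrite B ac -C A.
- by rewrite -C aba B C.
Qed.

Ltac split_lia := repeat (match goal with
  |- context [if ?c then _ else _] =>
    lazymatch c with
    | context [if _ then _ else _] => fail
    | _ => let H := fresh "H" in case: (boolP c) => H
    end
  end; try (exfalso; lia)).

Lemma clone_letter_pos n (k : 'I_n) (i : 'I_n.-1) b :
  clone_letter (letter_pos i k) (i, ~~ b) = inv_word (clone_letter k (i, b)).
Proof.
rewrite /clone_letter letter_pos_val.
by split_lia.
Qed.

Lemma clone_word_pres n (u v : word 'I_n.-1) (k : 'I_n) :
  pres_eq (@braid_rel n) u v ->
  pres_eq (@braid_rel n.+1) (clone_word k u) (clone_word k v).
Proof.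
move=> uv; elim: uv k => {u v}.
- by move=> u k; apply: pres_refl.
- by move=> u v _ IH k; apply: pres_sym.
- by move=> u v w _ IH1 _ IH2 k; apply: pres_trans (IH1 k) (IH2 k).
- move=> u u' v v' uu' IH1 _ IH2 k; rewrite !clone_word_cat.
  by rewrite (word_pos_pres uu'); apply: pres_cat.
- move=> i b k; rewrite /= cats0 clone_letter_pos; exact: pres_mulwV.
- move=> _ _ [] i j ij k; apply/of_wordP.
    have -> : clone_word k [:: (i, false); (j, false)]
            = clone_letter k (i, false) ++ clone_letter k (j, false).
      rewrite /= cats0; congr cat; rewrite /clone_letter letter_pos_val.
      by split_lia.
    have -> : clone_word k [:: (j, false); (i, false)]
            = clone_letter k (j, false) ++ clone_letter k (i, false).
      rewrite /= cats0; congr cat; rewrite /clone_letter letter_pos_val.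
      by split_lia.
    apply: sigma_words_comm => x y; rewrite /clone_letter.
    by split_lia; rewrite !inE -!pair_eqE /pair_eq /= -!val_eqE /=; lia.
  have bE : ord_hi i = ord_lo j by apply: val_inj.
  have aba := @sigma_braid n.+1 (ord_lo i) (ord_lo j) ij.
  have bcb := @sigma_braid n.+1 (ord_lo j) (ord_hi j) erefl.
  have ac : commute (@sigma n.+1 (ord_lo i) false) (@sigma n.+1 (ord_hi j) false).
    by apply: sigma_comm => /=; lia.
  have [id1 id2 id3] := braid3_identities aba bcb ac.
  rewrite -/(@braid_word n.+1 _) -/(@braid_word n.+1 _) /= /clone_letter !letter_pos_val.
  by split_lia; rewrite /= !braid_word_cons braid_word_nil !mulg1 !mulgA ?bE.
Qed.

(* The new position of [b] after doubling a strand in another position [a]. *)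
Definition ord_up {n} (a b : 'I_n) : 'I_n.+1 := lift (widen_ord (leqnSn n) a) b.

Arguments ord_up : simpl never.

Lemma ord_up_val n (a b : 'I_n) : ord_up a b = (if (a <= b)%N then b.+1 else b) :> nat.
Proof. by rewrite /= /bump; case: leq. Qed.

Variant clone_pos_spec n (a : 'I_n) : 'I_n.+1 -> Type :=
| ClonePosLo : clone_pos_spec a (@ord_lo n.+1 a)
| ClonePosHi : clone_pos_spec a (@ord_hi n.+1 a)
| ClonePosUp b : b != a -> clone_pos_spec a (ord_up a b).

Lemma clone_posP n (a : 'I_n) j : clone_pos_spec a j.
Proof.
have [->|nlo] := eqVneq j (@ord_lo n.+1 a); first exact: ClonePosLo.
have [->|nhi] := eqVneq j (@ord_hi n.+1 a); first exact: ClonePosHi.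
move: nlo nhi; rewrite -!val_eqE /= => nlo nhi.
have bP : (if (a < j)%N then j.-1 else j : nat) < n.
  by case: j a nlo nhi => j jn [a an] /= nlo nhi; split_lia; lia.
have -> : j = ord_up a (Ordinal bP).
  by apply/ord_inj; rewrite ord_up_val /=; move: nlo nhi; split_lia; lia.
by apply: ClonePosUp; rewrite -val_eqE /=; move: nlo nhi; split_lia; lia.
Qed.

Lemma clone_letter_lo n (a : 'I_n) (l : 'I_n.-1 * bool) :
  @word_pos n.+1 (clone_letter a l) (@ord_lo n.+1 a) = @ord_lo n.+1 (letter_pos l.1 a).
Proof.
case: l => i e; apply/ord_inj; rewrite /clone_letter /= letter_pos_val.
by split_lia; rewrite /= !letter_pos_val /=; split_lia; lia.
Qed.

Lemma clone_letter_hi n (a : 'I_n) (l : 'I_n.-1 * bool) :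
  @word_pos n.+1 (clone_letter a l) (@ord_hi n.+1 a) = @ord_hi n.+1 (letter_pos l.1 a).
Proof.
case: l => i e; apply/ord_inj; rewrite /clone_letter /= letter_pos_val.
by split_lia; rewrite /= !letter_pos_val /=; split_lia; lia.
Qed.

Lemma clone_letter_up n (a b : 'I_n) (l : 'I_n.-1 * bool) : b != a ->
  @word_pos n.+1 (clone_letter a l) (ord_up a b)
  = ord_up (letter_pos l.1 a) (letter_pos l.1 b).
Proof.
case: l => i e; rewrite -val_eqE /= => ba; apply/ord_inj.
rewrite ord_up_val /clone_letter /= !letter_pos_val.
by split_lia; rewrite /= !letter_pos_val ord_up_val /=; split_lia; lia.
Qed.

Lemma letter_pos_eq n (i : 'I_n.-1) (a b : 'I_n) :
  (letter_pos i a == letter_pos i b) = (a == b).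
Proof. exact: (inj_eq perm_inj). Qed.

Lemma clone_word_lo n (w : word 'I_n.-1) (a : 'I_n) :
  @word_pos n.+1 (clone_word a w) (@ord_lo n.+1 a) = @ord_lo n.+1 (word_pos w a).
Proof. by elim: w a => [|l w IHw] a //=; rewrite word_pos_cat clone_letter_lo IHw. Qed.

Lemma clone_word_hi n (w : word 'I_n.-1) (a : 'I_n) :
  @word_pos n.+1 (clone_word a w) (@ord_hi n.+1 a) = @ord_hi n.+1 (word_pos w a).
Proof. by elim: w a => [|l w IHw] a //=; rewrite word_pos_cat clone_letter_hi IHw. Qed.

Lemma clone_word_up n (w : word 'I_n.-1) (a b : 'I_n) : b != a ->
  @word_pos n.+1 (clone_word a w) (ord_up a b) = ord_up (word_pos w a) (word_pos w b).
Proof.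
elim: w a b => [|l w IHw] a b ba //=.
by rewrite word_pos_cat clone_letter_up // IHw // letter_pos_eq.
Qed.

Lemma clone_letterC n (a b : 'I_n) (l : 'I_n.-1 * bool) : b != a ->
  pres_eq (@braid_rel n.+2) (@clone_word n.+1 (ord_up a b) (clone_letter a l))
                            (@clone_word n.+1 (ord_up b a) (clone_letter b l)).
Proof.
case: l => i e; rewrite -val_eqE /= => ba.
have lohi : @ord_lo n.+1 (ord_hi i) = @ord_hi n.+1 (ord_lo i) by apply: ord_inj.
have cm x : (x * @sigma n.+2 (@ord_hi n.+1 (ord_hi i)) e * @sigma n.+2 (@ord_lo n.+1 (ord_lo i)) e
    = x * @sigma n.+2 (@ord_lo n.+1 (ord_lo i)) e * @sigma n.+2 (@ord_hi n.+1 (ord_hi i)) e)%g.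
  by rewrite -!mulgA; congr mulg; apply: sigma_comm => /=; lia.
apply/of_wordP; rewrite -/(@braid_word n.+2 _) -/(@braid_word n.+2 _) /clone_letter.
split_lia => /=; rewrite /clone_letter ?letter_pos_val ?ord_up_val /=; split_lia.
all: by rewrite /= ?braid_word_cons ?braid_word_nil ?mulg1 ?mulgA ?lohi ?cm.
Qed.

Lemma clone_wordC n (a b : 'I_n) (w : word 'I_n.-1) : b != a ->
  pres_eq (@braid_rel n.+2) (@clone_word n.+1 (ord_up a b) (clone_word a w))
                            (@clone_word n.+1 (ord_up b a) (clone_word b w)).
Proof.
elim: w a b => [|l w IHw] a b ba /=; first exact: pres_refl.
have ab : a != b by rewrite eq_sym.
rewrite !clone_word_cat !clone_letter_up //.
apply: pres_cat; first exact: clone_letterC.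
by apply: IHw; rewrite letter_pos_eq.
Qed.

Definition clone_braid {n} (k : 'I_n) (b : braid n) : braid n.+1 :=
  @braid_word n.+1 (clone_word k (repr b)).

Lemma clone_braidE n (k : 'I_n) (w : word 'I_n.-1) :
  clone_braid k (braid_word w) = @braid_word n.+1 (clone_word k w).
Proof. by apply/of_wordP; apply: clone_word_pres; apply/of_wordP; rewrite of_wordK. Qed.

Lemma pure_clone n (k : 'I_n) (p : pure_braid n) : pure (clone_braid k p).
Proof.
case: p => b /=; rewrite -[b]of_wordK clone_braidE.
move=> /pureP pb; apply/pureP => j; case: (clone_posP k j) => [||j' j'k].
- by rewrite clone_word_lo pb.
- by rewrite clone_word_hi pb.
- by rewrite clone_word_up // !pb.
Qed.

(* The cloning map: [clone k p] replaces the [k]-th strand of [p] by two parallel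
   strands. *)
Definition clone {n} (k : 'I_n) (p : pure_braid n) : pure_braid n.+1 :=
  PureBraid (pure_clone k p).

Lemma cloneM n (k : 'I_n) (p q : pure_braid n) :
  clone k (p * q)%g = (clone k p * clone k q)%g.
Proof.
apply: val_inj; rewrite [RHS]valM.
rewrite -[LHS]/(clone_braid k (val (p * q)%g)) valM /=.
case: p q => [p pp] [q qq] /=.
move: pp; rewrite -[p]of_wordK -[q]of_wordK => /pureP pp.
rewrite -of_word_cat !clone_braidE clone_word_cat pp.
by rewrite /braid_word of_word_cat.
Qed.

Lemma clone1 n (k : 'I_n) : clone k 1%g = 1%g.
Proof. by apply: (mulgI (clone k 1%g)); rewrite -cloneM !mulg1. Qed.

Lemma cloneV n (k : 'I_n) (p : pure_braid n) : clone k p^-1%g = ((clone k p)^-1)%g.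
Proof. by apply: (mulgI (clone k p)); rewrite -cloneM !mulgV clone1. Qed.

Lemma cloneC n (a b : 'I_n) (p : pure_braid n) : b != a ->
  clone (ord_up a b) (clone a p) = clone (ord_up b a) (clone b p).
Proof.
move=> ba; apply: val_inj => /=; case: p => p _ /=.
rewrite -[p]of_wordK !clone_braidE; apply/of_wordP; exact: clone_wordC.
Qed.

Inductive tree := Leaf | Node of tree & tree.

HB.instance Definition _ := gen_eqMixin tree.
HB.instance Definition _ := gen_choiceMixin tree.

Fixpoint nleaves (t : tree) : nat :=
  if t is Node l r then nleaves l + nleaves r else 1.

(* Attaches a caret to the [k]-th leaf of [t]; leaves are numbered from 0. *)
Fixpoint graft (t : tree) (k : nat) : tree :=
  if t is Node l r then
    if (k < nleaves l)%N then Node (graft l k) r else Node l (graft r (k - nleaves l))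
  else Node Leaf Leaf.

Lemma nleaves_gt0 t : 0 < nleaves t.
Proof. by elim: t => //= l ? r ?; lia. Qed.

Lemma nleaves_graft t k : k < nleaves t -> nleaves (graft t k) = (nleaves t).+1.
Proof.
elim: t k => //= l IHl r IHr k kn; case: ifP => /= kl; first by rewrite IHl.
by rewrite IHr; lia.
Qed.

Lemma graftC_lt t a b : a < b -> b < nleaves t ->
  graft (graft t a) b.+1 = graft (graft t b) a.
Proof.
elim: t a b => /= [|l IHl r IHr] a b ab bn; first by lia.
split_lia => /=; rewrite ?nleaves_graft //; split_lia.
- by rewrite IHl.
- by rewrite subSS.
- by rewrite subSn 1?IHr //; lia.
Qed.

Fixpoint tree_le (s t : tree) : bool :=
  match s, t with
  | Leaf, _ => true
  | Node l r, Node l' r' => tree_le l l' && tree_le r r'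
  | _, _ => false
  end.

Lemma tree_le_refl t : tree_le t t.
Proof. by elim: t => //= l -> r ->. Qed.

Lemma tree_le_trans : transitive tree_le.
Proof.
elim=> [|l IHl r IHr] [|l1 r1] [|l2 r2] //= /andP[h1 h2] /andP[h3 h4].
by rewrite (IHl _ _ h1 h3) (IHr _ _ h2 h4).
Qed.

Lemma tree_le_nleaves s t : tree_le s t -> (nleaves s <= nleaves t)%N.
Proof.
elim: s t => [|l IHl r IHr] [|l' r'] //=; first by move=> _; have := nleaves_gt0 l'; lia.
by move=> /andP[/IHl ? /IHr ?]; lia.
Qed.

Lemma tree_join s t : exists V, tree_le s V /\ tree_le t V.
Proof.
elim: s t => [|l IHl r IHr] [|l' r'].
- by exists Leaf.
- by exists (Node l' r'); rewrite tree_le_refl.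
- by exists (Node l r); rewrite tree_le_refl.
- have [L [hl hl']] := IHl l'; have [R [hr hr']] := IHr r'.
  by exists (Node L R); rewrite /= hl hl' hr hr'.
Qed.

Lemma tree_le_graft t k : tree_le t (graft t k).
Proof.
elim: t k => //= l IHl r IHr k; case: ifP => _ /=.
  by rewrite IHl tree_le_refl.
by rewrite tree_le_refl IHr.
Qed.

Lemma tree_le_graft2 s V a b : a < b -> b < nleaves s ->
  tree_le (graft s a) V -> tree_le (graft s b) V -> tree_le (graft (graft s a) b.+1) V.
Proof.
elim: s V a b => [|l IHl r IHr] V a b //=; first by lia.
move=> ab bn; split_lia => /=; rewrite ?nleaves_graft //; case: V => [|l' r'] //;
  split_lia => /=.
- by move=> /andP[h ->] /andP[h' _]; rewrite IHl.
- by move=> /andP[-> _] /andP[_]; rewrite subSS.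
- move=> /andP[-> h] /andP[_ h'].
  by rewrite subSn; [rewrite IHr //; lia|lia].
Qed.

Lemma tree_lt_graft s V : tree_le s V -> s <> V ->
  exists2 k, k < nleaves s & tree_le (graft s k) V.
Proof.
elim: s V => [|l IHl r IHr] [|l' r'] //=; first by exists 0.
move=> /andP[ll rr] ne; have [ll'|ne'] := pselect (l = l').
  have [|k kr h] := IHr _ rr; first by move=> rE; apply: ne; rewrite ll' rE.
  exists (nleaves l + k); first by lia.
  by rewrite ifF; [rewrite /= ll addKn h|lia].
have [k kl h] := IHl _ ll ne'.
exists k; first by lia.
by rewrite kl /= h rr.
Qed.

Definition ntree n := {t : tree | nleaves t == n}.

Lemma ngraft_subproof n (t : ntree n) (k : 'I_n) : nleaves (graft (val t) k) == n.+1.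
Proof. by case: t => t /= /eqP tn; rewrite nleaves_graft tn. Qed.

Definition ngraft {n} (t : ntree n) (k : 'I_n) : ntree n.+1 :=
  exist _ (graft (val t) k) (ngraft_subproof t k).

Lemma val_ngraft n (t : ntree n) (k : 'I_n) : val (ngraft t k) = graft (val t) k.
Proof. by []. Qed.

Lemma ngraftC n (t : ntree n) (a b : 'I_n) : b != a ->
  ngraft (ngraft t a) (ord_up a b) = ngraft (ngraft t b) (ord_up b a).
Proof.
wlog ab : a b / (a < b)%N => [W|_].
  move=> ba; have := ba; rewrite -val_eqE /= neq_ltn => /orP[] h.
    by symmetry; apply: W; rewrite // eq_sym.
  exact: W.
apply: val_inj; rewrite !val_ngraft !ord_up_val; split_lia.
by apply: graftC_lt => //; rewrite (eqP (valP t)).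
Qed.

Lemma ngraft_le n (t : ntree n) (a b : 'I_n) V : b != a ->
  tree_le (val (ngraft t a)) V -> tree_le (val (ngraft t b)) V ->
  tree_le (val (ngraft (ngraft t a) (ord_up a b))) V.
Proof.
wlog ab : a b / (a < b)%N => [W|] ba aV bV.
  have /orP[h|h] : (b < a)%N || (a < b)%N by rewrite -neq_ltn val_eqE.
    2: exact: W.
  by rewrite ngraftC //; apply: W; rewrite // eq_sym.
rewrite !val_ngraft ord_up_val ifT 1?ltnW //.
by apply: tree_le_graft2; rewrite // (eqP (valP t)).
Qed.

Record triple := Triple {
  strands : nat;
  tminus : ntree strands;
  tbraid : pure_braid strands;
  tplus : ntree strands }.

HB.instance Definition _ := gen_eqMixin triple.
HB.instance Definition _ := gen_choiceMixin triple.

Definition expand (t : triple) (k : 'I_(strands t)) : triple :=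
  Triple (ngraft (tminus t) k) (clone k (tbraid t)) (ngraft (tplus t) k).

Inductive expansion : triple -> triple -> Prop :=
| Expansion t k : expansion t (@expand t k).

Definition triple_eqv : triple -> triple -> Prop := clos_refl_sym_trans triple expansion.

Definition triple_eqvb : rel triple := fun t u => `[< triple_eqv t u >].

Lemma triple_eqvb_refl : reflexive triple_eqvb.
Proof. by move=> t; apply/asboolP; apply: rst_refl. Qed.

Lemma triple_eqvb_sym : symmetric triple_eqvb.
Proof. by move=> t u; apply/asboolP/asboolP; apply: rst_sym. Qed.

Lemma triple_eqvb_trans : transitive triple_eqvb.
Proof. by move=> u t v /asboolP tu /asboolP uv; apply/asboolP; apply: rst_trans tu uv. Qed.

Canonical triple_equiv :=
  EquivRel triple_eqvb triple_eqvb_refl triple_eqvb_sym triple_eqvb_trans.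

Definition Fbr := {eq_quot triple_equiv}.
HB.instance Definition _ := Quotient.on Fbr.
HB.instance Definition _ := Choice.on Fbr.

Definition Fbr_class (t : triple) : Fbr := \pi_Fbr t.

Lemma Fbr_classP t u : Fbr_class t = Fbr_class u <-> triple_eqv t u.
Proof. by split=> [/eqmodP/asboolP //|tu]; apply/eqmodP/asboolP. Qed.

Lemma Fbr_classK x : Fbr_class (repr x) = x.
Proof. exact: reprK. Qed.

Definition expansions := clos_refl_trans_1n triple expansion.

Lemma expansions_eqv t u : expansions t u -> triple_eqv t u.
Proof.
elim=> [{}t|{}t v {}u tv _ vu]; first exact: rst_refl.
by apply: rst_trans vu; apply: rst_step.
Qed.

Lemma expansions1 t u : expansion t u -> expansions t u.
Proof. by move=> tu; apply: rt1n_trans tu _; apply: rt1n_refl. Qed.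

Lemma expansions_trans t u v : expansions t u -> expansions u v -> expansions t v.
Proof. by elim=> // {}t w {}u tw _ IH /IH; apply: rt1n_trans tw. Qed.

Lemma tplus_strands t : nleaves (val (tplus t)) = strands t.
Proof. exact: (eqP (valP (tplus t))). Qed.

Lemma expansion_strands t u : expansion t u -> strands u = (strands t).+1.
Proof. by case. Qed.

Lemma expansions_strands t u : expansions t u -> t = u \/ (strands t < strands u)%N.
Proof.
elim=> [{}t|{}t v {}u /expansion_strands tv _ IH]; first by left.
by right; case: IH => [<-|]; rewrite tv //; apply: ltn_trans.
Qed.

Lemma expansion_tree_le t u : expansion t u -> tree_le (val (tplus t)) (val (tplus u)).
Proof. by case=> {}t k; apply: tree_le_graft. Qed.

Lemma expansions_tree_le t u : expansions t u -> tree_le (val (tplus t)) (val (tplus u)).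
Proof.
elim=> [{}t|{}t v {}u /expansion_tree_le tv _]; first exact: tree_le_refl.
exact: tree_le_trans.
Qed.

Lemma expand_diamond t (a b : 'I_(strands t)) V : b != a ->
  tree_le (val (tplus (expand a))) V -> tree_le (val (tplus (expand b))) V ->
  exists v, [/\ expansion (expand a) v, expansion (expand b) v & tree_le (val (tplus v)) V].
Proof.
move=> ba aV bV; exists (@expand (expand a) (ord_up a b)); split.
- exact: Expansion.
- have -> : @expand (expand a) (ord_up a b) = @expand (expand b) (ord_up b a).
    by rewrite /expand /= !(ngraftC _ ba) cloneC.
  exact: Expansion.
- exact: ngraft_le.
Qed.

Lemma expansions_to t V : tree_le (val (tplus t)) V ->
  exists2 u, expansions t u & val (tplus u) = V.
Proof.
have [m] := ubnP (nleaves V - strands t); elim: m t => // m IH t mt tV.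
have [tE|tE] := pselect (val (tplus t) = V); first by exists t => //; apply: rt1n_refl.
have [k kt kV] := tree_lt_graft tV tE; rewrite tplus_strands in kt.
have := tree_le_nleaves kV; rewrite nleaves_graft ?tplus_strands // => ltV.
have [||u tu uV] := IH (@expand t (Ordinal kt)) => //=; first by lia.
by exists u => //; apply: rt1n_trans tu; apply: Expansion.
Qed.

Lemma expansions_uniq t u u' : expansions t u -> expansions t u' ->
  val (tplus u) = val (tplus u') -> u = u'.
Proof.
move=> + + uu'; have [m] := ubnP (strands u - strands t).
elim: m t u u' uu' => // m IH t u u' uu' mt tu tu'.
have suu' : strands u = strands u' by have := tplus_strands u; rewrite uu' tplus_strands.
case: tu mt suu' uu' => [|v {}u tv vu] mt suu' uu'.
  by case: (expansions_strands tu') => // ; rewrite suu' ltnn.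
case: tu' uu' suu' => [|v' {}u' tv' vu'] uu' suu'.
  case: (expansions_strands vu) => [E|]; move: suu'.
    by rewrite -E (expansion_strands tv); lia.
  by rewrite (expansion_strands tv); lia.
have uv := expansions_strands vu.
case: tv v' tv' vu vu' mt => {}t a v' tv'.
case: _ v' / tv' a => {}t b a.
move=> au bu' mt.
have sa : ((strands t).+1 <= strands u)%N.
  by have [<-|/ltnW] := expansions_strands au.
have [abE|ba] := eqVneq b a.
  by subst b; apply: (IH _ _ _ uu' _ au bu') => /=; lia.
have bu : tree_le (val (tplus (expand b))) (val (tplus u)).
  by rewrite uu'; apply: expansions_tree_le.
have [w0 [aw bw wV]] := expand_diamond ba (expansions_tree_le au) bu.
have [w w0w wE] := expansions_to wV.
have suw : strands w = strands u by rewrite -(tplus_strands w) wE tplus_strands.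
transitivity w; [apply: (IH _ _ _ _ _ au)|symmetry; apply: (IH _ _ _ _ _ bu')].
- by rewrite wE.
- by rewrite /=; lia.
- exact: rt1n_trans aw w0w.
- by rewrite wE.
- by rewrite /=; lia.
- exact: rt1n_trans bw w0w.
Qed.

Lemma expansions_join t u u' : expansions t u -> expansions t u' ->
  exists v, expansions u v /\ expansions u' v.
Proof.
move=> tu tu'; have [V [uV u'V]] := tree_join (val (tplus u)) (val (tplus u')).
have [v uv vE] := expansions_to uV; have [v' u'v' v'E] := expansions_to u'V.
exists v; split=> //; have -> // : v = v'.
apply: (@expansions_uniq t); [| |by rewrite vE].
- exact: expansions_trans uv.
- exact: expansions_trans u'v'.
Qed.

Lemma triple_eqvP t u :
  triple_eqv t u <-> exists v, expansions t v /\ expansions u v.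
Proof.
split=> [|[v [/expansions_eqv tv /expansions_eqv uv]]]; last first.
  by apply: rst_trans tv _; apply: rst_sym.
elim=> {t u} [t u tu|t|t u _ [v [tv uv]]|t u w _ [v1 [tv1 uv1]] _ [v2 [uv2 wv2]]].
- by exists u; split; [exact: expansions1|exact: rt1n_refl].
- by exists t; split; apply: rt1n_refl.
- by exists v.
- have [v [v1v v2v]] := expansions_join uv1 uv2.
  by exists v; split; [exact: expansions_trans v1v|exact: expansions_trans v2v].
Qed.

Definition triple_inv (t : triple) : triple :=
  Triple (tplus t) ((tbraid t)^-1)%g (tminus t).

Lemma triple_invK : involutive triple_inv.
Proof. by case=> n T p S; rewrite /triple_inv /= invgK. Qed.

Lemma expansion_inv t u : expansion t u -> expansion (triple_inv t) (triple_inv u).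
Proof.
case=> {}t k; have -> : triple_inv (expand k) = @expand (triple_inv t) k.
  by rewrite /triple_inv /expand /= cloneV.
exact: Expansion.
Qed.

Lemma expansions_inv t u : expansions t u -> expansions (triple_inv t) (triple_inv u).
Proof.
elim=> [{}t|{}t v {}u /expansion_inv tv _]; first exact: rt1n_refl.
exact: rt1n_trans.
Qed.

Lemma triple_eqv_inv t u : triple_eqv t u -> triple_eqv (triple_inv t) (triple_inv u).
Proof.
move=> /triple_eqvP[v [tv uv]]; apply/triple_eqvP; exists (triple_inv v).
by split; apply: expansions_inv.
Qed.

Lemma expansions_to_minus t V : tree_le (val (tminus t)) V ->
  exists2 u, expansions t u & val (tminus u) = V.
Proof.
move=> tV; have [u tu uE] := @expansions_to (triple_inv t) V tV.
by exists (triple_inv u) => //; rewrite -[t]triple_invK; apply: expansions_inv.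
Qed.

Lemma expansions_uniq_minus t u u' : expansions t u -> expansions t u' ->
  val (tminus u) = val (tminus u') -> u = u'.
Proof.
move=> /expansions_inv tu /expansions_inv tu' uu'.
by apply: (can_inj triple_invK); apply: expansions_uniq tu tu' uu'.
Qed.

Lemma tminus_strands t : nleaves (val (tminus t)) = strands t.
Proof. exact: (eqP (valP (tminus t))). Qed.

Lemma expansions_tminus_le t u : expansions t u ->
  tree_le (val (tminus t)) (val (tminus u)).
Proof. by move=> /expansions_inv/expansions_tree_le. Qed.

Lemma composable t u : val (tplus t) = val (tminus u) ->
  exists n (T : ntree n) p S q U, t = Triple T p S /\ u = Triple S q U.
Proof.
case: t u => [n T p S] [m S' q U] /= SS'.
have nm : n = m.
  have := tplus_strands (Triple T p S); rewrite /= SS'.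
  by rewrite (tminus_strands (Triple S' q U)).
subst m; have <- : S = S' by apply: val_inj.
by exists n, T, p, S, q, U.
Qed.

Lemma composable_l n (S : ntree n) t : val (tplus t) = val S ->
  exists T p, t = Triple T p S.
Proof.
case: t => [m T p S'] /= SS'.
have mn : m = n by have := eqP (valP S'); have := eqP (valP S); rewrite /= SS' => ->.
by subst m; have -> : S = S' by [exact: val_inj]; exists T, p.
Qed.

Lemma composable_r n (S : ntree n) u : val (tminus u) = val S ->
  exists q U, u = Triple S q U.
Proof.
move=> /(@composable_l _ _ (triple_inv u)) [U [q uE]].
by exists (q^-1)%g, U; rewrite -[u]triple_invK uE.
Qed.

Lemma expansions_mul n (T : ntree n) p S q U t' u' :
  expansions (Triple T p S) t' -> expansions (Triple S q U) u' ->
  val (tplus t') = val (tminus u') ->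
  exists n' (T' : ntree n') p' S' q' U',
    [/\ t' = Triple T' p' S', u' = Triple S' q' U' &
        expansions (Triple T (p * q)%g U) (Triple T' (p' * q')%g U')].
Proof.
move=> h1 h2 t'u'.
have [n' [T' [p' [S' [q' [U' [tE hu h]]]]]]] : exists n' (T' : ntree n') p' S' q' U',
    [/\ t' = Triple T' p' S', expansions (Triple S q U) (Triple S' q' U') &
        expansions (Triple T (p * q)%g U) (Triple T' (p' * q')%g U')].
  move: h1 => {u' h2 t'u'}; move tE: (Triple T p S) => t h1.
  elim: h1 n T p S q U tE => {t t'} [t|t v t' tv _ IH] n T p S q U tE.
    by exists n, T, p, S, q, U; split=> //; apply: rt1n_refl.
  case: tv tE IH => {}t k tE IH; subst t; move: k IH => /= k IH.
  have [n' [T' [p' [S' [q' [U' [t'E hu h]]]]]]] :=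
    IH _ _ _ _ (clone k q) (ngraft U k) erefl.
  exists n', T', p', S', q', U'; split=> //.
    by apply: rt1n_trans hu; apply: (@Expansion (Triple S q U)).
  apply: rt1n_trans h; rewrite -cloneM.
  exact: (@Expansion (Triple T (p * q)%g U)).
exists n', T', p', S', q', U'; split=> //.
by apply: expansions_uniq_minus h2 hu _; rewrite -t'u' tE.
Qed.

Definition triple_mul (t u : triple) : triple :=
  if strands u =P strands t is ReflectT E then
    Triple (tminus t) (tbraid t * ecast i (pure_braid i) E (tbraid u))%g
           (ecast i (ntree i) E (tplus u))
  else t.

Lemma triple_mulE n (T : ntree n) p S q U :
  triple_mul (Triple T p S) (Triple S q U) = Triple T (p * q)%g U.
Proof. by rewrite /triple_mul /=; case: eqP => // E; rewrite (eq_axiomK E). Qed.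

Lemma triple_eqv_mul n (T : ntree n) p S q U n' (T' : ntree n') p' S' q' U' :
  triple_eqv (Triple T p S) (Triple T' p' S') ->
  triple_eqv (Triple S q U) (Triple S' q' U') ->
  triple_eqv (Triple T (p * q)%g U) (Triple T' (p' * q')%g U').
Proof.
move=> /triple_eqvP[a [ta t'a]] /triple_eqvP[b [ub u'b]].
have [V [aV bV]] := tree_join (val (tplus a)) (val (tminus b)).
have [c ac cE] := expansions_to aV; have [d bd dE] := expansions_to_minus bV.
have cd : val (tplus c) = val (tminus d) by rewrite cE.
have [m [A [r [B [s [C [cE1 dE1 h]]]]]]] :=
  expansions_mul (expansions_trans ta ac) (expansions_trans ub bd) cd.
have [m' [A' [r' [B' [s' [C' [cE2 dE2 h']]]]]]] :=
  expansions_mul (expansions_trans t'a ac) (expansions_trans u'b bd) cd.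
apply/triple_eqvP; exists (Triple A (r * s)%g C); split=> //.
by rewrite -(triple_mulE A r B s C) -cE1 -dE1 cE2 dE2 triple_mulE.
Qed.

Lemma Fbr_mul_exists (x y : Fbr) : exists z : Fbr,
  exists n (T : ntree n) p S q U,
    [/\ x = Fbr_class (Triple T p S), y = Fbr_class (Triple S q U) &
        z = Fbr_class (Triple T (p * q)%g U)].
Proof.
have [V [xV yV]] := tree_join (val (tplus (repr x))) (val (tminus (repr y))).
have [t xt tE] := expansions_to xV; have [u yu uE] := expansions_to_minus yV.
have [|n [T [p [S [q [U [tE' uE']]]]]]] := @composable t u; first by rewrite tE.
exists (Fbr_class (Triple T (p * q)%g U)), n, T, p, S, q, U; rewrite -tE' -uE'.
by split=> //; rewrite -[LHS]Fbr_classK; apply/Fbr_classP/expansions_eqv.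
Qed.

(* The product is determined by [Fbr_mulE] below. *)
Definition Fbr_mul (x y : Fbr) : Fbr := projT1 (cid (Fbr_mul_exists x y)).

Lemma Fbr_mulE n (T : ntree n) p S q U :
  Fbr_mul (Fbr_class (Triple T p S)) (Fbr_class (Triple S q U))
  = Fbr_class (Triple T (p * q)%g U).
Proof.
rewrite /Fbr_mul; case: cid => _ /= [m [T' [p' [S' [q' [U' [/Fbr_classP xE /Fbr_classP yE ->]]]]]]].
by apply/esym/Fbr_classP/triple_eqv_mul; [exact: xE|exact: yE].
Qed.

Lemma Fbr_composable (x y : Fbr) : exists n (T : ntree n) p S q U,
  x = Fbr_class (Triple T p S) /\ y = Fbr_class (Triple S q U).
Proof.
have [z [n [T [p [S [q [U [xE yE _]]]]]]]] := Fbr_mul_exists x y.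
by exists n, T, p, S, q, U.
Qed.

Definition leaf1 : ntree 1 := exist _ Leaf isT.
Definition Fbr_one : Fbr := Fbr_class (Triple leaf1 1%g leaf1).
Definition Fbr_inv (x : Fbr) : Fbr := Fbr_class (triple_inv (repr x)).

Lemma Fbr_invE n (T : ntree n) p S :
  Fbr_inv (Fbr_class (Triple T p S)) = Fbr_class (Triple S p^-1%g T).
Proof.
apply/Fbr_classP; apply: (@triple_eqv_inv _ (Triple T p S)).
by apply/Fbr_classP; rewrite Fbr_classK.
Qed.

Lemma Fbr_oneE n (T : ntree n) : Fbr_class (Triple T 1%g T) = Fbr_one.
Proof.
have oneP t : expansions (Triple leaf1 1%g leaf1) t ->
    tminus t = tplus t /\ tbraid t = 1%g.
  move tE: (Triple leaf1 1%g leaf1) => u ut.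
  have : tminus u = tplus u /\ tbraid u = 1%g by rewrite -tE.
  elim: ut => // {tE} {}u v {}t uv _ IH [h1 h2]; apply: IH.
  by case: uv h1 h2 => {}u k /= -> ->; rewrite clone1.
have [t h tE] := @expansions_to (Triple leaf1 1%g leaf1) (val T) isT.
have [] := oneP _ h; have {h} := expansions_eqv h.
case: t tE => m A q B /= BT hm AB q1; subst A q.
have mn : m = n by have := eqP (valP B); have := eqP (valP T); rewrite /= BT => ->.
subst m; have -> : T = B by exact/esym/val_inj.
exact/esym/Fbr_classP.
Qed.

Lemma Fbr_mulA : associative Fbr_mul.
Proof.
move=> x y z.
have [n [T [p [S [q [U [-> yE]]]]]]] := Fbr_composable x y.
have [m [S' [q' [U' [r [W [yE' ->]]]]]]] := Fbr_composable y z.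
have /Fbr_classP/triple_eqvP[t [h1 h2]] :
    Fbr_class (Triple S q U) = Fbr_class (Triple S' q' U') by rewrite -yE.
have [x1 xh xE] := @expansions_to (Triple T p S) _ (expansions_tminus_le h1).
have [z1 zh zE] := @expansions_to_minus (Triple U' r W) _ (expansions_tree_le h2).
rewrite yE; have /Fbr_classP -> := expansions_eqv xh.
have /Fbr_classP -> := expansions_eqv h1.
have /Fbr_classP -> := expansions_eqv zh.
case: t {h1 h2} xE zE => k B b C /= xE zE.
have [A [a ->]] := composable_l xE; have [c [D ->]] := composable_r zE.
by rewrite !Fbr_mulE mulgA.
Qed.

Lemma Fbr_mul1 : left_id Fbr_one Fbr_mul.
Proof.
by move=> x; rewrite -[x]Fbr_classK; case: repr => n T p S; rewrite -(Fbr_oneE T) Fbr_mulE mul1g.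
Qed.

Lemma Fbr_mulr1 : right_id Fbr_one Fbr_mul.
Proof.
by move=> x; rewrite -[x]Fbr_classK; case: repr => n T p S; rewrite -(Fbr_oneE S) Fbr_mulE mulg1.
Qed.

Lemma Fbr_mulV : left_inverse Fbr_one Fbr_inv Fbr_mul.
Proof.
move=> x; rewrite -[x]Fbr_classK; case: repr => n T p S.
by rewrite Fbr_invE Fbr_mulE mulVg Fbr_oneE.
Qed.

Lemma Fbr_mulrV : right_inverse Fbr_one Fbr_inv Fbr_mul.
Proof.
move=> x; rewrite -[x]Fbr_classK; case: repr => n T p S.
by rewrite Fbr_invE Fbr_mulE mulgV Fbr_oneE.
Qed.

HB.instance Definition _ := isGroup.Build Fbr
  Fbr_mulA Fbr_mul1 Fbr_mulr1 Fbr_mulV Fbr_mulrV.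

(* Lengths of the paths from the root to the leftmost and rightmost leaves. *)
Fixpoint left_depth (t : tree) : nat :=
  if t is Node l _ then (left_depth l).+1 else 0.

Fixpoint right_depth (t : tree) : nat :=
  if t is Node _ r then (right_depth r).+1 else 0.

Lemma left_depth_graft t k : k < nleaves t ->
  left_depth (graft t k) = left_depth t + (k == 0).
Proof.
elim: t k => [|l IHl r _] k /=; first by case: k.
have := nleaves_gt0 l; case: ifP => kl /= l0 kn; first by rewrite IHl.
by case: k kl kn => [|k]; rewrite ?l0 //= addn0.
Qed.

Lemma right_depth_graft t k : k < nleaves t ->
  right_depth (graft t k) = right_depth t + (k.+1 == nleaves t).
Proof.
elim: t k => [|l _ r IHr] k /=; first by case: k.
have := nleaves_gt0 r; case: ifP => kl /= r0 kn.
  by rewrite (_ : _ == _ = false) ?addn0 //; lia.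
by rewrite IHr; [congr (_.+1 + nat_of_bool _)|]; lia.
Qed.

Local Open Scope ring_scope.

Section DepthCharacters.
Context (R : realType).

Definition triple_depth (d : tree -> nat) (t : triple) : R :=
  (d (val (tplus t)))%:R - (d (val (tminus t)))%:R.

Definition phi0 (x : Fbr) : R := triple_depth left_depth (repr x).
Definition phi1 (x : Fbr) : R := triple_depth right_depth (repr x).

Lemma triple_depth_eqv (d : tree -> nat) (c : nat -> nat -> nat) :
  (forall t k, (k < nleaves t)%N -> d (graft t k) = (d t + c (nleaves t) k)%N) ->
  forall t u, triple_eqv t u -> triple_depth d t = triple_depth d u.
Proof.
move=> dc t u; elim=> {t u} [_ _ [t k]|//|t u _ //|t u v _ -> _ //].
rewrite /triple_depth !dc ?tplus_strands ?tminus_strands //.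
by rewrite !natrD opprD addrACA subrr addr0.
Qed.

Lemma phi0E n (T : ntree n) p S : phi0 (Fbr_class (Triple T p S))
  = (left_depth (val S))%:R - (left_depth (val T))%:R.
Proof.
rewrite -[RHS]/(triple_depth left_depth (Triple T p S)).
apply: (triple_depth_eqv (c := fun _ k => nat_of_bool (k == 0%N)) left_depth_graft).
by apply/Fbr_classP; rewrite Fbr_classK.
Qed.

Lemma phi1E n (T : ntree n) p S : phi1 (Fbr_class (Triple T p S))
  = (right_depth (val S))%:R - (right_depth (val T))%:R.
Proof.
rewrite -[RHS]/(triple_depth right_depth (Triple T p S)).
apply: (triple_depth_eqv (c := fun m k => nat_of_bool (k.+1 == m)) right_depth_graft).
by apply/Fbr_classP; rewrite Fbr_classK.
Qed.

End DepthCharacters.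

Section CharacterSphere.
Context (R : realType) (G : groupType).

Definition is_character (chi : G -> R) : Prop :=
  forall g h, chi (g * h)%g = chi g + chi h.

(* For finitely generated [G] the topology of pointwise convergence on the
   characters is the usual topology of the finite-dimensional space Hom(G, R). *)
Definition nontrivial_characters : set {ptws G -> R} :=
  [set chi | is_character chi /\ exists g, chi g != 0].

Definition same_ray : rel nontrivial_characters :=
  fun chi psi => `[< exists2 c : R, 0 < c & forall g, val psi g = c * val chi g >].

Lemma same_ray_refl : reflexive same_ray.
Proof. by move=> chi; apply/asboolP; exists 1 => // g; rewrite mul1r. Qed.

Lemma same_ray_sym : symmetric same_ray.
Proof.
move=> chi psi; apply/asboolP/asboolP => -[c c0 E]; exists c^-1; rewrite ?invr_gt0 // => g;
by rewrite E mulKf // gt_eqF.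
Qed.

Lemma same_ray_trans : transitive same_ray.
Proof.
move=> psi chi xi /asboolP[c c0 E] /asboolP[d d0 F]; apply/asboolP.
by exists (d * c); rewrite ?mulr_gt0 // => g; rewrite F E mulrA.
Qed.

Canonical same_ray_equiv :=
  EquivRel same_ray same_ray_refl same_ray_sym same_ray_trans.

Definition character_sphere := quotient_topology {eq_quot same_ray_equiv}.
HB.instance Definition _ := Quotient.on character_sphere.
HB.instance Definition _ := Topological.on character_sphere.

Definition ray (chi : nontrivial_characters) : character_sphere :=
  \pi_character_sphere chi.

Lemma rayP chi psi : ray chi = ray psi <->
  exists2 c : R, 0 < c & forall g, val psi g = c * val chi g.
Proof. by split=> [/eqmodP/asboolP //|E]; apply/eqmodP/asboolP. Qed.

Definition generates (S : set G) : Prop :=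
  forall H : set G, H 1%g -> (forall g h, H g -> H h -> H (g * h)%g) ->
    (forall g, H g -> H g^-1%g) -> (S `<=` H)%classic -> H = setT.

(* [superlevel_edge] and [superlevel_connected]: the full subgraph of the Cayley
   graph of [S] spanned by the vertices with [0 <= chi], and its connectedness. *)
Definition superlevel_edge (S : set G) (chi : G -> R) (g h : G) : Prop :=
  [/\ 0 <= chi g, 0 <= chi h & exists2 s, S s & h = (g * s)%g].

Definition superlevel_connected (S : set G) (chi : G -> R) : Prop :=
  forall g h, 0 <= chi g -> 0 <= chi h ->
    clos_refl_sym_trans G (superlevel_edge S chi) g h.

Definition Sigma1 (S : set G) : set character_sphere :=
  [set ray chi | chi in [set chi | superlevel_connected S (val chi)]]%classic.

End CharacterSphere.

Arguments nontrivial_characters : clear implicits.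
Arguments Sigma1 R {G} S.

Definition homeomorphic (X Y : topologicalType) : Prop :=
  exists (f : X -> Y) (g : Y -> X),
    [/\ continuous f, continuous g, cancel f g & cancel g f].

Definition sphere (R : realType) (d : nat) : set 'rV[R]_d.+1 :=
  [set x | \sum_i x ord0 i ^+ 2 = 1]%classic.

Arguments sphere : clear implicits.

Section DepthPoints.
Context (R : realType).

Lemma phi0_character : is_character (@phi0 R).
Proof.
move=> x y; have [n [T [p [S [q [U [-> ->]]]]]]] := Fbr_composable x y.
by rewrite [(_ * _)%g]Fbr_mulE !phi0E [RHS]addrC addrA subrK.
Qed.

Lemma phi1_character : is_character (@phi1 R).
Proof.
move=> x y; have [n [T [p [S [q [U [-> ->]]]]]]] := Fbr_composable x y.
by rewrite [(_ * _)%g]Fbr_mulE !phi1E [RHS]addrC addrA subrK.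
Qed.

Definition caret_left : ntree 3 := exist _ (Node (Node Leaf Leaf) Leaf) isT.
Definition caret_right : ntree 3 := exist _ (Node Leaf (Node Leaf Leaf)) isT.

Lemma phi0_nontrivial : nontrivial_characters R Fbr (@phi0 R).
Proof.
split; first exact: phi0_character.
exists (Fbr_class (Triple caret_right 1%g caret_left)).
by rewrite phi0E /= -natrB // oner_eq0.
Qed.

Lemma phi1_nontrivial : nontrivial_characters R Fbr (@phi1 R).
Proof.
split; first exact: phi1_character.
exists (Fbr_class (Triple caret_left 1%g caret_right)).
by rewrite phi1E /= -natrB // oner_eq0.
Qed.

Definition phi0_point : character_sphere R Fbr :=
  ray (exist _ (@phi0 R) (mem_set phi0_nontrivial)).
Definition phi1_point : character_sphere R Fbr :=
  ray (exist _ (@phi1 R) (mem_set phi1_nontrivial)).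

End DepthPoints.

(* Main.v *)
(* Let K be the kernel of the projection onto Thompson's group F. A character on K amounts
   to a family of characters of the pure braid groups compatible with cloning. Since these
   groups are generated by conjugates of squares of crossings, such a family is determined
   by its values on pairs of strands, and cloning forces the values to be those of a
   combination of [omega] and [psi], which are twice the linking number of the two outer
   strands and twice the sum of the linking numbers of adjacent strands. So phi_0, phi_1, omega and psi are a basis
   of the space of characters.

   Fix a character chi and an element t with chi(t) > 0. The elements a for which t^M and
   a t^M can be joined arbitrarily high up, for large M, form a subgroup containing t, and
   whenever it contains some y with chi(y) <> 0 it contains the centralizer of y. If this
   subgroup is everything, then chi is in Sigma^1. When chi does not vanish on K, start
   from the full twist, which is central in the pure braid group, so that all of K is
   reached, and then the generators x_0 and x_1 of F. When chi = a phi_0 + b phi_1 with a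
   and b nonzero, use commuting elements of F. When only a is nonzero and negative, the
   conjugates of x_1 by powers of x_0 stay in a finitely generated subgroup of the kernel;
   the case of b is symmetric.

   Finally, if phi_0 >= 0 along a path of the Cayley graph starting from 1, then all
   elements on it act linearly on one fixed neighbourhood of 0, and likewise for phi_1. *)

From Stdlib Require Import Relation_Operators.
From mathcomp Require Import all_boot all_order all_algebra fingroup perm zify ring lra.
From mathcomp Require Import all_classical all_reals all_analysis.
Require Import Defs.

Set Implicit Arguments.
Unset Strict Implicit.
Unset Printing Implicit Defensive.

Import Order.TTheory GRing.Theory Num.Theory.
Import numFieldTopology.Exports.
Local Open Scope ring_scope.

(** * Paths in superlevel sets *)

Section SuperlevelPaths.
Context (R : realType) (G : groupType) (S : set G) (chi : G -> R).
Hypotheses (chiM : is_character chi) (genS : generates S).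
Implicit Types (g x y e : G) (H : R).

Lemma character1 : chi 1%g = 0.
Proof. by have := chiM 1%g 1%g; rewrite mulg1; lra. Qed.

Lemma characterV g : chi g^-1%g = - chi g.
Proof. by have := chiM g g^-1%g; rewrite mulgV character1; lra. Qed.

Lemma characterX g n : chi (g ^+ n)%g = chi g *+ n.
Proof.
by elim: n => [|n IHn]; rewrite ?expg0 ?character1 // expgS chiM IHn mulrS.
Qed.

Definition reach H := clos_refl_sym_trans G (superlevel_edge S (fun g => chi g - H)).

Lemma reach_refl H x : reach H x x. Proof. exact: rst_refl. Qed.
Lemma reach_sym H x y : reach H x y -> reach H y x. Proof. exact: rst_sym. Qed.
Lemma reach_trans H y x z : reach H x y -> reach H y z -> reach H x z.
Proof. exact: rst_trans. Qed.

Lemma reach_le H' H x y : H' <= H -> reach H x y -> reach H' x y.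
Proof.
move=> HH'; elim=> {x y} [x y [hx hy [s Ss sE]]|x|x y _ xy|x y z _ xy _ yz].
- by apply: rst_step; split; [lra|lra|exists s].
- exact: reach_refl.
- exact: reach_sym.
- exact: reach_trans xy yz.
Qed.

(** Left multiplication is an automorphism of the Cayley graph and shifts heights by [chi g]. *)
Lemma reach_mull H g x y : reach H x y -> reach (H + chi g) (g * x)%g (g * y)%g.
Proof.
elim=> {x y} [x y [hx hy [s Ss sE]]|x|x y _ xy|x y z _ xy _ yz].
- apply: rst_step; split; rewrite ?chiM; [lra|lra|exists s => //].
  by rewrite sE mulgA.
- exact: reach_refl.
- exact: reach_sym.
- exact: reach_trans xy yz.
Qed.

(** The constant bounds how far a path spelling [e] descends below its start. It depends on [e]
    alone, and the elements that have one form a subgroup containing [S]. *)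
Lemma reach_step e : exists c, forall H x, H + c <= chi x -> reach H x (x * e)%g.
Proof.
pose A := [set e | exists c, forall H x, H + c <= chi x -> reach H x (x * e)%g]%classic.
suff : A e by [].
rewrite (_ : A = setT) //; apply: genS.
- by exists 0 => H x _; rewrite mulg1; apply: reach_refl.
- move=> g h [c cP] [d dP]; exists (`|c| + `|d| + `|chi g|) => H x Hx.
  have := ler_norm c; have := ler_norm d; have := ler_norm (- chi g).
  have := normr_ge0 c; have := normr_ge0 d; have := normr_ge0 (chi g).
  rewrite normrN => *; rewrite mulgA; apply: (@reach_trans _ (x * g)%g).
    by apply: cP; lra.
  by apply: dP; rewrite chiM; lra.
- move=> g [c cP]; exists (c + chi g) => H x Hx.
  rewrite -{1}[x](mulgKV g); apply: reach_sym; apply: cP.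
  by rewrite chiM characterV; lra.
- move=> s Ss; exists (`|chi s|) => H x Hx.
  have := ler_norm (- chi s); have := normr_ge0 (chi s); rewrite normrN => *.
  by apply: rst_step; split; rewrite ?chiM; [lra|lra|exists s].
Qed.

(** Each successive copy of [t] starts no lower than the one before, so one constant serves all
    powers. *)
Lemma reach_steps t : 0 <= chi t ->
  exists c, forall H x M, H + c <= chi x -> reach H x (x * t ^+ M)%g.
Proof.
move=> t0; have [c cP] := reach_step t; exists c => H x M Hx.
elim: M => [|M IHM]; first by rewrite expg0 mulg1; apply: reach_refl.
apply: reach_trans IHM _; rewrite expgSr mulgA; apply: cP.
by rewrite chiM characterX; have := mulrn_wge0 M t0; lra.
Qed.

Section Stable.
Context (t : G) (t0 : 0 < chi t).

(* By Bieri, Neumann and Strebel, [chi] is in Sigma^1 iff every [a] has this property;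
   only one direction is used. *)
Definition stable (a : G) := forall H, exists M0, forall M, (M0 <= M)%N ->
  reach H (t ^+ M)%g (a * t ^+ M)%g.

Lemma archimed_mulrn (u v : R) : 0 < u -> exists n, forall m, (n <= m)%N -> v <= u *+ m.
Proof.
move=> u0; exists (Num.bound `|v / u|) => m nm.
rewrite -mulr_natr -ler_pdivrMl //.
apply: le_trans (_ : (Num.bound `|v / u|)%:R <= _); last by rewrite ler_nat.
rewrite mulrC; apply: le_trans (ler_norm _) _; apply/ltW.
by apply: archi_boundP.
Qed.

Lemma stable1 : stable 1%g.
Proof. by move=> H; exists 0%N => M _; rewrite mul1g; apply: reach_refl. Qed.

Lemma stableM a b : stable a -> stable b -> stable (a * b)%g.
Proof.
move=> sa sb H; have [M1 h1] := sa H; have [M2 h2] := sb (H - chi a).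
exists (maxn M1 M2) => M; rewrite geq_max => /andP[/h1 h /h2 h'].
apply: reach_trans h _; rewrite -mulgA.
by have := reach_mull a h'; rewrite subrK.
Qed.

Lemma stableV a : stable a -> stable a^-1%g.
Proof.
move=> sa H; have [M1 h1] := sa (H + chi a).
exists M1 => M /h1 /(reach_mull a^-1%g).
by rewrite mulKg characterV addrK => /reach_sym.
Qed.

Lemma stable_self : stable t.
Proof.
move=> H; have [c cP] := reach_step t; have [M0 h] := archimed_mulrn (H + c) t0.
by exists M0 => M /h hM; rewrite -expgS expgSr; apply: cP; rewrite characterX.
Qed.

Lemma stableX a n : stable a -> stable (a ^+ n)%g.
Proof. by move=> sa; elim: n => [|n IHn]; [apply: stable1|rewrite expgS; apply: stableM]. Qed.

(** A path from [t ^+ M] to [y * t ^+ M] only rises when translated by powers of [y]. The translates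
    lead to [y ^+ j * t ^+ M], and the power of [t] can be removed high up because [y ^+ j] is high
    already. *)
Lemma stable_reach y H : stable y -> 0 < chi y ->
  exists M0, forall M j, (M0 <= M)%N -> (M0 <= j)%N -> reach H (t ^+ M)%g (y ^+ j)%g.
Proof.
move=> sy y0; have [M1 h1] := sy H; have [c cP] := reach_steps (ltW t0).
have [M2 h2] := archimed_mulrn (H + c) y0.
exists (maxn M1 M2) => M j; rewrite !geq_max => /andP[MM1 _] /andP[_ jM2].
apply: (@reach_trans _ (y ^+ j * t ^+ M)%g); last first.
  by apply/reach_sym/cP; rewrite characterX h2.
elim: (j) => [|i IHi]; first by rewrite mul1g; apply: reach_refl.
apply: reach_trans IHi _; have := reach_mull (y ^+ i)%g (h1 _ MM1).
rewrite expgSr -mulgA; apply: reach_le.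
by rewrite characterX; have := mulrn_wge0 i (ltW y0); lra.
Qed.

(** With [chi y] positive, the path goes from [t ^+ M] to [y ^+ M0], then to [y ^+ M0 * a], which is
    [a * y ^+ M0], and along an [a]-translate to [a * t ^+ M]. *)
Lemma stable_commute y a : stable y -> chi y != 0 -> commute a y -> stable a.
Proof.
wlog y0 : y / 0 < chi y => [W|] sy yn ay.
  have [/(W y)|] := ltP 0 (chi y); first exact.
  rewrite le_eqVlt (negPf yn) /= => y0; apply: (W y^-1%g).
  - by rewrite characterV oppr_gt0.
  - exact: stableV.
  - by rewrite characterV oppr_eq0.
  - exact: commuteV.
move=> H; have [M1 h1] := stable_reach H sy y0.
have [M2 h2] := stable_reach (H - chi a) sy y0.
have [c cP] := reach_step a; have [M3 h3] := archimed_mulrn (H + c) y0.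
pose M0 := maxn M1 (maxn M2 M3); have [m1 m2 m3] : [/\ (M1 <= M0)%N, (M2 <= M0)%N & (M3 <= M0)%N].
  by rewrite /M0; split; lia.
exists M0 => M M0M; apply: reach_trans (h1 M M0 _ m1) _; first by lia.
apply: (@reach_trans _ (a * y ^+ M0)%g); last first.
  have := reach_mull a (h2 M M0 _ m2); rewrite subrK => /(_ _)/reach_sym; apply; lia.
have -> : (a * y ^+ M0 = y ^+ M0 * a)%g by apply: commuteX.
by apply: cP; rewrite characterX h3.
Qed.

(* The conjugates of [a] by the powers of [t] all lie in the subgroup generated by [a]
   and [t^-1 a t], on which [chi] vanishes: paths in it stay at bounded depth. *)
Lemma stable_descending a : chi a = 0 ->
  (forall n, commute (t * a^-1)%g (t ^- n.+1 * a * t ^+ n.+1)%g) -> stable a.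
Proof.
move=> a0 ta; pose b := (t^-1 * a * t)%g.
(* Commuting with [t * a^-1] means that conjugation by [t] and by [a] agree on these conjugates of
   [a]. *)
have shift n : (t ^- n.+1 * a * t ^+ n.+1 = a ^- n * b * a ^+ n)%g.
  elim: n => [|n IHn]; first by rewrite invg1 expg1 mul1g mulg1.
  have -> : (t ^- n.+2 * a * t ^+ n.+2 = t^-1 * (t ^- n.+1 * a * t ^+ n.+1) * t)%g.
    by rewrite (expgSr t n.+1) invMg !mulgA.
  have E := ta n; rewrite /commute in E.
  have -> : (t^-1 * (t ^- n.+1 * a * t ^+ n.+1) * t
      = a^-1 * (t ^- n.+1 * a * t ^+ n.+1) * a)%g.
    set w := (t ^- n.+1 * a * t ^+ n.+1)%g in E *.
    apply: (mulgI t); apply: (mulIg a^-1%g).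
    by move: E; rewrite !mulgA mulgV mul1g mulgK => ->.
  by rewrite IHn expgSr invMg !mulgA.
have b0 : chi b = 0 by rewrite /b !chiM characterV a0; lra.
have a0' : 0 <= chi a by rewrite a0.
have av0 : 0 <= chi a^-1%g by rewrite characterV a0 oppr0.
have [c1 h1] := reach_steps a0'; have [c2 h2] := reach_steps av0.
have [c3 h3] := reach_step b => H.
pose c := `|c1| + `|c2| + `|c3|.
have [M0 M0P] := archimed_mulrn (H + c) t0; exists M0.+1 => -[//|M] M0M.
have HM : H + c <= chi (t ^+ M.+1)%g by rewrite characterX M0P //; lia.
have := ler_norm c1; have := ler_norm c2; have := ler_norm c3.
have := normr_ge0 c1; have := normr_ge0 c2; have := normr_ge0 c3.
move=> ? ? ? ? ? ?; rewrite /c in HM.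
have -> : (a * t ^+ M.+1 = t ^+ M.+1 * a^-1 ^+ M * b * a ^+ M)%g.
  by rewrite -2!(mulgA (t ^+ M.+1)%g) expVgn -shift !mulgA mulgV mul1g.
have e1 : chi (t ^+ M.+1 * a^-1 ^+ M)%g = chi (t ^+ M.+1)%g.
  by rewrite expVgn chiM characterV (characterX a) a0 mul0rn oppr0 addr0.
apply: reach_trans (h2 _ _ M _) _; first by lra.
apply: reach_trans (h3 _ _ _) _; first by rewrite e1; lra.
by apply: h1; rewrite chiM e1 b0; lra.
Qed.

Lemma stable_connected : (forall a, stable a) -> superlevel_connected S chi.
Proof.
move=> st; have [s [Ss s0]] : exists s, S s /\ chi s != 0.
  apply: contrapT => /forallNP no.
  suff E : [set g | chi g = 0]%classic = setT.
    have : [set g | chi g = 0]%classic t by rewrite E.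
    by move=> /= tE; move: t0; rewrite tE ltxx.
  apply: genS => [|g h|g|g Sg] /=; first exact: character1.
  - by rewrite chiM => -> ->; rewrite addr0.
  - by rewrite characterV => ->; rewrite oppr0.
  - by have /not_andP[//|/negP/negPn/eqP] := no g.
(* Single edges along [u] never descend, whereas a path from [reach_step] may dip by a constant and
   leave the superlevel set near height 0. *)
pose u := if 0 < chi s then s else s^-1%g.
have u0 : 0 < chi u.
  rewrite /u; case: ifPn => //; rewrite -leNgt => h.
  by rewrite characterV oppr_gt0 lt_neqAle s0.
have uP x : 0 <= chi x -> reach 0 x (x * u)%g.
  have := u0; rewrite /u; case: ifP => _ p0 x0.
    by apply: rst_step; split; rewrite ?chiM; [lra|lra|exists s].
  apply/rst_sym/rst_step; move: p0; rewrite characterV => p0.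
  by split; rewrite ?chiM ?characterV; [lra|lra|exists s; rewrite ?mulgKV].
have uPn x n : 0 <= chi x -> reach 0 x (x * u ^+ n)%g.
  move=> x0; elim: n => [|n IHn]; first by rewrite mulg1; apply: reach_refl.
  apply: reach_trans IHn _; rewrite expgSr mulgA; apply: uP.
  by rewrite chiM characterX; have := mulrn_wge0 n (ltW u0); lra.
have [c cP] := reach_steps (ltW t0); have [N NP] := archimed_mulrn c u0.
have {}NP := NP N (leqnn N).
(* [N] steps along [u] give the room that the steps along [t] need; stability of [u ^+ N] then
   removes them at the top. *)
have up x : 0 <= chi x -> exists M0, forall M, (M0 <= M)%N -> reach 0 x (x * t ^+ M)%g.
  move=> x0; have [M0 h] := stableX N (st u) 0; exists M0 => M M0M.
  apply: reach_trans (uPn _ N x0) _.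
  apply: (@reach_trans _ (x * u ^+ N * t ^+ M)%g).
    by apply: cP; rewrite chiM characterX; lra.
  rewrite -mulgA; apply/reach_sym; apply: reach_le (reach_mull x (h _ M0M)).
  by rewrite add0r.
move=> g h g0 h0; have [M1 h1] := up g g0; have [M2 h2] := up h h0.
have [M3 h3] := st (g^-1 * h)%g 0; pose M := maxn M1 (maxn M2 M3).
suff : reach 0 g h.
  rewrite /reach; congr (clos_refl_sym_trans _ _ _ _).
  by apply/funext => x; apply/funext => y; rewrite /superlevel_edge !subr0.
apply: reach_trans (h1 M _) _; first by rewrite /M; lia.
apply: (@reach_trans _ (h * t ^+ M)%g); last by apply/reach_sym/h2; rewrite /M; lia.
have := reach_mull g (h3 M _); rewrite mulgA mulKVg => /(_ _) h'.
by apply: reach_le (h' _); rewrite ?add0r // /M; lia.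
Qed.

End Stable.

Lemma exists_stable y : chi y != 0 -> exists2 t, 0 < chi t & stable t y.
Proof.
move=> y0; have [|yp] := ltP 0 (chi y); first by exists y => //; apply: stable_self.
have yV : 0 < chi y^-1%g by rewrite characterV oppr_gt0 lt_neqAle y0.
by exists y^-1%g => //; rewrite -[X in stable _ X]invgK; apply/stableV/stable_self.
Qed.

End SuperlevelPaths.
(** * Generators of the group *)

Lemma class_expand n (T : ntree n) p S k :
  Fbr_class (Triple (ngraft T k) (clone k p) (ngraft S k)) = Fbr_class (Triple T p S).
Proof. by apply/Fbr_classP/rst_sym/rst_step; apply: (@Expansion (Triple T p S)). Qed.

Lemma class_mul n (T : ntree n) p S q U :
  (Fbr_class (Triple T p S) * Fbr_class (Triple S q U))%g = Fbr_class (Triple T (p * q)%g U).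
Proof. exact: Fbr_mulE. Qed.

Lemma class_inv n (T : ntree n) p S :
  ((Fbr_class (Triple T p S))^-1)%g = Fbr_class (Triple S p^-1%g T).
Proof. exact: Fbr_invE. Qed.

(** Trivial braids give the copy of Thompson's group F; [pure_elt] gives the elements of the kernel
    K. *)
Definition tree_pair n (T S : ntree n) : Fbr := Fbr_class (Triple T 1%g S).
Definition pure_elt n (T : ntree n) (p : pure_braid n) : Fbr := Fbr_class (Triple T p T).

Lemma tree_pair_mul n (T S U : ntree n) :
  (tree_pair T S * tree_pair S U)%g = tree_pair T U.
Proof. by rewrite /tree_pair class_mul mulg1. Qed.

Lemma tree_pair1 n (T : ntree n) : tree_pair T T = 1%g.
Proof. exact: Fbr_oneE. Qed.

Lemma tree_pairV n (T S : ntree n) : ((tree_pair T S)^-1)%g = tree_pair S T.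
Proof. by rewrite /tree_pair class_inv invg1. Qed.

Lemma tree_pair_graft n (T S : ntree n) k : tree_pair (ngraft T k) (ngraft S k) = tree_pair T S.
Proof. by rewrite /tree_pair -(class_expand _ _ _ k) clone1. Qed.

Lemma pure_elt_graft n (T : ntree n) p k : pure_elt (ngraft T k) (clone k p) = pure_elt T p.
Proof. exact: class_expand. Qed.

Lemma pure_eltM n (T : ntree n) p q : pure_elt T (p * q)%g = (pure_elt T p * pure_elt T q)%g.
Proof. by rewrite /pure_elt class_mul. Qed.

Lemma class_decomp n (T : ntree n) p S :
  Fbr_class (Triple T p S) = (pure_elt T p * tree_pair T S)%g.
Proof. by rewrite /pure_elt /tree_pair class_mul mulg1. Qed.

Lemma pure_eltJ n (T S : ntree n) p :
  pure_elt T p = (tree_pair T S * pure_elt S p * (tree_pair T S)^-1)%g.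
Proof. by rewrite tree_pairV /pure_elt /tree_pair !class_mul mul1g mulg1. Qed.

(** Doubling either of two parallel copies gives three parallel copies, by the same word letter for
    letter. *)
Lemma clone_word_lo_hi n (k : 'I_n) (w : word 'I_n.-1) :
  @clone_word n.+1 (@ord_lo n.+1 k) (clone_word k w)
  = @clone_word n.+1 (@ord_hi n.+1 k) (clone_word k w).
Proof.
elim: w k => //= l w IHw k; rewrite !clone_word_cat clone_letter_lo clone_letter_hi IHw.
congr cat; case: l => i e; rewrite /clone_letter.
split_lia; rewrite /= /clone_letter ?letter_pos_val /=; split_lia => //=.
all: by do ?[congr cons]; congr pair; apply: ord_inj.
Qed.

Lemma clone_lo_hi n (k : 'I_n) (p : pure_braid n) :
  @clone n.+1 (@ord_lo n.+1 k) (clone k p) = @clone n.+1 (@ord_hi n.+1 k) (clone k p).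
Proof.
apply: val_inj => /=; case: p => p _ /=.
by rewrite -[p]of_wordK !clone_braidE clone_word_lo_hi.
Qed.

(* The copy of the generator [x_0] of Thompson's group F supported below leaf [k]. *)
Definition leaf_rot n (T : ntree n) (k : 'I_n) : Fbr :=
  tree_pair (@ngraft n.+1 (ngraft T k) (@ord_lo n.+1 k))
            (@ngraft n.+1 (ngraft T k) (@ord_hi n.+1 k)).

(** Doubling strand [k] twice represents the pure element over both trees of the rotation, with the
    same braid by [clone_lo_hi]. *)
Lemma leaf_rot_commute n (T : ntree n) p k : commute (leaf_rot T k) (pure_elt T p).
Proof.
rewrite /commute -(pure_elt_graft T p k).
rewrite -{1}(pure_elt_graft _ _ (@ord_hi n.+1 k)) -(pure_elt_graft _ _ (@ord_lo n.+1 k)).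
by rewrite clone_lo_hi /leaf_rot /tree_pair /pure_elt !class_mul mul1g mulg1.
Qed.

Lemma leaf_rot_graft n (T : ntree n) (j k : 'I_n) : j != k ->
  leaf_rot (ngraft T j) (ord_up j k) = leaf_rot T k.
Proof.
move=> jk; have kj : k != j by rewrite eq_sym.
rewrite /leaf_rot; set A := ngraft (ngraft T k) _; set B := ngraft (ngraft T k) _.
rewrite -(tree_pair_graft A B (@ord_up n.+1 (@ord_lo n.+1 k) (ord_up k j))).
move: jk; rewrite -val_eqE /= => jk.
have nlo : ord_up k j != @ord_lo n.+1 k.
  by apply/eqP=> /(congr1 (@nat_of_ord _)); rewrite ord_up_val /=; split_lia; lia.
have nhi : ord_up k j != @ord_hi n.+1 k.
  by apply/eqP=> /(congr1 (@nat_of_ord _)); rewrite ord_up_val /=; split_lia; lia.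
rewrite /A (ngraftC (ngraft T k) nlo) (ngraftC T jk).
have -> : @ord_up n.+1 (@ord_lo n.+1 k) (ord_up k j) = @ord_up n.+1 (@ord_hi n.+1 k) (ord_up k j).
  by apply: ord_inj; rewrite !ord_up_val /= ?ord_up_val; split_lia; lia.
rewrite /B (ngraftC (ngraft T k) nhi) (ngraftC T jk).
by congr (tree_pair (ngraft _ _) (ngraft _ _)); apply: ord_inj;
  rewrite !ord_up_val /= ?ord_up_val /bump; split_lia; lia.
Qed.

(** * Right combs and the standard generators of Thompson's group F *)

Fixpoint right_comb_tree m := if m is m'.+1 then Node Leaf (right_comb_tree m') else Leaf.

Lemma nleaves_right_comb m : nleaves (right_comb_tree m) == m.+1.
Proof. by elim: m => //= m /eqP ->. Qed.

Definition right_comb m : ntree m.+1 := exist _ (right_comb_tree m) (nleaves_right_comb m).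

Lemma right_combS m : right_comb m.+1 = ngraft (right_comb m) ord_max.
Proof. by apply: val_inj => /=; elim: m => //= m ->; rewrite subSS subn0. Qed.

Definition comb_rot m (k : nat) : Fbr :=
  tree_pair (ngraft (right_comb m) (inord k)) (right_comb m.+1).

Lemma comb_rot_max m : comb_rot m m = 1%g.
Proof.
rewrite /comb_rot right_combS; have -> : inord m = ord_max :> 'I_m.+1.
  by apply: ord_inj; rewrite inordK.
exact: tree_pair1.
Qed.

(** The generator x_k of F, over the smallest comb where the pair is not trivial. *)
Definition xgen k := comb_rot k.+1 k.

Lemma comb_rotE m k : (k < m)%N -> comb_rot m k = xgen k.
Proof.
elim: m => // m IHm; rewrite ltnS leq_eqVlt => /orP[/eqP-> //|km].
rewrite -(IHm km) /comb_rot.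
rewrite -(tree_pair_graft (ngraft (right_comb m) (inord k)) _ ord_max) -right_combS; congr tree_pair.
apply: val_inj; rewrite right_combS !val_ngraft /= !inordK; try lia.
by rewrite graftC_lt // (eqP (nleaves_right_comb m)).
Qed.

Lemma xgen_rel j k : (j < k)%N -> (xgen k * xgen j = xgen j * xgen k.+1)%g.
Proof.
move=> jk; rewrite -[in LHS](@comb_rotE k.+2 j); last by lia.
rewrite -[in RHS](@comb_rotE k.+1 j); last by lia.
rewrite [in RHS]/comb_rot -(tree_pair_graft (ngraft _ _) _ (inord k.+1)) /xgen /comb_rot.
rewrite tree_pair_mul.
rewrite -(tree_pair_graft (ngraft _ (inord k)) _ (inord j)).
rewrite tree_pair_mul; congr tree_pair.
rewrite -/(right_comb_tree k.+1).
apply: val_inj; rewrite !val_ngraft !inordK; try lia.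
by rewrite graftC_lt // (eqP (nleaves_right_comb k.+1)); lia.
Qed.

Lemma tree_is_graft t : t <> Leaf ->
  exists t' k, (k < nleaves t')%N /\ t = graft t' k.
Proof.
elim: t => // l IHl r IHr _; have [lE|/IHl[l' [k [kl ->]]]] := pselect (l = Leaf).
  have [rE|/IHr[r' [k [kr ->]]]] := pselect (r = Leaf).
    by exists Leaf, 0%N; rewrite lE rE.
  by exists (Node l r'), k.+1; rewrite lE /=; split=> //; rewrite subSS subn0.
exists (Node l' r), k; rewrite /= kl; split=> //; lia.
Qed.

(** A tree with more than one leaf is a smaller tree with a caret at some leaf [k]. Attaching this
    caret to the comb instead splits off one factor [comb_rot n k], which is [xgen k] or trivial. *)
Lemma tree_pair_ind (P : Fbr -> Prop) :
  (forall g h, P g -> P h -> P (g * h)%g) -> (forall g, P g -> P g^-1%g) ->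
  (forall k, P (xgen k)) -> forall n (T S : ntree n), P (tree_pair T S).
Proof.
move=> PM PV Px; have P1 : P 1%g by rewrite -(mulgV (xgen 0)); apply: (PM) => //; apply: PV.
have Pcomb n (T : ntree n.+1) : P (tree_pair T (right_comb n)).
  elim: n T => [|n IHn] T.
    have -> : T = right_comb 0; last by rewrite tree_pair1.
    apply: val_inj; case: T => -[|l r] //= /eqP.
    by have := nleaves_gt0 l; have := nleaves_gt0 r; lia.
  have Tn := eqP (valP T).
  have [TL|t' [k [kt' tE]]] := @tree_is_graft (val T); first by rewrite TL in Tn.
  have t'n : nleaves t' == n.+1 by move: Tn; rewrite tE nleaves_graft // => -[->].
  pose T' : ntree n.+1 := exist _ t' t'n.
  have kn : (k < n.+1)%N by rewrite -(eqP t'n).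
  have -> : T = ngraft T' (inord k) by apply: val_inj; rewrite val_ngraft inordK.
  rewrite -(tree_pair_mul _ (ngraft (right_comb n) (inord k))) tree_pair_graft.
  apply: PM => //; rewrite -/(comb_rot n k).
  by move: kn; rewrite ltnS leq_eqVlt => /orP[/eqP->|/comb_rotE->]; rewrite ?comb_rot_max.
case=> [|n] T S; first by exfalso; have := nleaves_gt0 (val T); rewrite (eqP (valP T)).
rewrite -(tree_pair_mul _ (right_comb n)) -(tree_pairV S).
by apply: PM => //; apply: PV.
Qed.

Lemma Fbr_ind (P : Fbr -> Prop) :
  (forall g h, P g -> P h -> P (g * h)%g) -> (forall g, P g -> P g^-1%g) ->
  (forall n (T : ntree n) p, P (pure_elt T p)) -> (forall k, P (xgen k)) ->
  forall g, P g.
Proof.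
move=> PM PV Pp Px g; rewrite -[g]Fbr_classK; case: (generic_quotient.repr g) => n T p S.
by rewrite class_decomp; apply: (PM) => //; apply: tree_pair_ind.
Qed.

(** Conjugation by [xgen i] and by [xgen j] both carry [xgen k] to [xgen k.+1]. *)
Lemma xgen_commute i j k : (i < k)%N -> (j < k)%N -> commute (xgen k) (xgen i * (xgen j)^-1)%g.
Proof.
move=> /xgen_rel ik /xgen_rel jk; rewrite /commute mulgA ik -!mulgA; congr (_ * _)%g.
have -> : xgen k = (xgen j * xgen k.+1 * (xgen j)^-1)%g by rewrite -jk mulgK.
by rewrite -mulgA mulKg.
Qed.

Lemma xgen_conj n : (xgen 0 ^- n * xgen 1 * xgen 0 ^+ n)%g = xgen n.+1.
Proof.
elim: n => [|n IHn]; first by rewrite invg1 mul1g mulg1.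
have -> : (xgen 0 ^- n.+1 * xgen 1 * xgen 0 ^+ n.+1
    = (xgen 0)^-1 * (xgen 0 ^- n * xgen 1 * xgen 0 ^+ n) * xgen 0)%g.
  by rewrite expgSr invMg !mulgA.
by rewrite IHn -mulgA xgen_rel // mulKg.
Qed.

Lemma pure_elt_le n (T : ntree n) p V : tree_le (val T) V ->
  forall m (T' : ntree m), val T' = V -> exists p', pure_elt T p = pure_elt T' p'.
Proof.
have [d] := ubnP (nleaves V - n); elim: d n T p => // d IHd n T p nd TV m T' T'V.
have Tn := eqP (valP T); have [TE|TE] := pselect (val T = V).
  have mn : m = n by rewrite -Tn TE -T'V (eqP (valP T')).
  by subst m; exists p; congr pure_elt; apply: val_inj; rewrite T'V.
have [k kn kV] := tree_lt_graft TV TE; rewrite Tn in kn.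
have := tree_le_nleaves kV; rewrite nleaves_graft Tn // => nV.
have [|p' E] := IHd n.+1 (ngraft T (Ordinal kn)) (clone (Ordinal kn) p) _ kV m T' T'V.
  by lia.
by exists p'; rewrite -E pure_elt_graft.
Qed.

(** K is normal: over a common expansion the trees match up and only a product of pure braids
    remains. *)
Lemma pure_elt_normal g n (T : ntree n) p :
  exists m (T' : ntree m) p', (g^-1 * pure_elt T p * g)%g = pure_elt T' p'.
Proof.
rewrite -[g]Fbr_classK; set t := generic_quotient.repr g.
have [V [TV tV]] := tree_join (val T) (val (tminus t)).
have [u tu uV] := expansions_to_minus tV.
have /Fbr_classP -> := expansions_eqv tu; case: u tu uV => m A q B /= _ AV.
have [p' ->] := pure_elt_le p TV AV.
by exists m, B, (q^-1 * p' * q)%g; rewrite /pure_elt class_inv !class_mul.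
Qed.

Lemma phi0_tree_pair (R : realType) n (T S : ntree n) : phi0 R (tree_pair T S)
  = (left_depth (val S))%:R - (left_depth (val T))%:R.
Proof. exact: phi0E. Qed.

Lemma phi1_tree_pair (R : realType) n (T S : ntree n) : phi1 R (tree_pair T S)
  = (right_depth (val S))%:R - (right_depth (val T))%:R.
Proof. exact: phi1E. Qed.

Lemma phi0_pure_elt (R : realType) n (T : ntree n) p : phi0 R (pure_elt T p) = 0.
Proof. by rewrite phi0E subrr. Qed.

Lemma phi1_pure_elt (R : realType) n (T : ntree n) p : phi1 R (pure_elt T p) = 0.
Proof. by rewrite phi1E subrr. Qed.

Lemma phi0_xgen (R : realType) k : phi0 R (xgen k) = - (k == 0%N)%:R.
Proof.
rewrite phi0_tree_pair val_ngraft left_depth_graft /= ?inordK //; last first.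
  by rewrite (eqP (nleaves_right_comb k)).
by rewrite natrD opprD addrA subrr sub0r.
Qed.

Lemma phi1_xgen (R : realType) k : phi1 R (xgen k) = 1.
Proof.
rewrite phi1_tree_pair val_ngraft right_depth_graft /= ?inordK //; last first.
  by rewrite (eqP (nleaves_right_comb k)).
rewrite (eqP (nleaves_right_comb k)) eqSS (ltn_eqF (ltnSn k)) addn0.
by rewrite -natrB ?leqnSn // subSnn.
Qed.

Lemma phi0_leaf_rot0 (R : realType) n (T : ntree n.+1) : phi0 R (leaf_rot T ord0) = -1.
Proof.
have Tn := eqP (valP T).
rewrite phi0_tree_pair !val_ngraft !left_depth_graft //= ?nleaves_graft ?Tn //.
by rewrite addn0 !natrD; lra.
Qed.

Lemma phi1_leaf_rot0 (R : realType) n (T : ntree n.+2) : phi1 R (leaf_rot T ord0) = 0.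
Proof.
have Tn := eqP (valP T).
by rewrite phi1_tree_pair !val_ngraft !right_depth_graft //= ?nleaves_graft ?Tn // subrr.
Qed.

Lemma phi1_leaf_rot_max (R : realType) n (T : ntree n.+1) : phi1 R (leaf_rot T ord_max) = 1.
Proof.
have Tn := eqP (valP T).
rewrite phi1_tree_pair !val_ngraft !right_depth_graft //= ?nleaves_graft ?Tn //.
by rewrite (ltn_eqF (ltnSn n.+1)) !eqxx /= !natrD; lra.
Qed.

Definition caret : ntree 2 := exist _ (Node Leaf Leaf) isT.

Lemma xgen1_leaf_rot : xgen 1 = leaf_rot caret ord_max.
Proof.
by rewrite /xgen /comb_rot /leaf_rot; congr tree_pair; apply: val_inj; rewrite /= ?inordK.
Qed.

(** Over three leaves, as also in [leaf_rot0_3], so that the rotation commutes with a twist on three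
    strands too. *)
Lemma xgen1_leaf_rot3 : xgen 1 = leaf_rot caret_left ord_max.
Proof.
rewrite xgen1_leaf_rot -(@leaf_rot_graft 2 caret ord0 ord_max) //.
have -> : ngraft caret ord0 = caret_left by apply: val_inj.
by congr leaf_rot; apply: ord_inj; rewrite ord_up_val.
Qed.

Lemma leaf_rot0_3 : leaf_rot caret ord0 = leaf_rot caret_right ord0.
Proof.
rewrite -(@leaf_rot_graft 2 caret ord_max ord0) //.
have -> : ngraft caret ord_max = caret_right by apply: val_inj.
by congr leaf_rot; apply: ord_inj; rewrite ord_up_val.
Qed.

(* The two ways round the pentagon of rotations of trees with four leaves. *)
Lemma xgen_pentagon : (leaf_rot caret ord0 * xgen 0 * xgen 1 = xgen 0 * xgen 0)%g.
Proof.
have x0l : xgen 0 = tree_pair caret_left caret_right.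
  by rewrite /xgen /comb_rot; congr tree_pair; apply: val_inj; rewrite /= ?inordK.
rewrite x0l -[in LHS](tree_pair_graft _ _ (@Ordinal 3 1 isT)).
have -> : (tree_pair caret_left caret_right * tree_pair caret_left caret_right)%g
  = (tree_pair (ngraft caret_left (@Ordinal 3 0 isT)) (ngraft caret_right (@Ordinal 3 0 isT))
     * tree_pair (ngraft caret_left (@Ordinal 3 2 isT)) (ngraft caret_right (@Ordinal 3 2 isT)))%g.
  by rewrite !tree_pair_graft.
have -> : xgen 1 = tree_pair (ngraft caret_right (@Ordinal 3 1 isT)) (right_comb 3).
  by rewrite /xgen /comb_rot; congr tree_pair; apply: val_inj; rewrite /= ?inordK.
have -> : leaf_rot caret ord0 = tree_pair (ngraft caret_left (@Ordinal 3 0 isT))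
    (ngraft caret_left (@Ordinal 3 1 isT)).
  by congr tree_pair; apply: val_inj.
have -> : ngraft caret_left (@Ordinal 3 2 isT) = ngraft caret_right (@Ordinal 3 0 isT).
  exact: val_inj.
rewrite !tree_pair_mul; congr tree_pair; exact: val_inj.
Qed.
(** * Pure braids as products of conjugated squares *)

Lemma mulg_conj_eq (G : groupType) (x u y z : G) :
  (u * y = z * u -> x * u * y * (x * u)^-1 = x * z * x^-1)%g.
Proof. by move=> uy; rewrite -(mulgA x) uy invMg !mulgA mulgK. Qed.

Lemma commute_conj (G : groupType) (g x y : G) :
  commute x y -> commute (g * x * g^-1)%g (g * y * g^-1)%g.
Proof. by move=> xy; rewrite /commute !mulgA !mulgKV -(mulgA g x) xy mulgA. Qed.

Section BraidSquares.
Context (n : nat).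
Implicit Types (i j m l : nat) (b u v q h : braid n) (k : 'I_n).
Local Open Scope group_scope.

(* Out of range, [sg i] is the identity. *)
Definition sg i : braid n := if insub i is Some j then sigma j false else 1.

Definition sgb i (e : bool) : braid n := if e then (sg i)^-1 else sg i.

Lemma sgE (i : 'I_n.-1) : sg i = sigma i false.
Proof. by rewrite /sg valK. Qed.

Lemma sgbE (i : 'I_n.-1) e : sgb i e = sigma i e.
Proof. by rewrite /sgb sgE; case: e; rewrite // -sigmaV. Qed.

Lemma sg_comm i j : (i.+1 < j)%N -> commute (sg i) (sg j).
Proof.
move=> ij; rewrite /sg; case: insubP => [i' _ iE|_]; last exact/commute_sym/commute1.
case: insubP => [j' _ jE|_]; last exact: commute1.
by apply: sigma_comm; rewrite iE jE ij.
Qed.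

Lemma sg_braid i : (i.+1 < n.-1)%N -> sg i * sg i.+1 * sg i = sg i.+1 * sg i * sg i.+1.
Proof.
move=> ij; have i1 : (i < n.-1)%N by apply: ltnW.
rewrite -[i.+1]/(nat_of_ord (Ordinal ij)) -[in sg i]/(nat_of_ord (Ordinal i1)) !sgE.
exact: sigma_braid.
Qed.

Lemma braid_ind (P : braid n -> Prop) : P 1 ->
  (forall i e b, (i < n.-1)%N -> P b -> P (sgb i e * b)) -> forall b, P b.
Proof.
move=> P1 PM b; rewrite -[b]of_wordK -/(braid_word _).
elim: (generic_quotient.repr b) => [|[i e] w IHw]; first by rewrite braid_word_nil.
by rewrite braid_word_cons -sgbE; apply: PM.
Qed.

Lemma braid_posM b b' k : braid_pos (b * b') k = braid_pos b' (braid_pos b k).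
Proof.
rewrite -[b]of_wordK -[b']of_wordK -of_word_cat -!/(braid_word _).
by rewrite !braid_posE word_pos_cat.
Qed.

Lemma braid_pos1 k : braid_pos (1 : braid n) k = k.
Proof. by rewrite -(@braid_word_nil n) braid_posE. Qed.

Lemma braid_posK b : cancel (braid_pos b) (braid_pos b^-1).
Proof. by move=> k; rewrite -braid_posM mulgV braid_pos1. Qed.

Lemma braid_posKV b : cancel (braid_pos b^-1) (braid_pos b).
Proof. by move=> k; rewrite -braid_posM mulVg braid_pos1. Qed.

Lemma braid_pos_inj b : injective (braid_pos b).
Proof. exact: can_inj (braid_posK b). Qed.

Lemma braid_pos_sgb i e k : (i < n.-1)%N -> braid_pos (sgb i e) k
  = (if k == i :> nat then i.+1 else if k == i.+1 :> nat then i else k) :> nat.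
Proof.
move=> ni; rewrite -[i]/(nat_of_ord (Ordinal ni)) sgbE /sigma braid_posE /=.
exact: letter_pos_val.
Qed.

Lemma braid_pos_sg i k : (i < n.-1)%N -> braid_pos (sg i) k
  = (if k == i :> nat then i.+1 else if k == i.+1 :> nat then i else k) :> nat.
Proof. exact: (@braid_pos_sgb i false). Qed.

Lemma pure_pos b : pure b <-> forall k, braid_pos b k = k.
Proof. by split=> [/forallP h k|h]; [exact/eqP|apply/forallP=> k; rewrite h]. Qed.

Lemma pure1 : pure (1 : braid n).
Proof. by apply/pure_pos => k; rewrite braid_pos1. Qed.

Lemma pureM b b' : pure b -> pure b' -> pure (b * b').
Proof. by move=> /pure_pos h /pure_pos h'; apply/pure_pos => k; rewrite braid_posM h h'. Qed.

Lemma pureV b : pure b -> pure b^-1.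
Proof. by move=> /pure_pos h; apply/pure_pos => k; rewrite -{1}[k]h braid_posK. Qed.

Lemma pureJ b u : pure b -> pure (u * b * u^-1).
Proof.
by move=> /pure_pos h; apply/pure_pos => k; rewrite !braid_posM h braid_posK.
Qed.

(** The usual generators of the pure braid group: two strands are brought together, twisted fully
    around each other and led back. *)
Definition sqconj u i : braid n := u * (sg i * sg i) * u^-1.

Lemma pure_sqconj u i : (i < n.-1)%N -> pure (sqconj u i).
Proof.
move=> ni; apply/pureJ/pure_pos => k; apply: ord_inj.
by rewrite braid_posM !braid_pos_sg //; split_lia; lia.
Qed.

Inductive sq_closure : braid n -> Prop :=
| sq1 : sq_closure 1
| sqM q q' : sq_closure q -> sq_closure q' -> sq_closure (q * q')
| sqV q : sq_closure q -> sq_closure q^-1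
| sq_gen u i : (i < n.-1)%N -> sq_closure (sqconj u i).

Lemma sqJ q u : sq_closure q -> sq_closure (u * q * u^-1).
Proof.
elim=> {q} [|q q' _ IH _ IH'|q _ IH|v i ni].
- by rewrite mulg1 mulgV; apply: sq1.
- have -> : u * (q * q') * u^-1 = (u * q * u^-1) * (u * q' * u^-1) by rewrite !mulgA mulgKV.
  exact: sqM.
- have -> : u * q^-1 * u^-1 = (u * q * u^-1)^-1 by rewrite !invMg invgK mulgA.
  exact: sqV.
- have -> : u * sqconj v i * u^-1 = sqconj (u * v) i by rewrite /sqconj invMg !mulgA.
  exact: sq_gen.
Qed.

Lemma pure_sq q : sq_closure q -> pure q.
Proof.
elim=> {q} *; [exact: pure1|exact: pureM|exact: pureV|exact: pure_sqconj].
Qed.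

Lemma sq_sg i : (i < n.-1)%N -> sq_closure (sg i * sg i).
Proof. by move=> ni; have := sq_gen 1 ni; rewrite /sqconj mul1g invg1 mulg1. Qed.

Inductive above m : braid n -> Prop :=
| above1 : above m 1
| above_cons j e b : (m <= j)%N -> (j < n.-1)%N -> above m b -> above m (sgb j e * b).

Lemma aboveM m b b' : above m b -> above m b' -> above m (b * b').
Proof.
elim=> {b} [|j e b mj jn _ IH] h; first by rewrite mul1g.
by rewrite -mulgA; apply: above_cons => //; apply: IH.
Qed.

Lemma above_sgb m j e : (m <= j)%N -> (j < n.-1)%N -> above m (sgb j e).
Proof. by move=> mj jn; rewrite -[sgb j e]mulg1; apply: above_cons => //; apply: above1. Qed.

Lemma above0 b : above 0 b.
Proof. by elim/braid_ind: b => [|i e b ni]; [exact: above1|exact: above_cons]. Qed.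

Lemma above_pos m b k : above m b -> (k < m)%N -> braid_pos b k = k.
Proof.
move=> h km; elim: h => {b} [|j e b mj jn _ IH]; first exact: braid_pos1.
rewrite braid_posM (_ : braid_pos _ k = k) //; apply: ord_inj.
by rewrite braid_pos_sgb //; split_lia; lia.
Qed.

Lemma above_commute m j b : above m b -> (j.+1 < m)%N -> commute (sg j) b.
Proof.
move=> h jm; elim: h => {b} [|i e b mi ni _ IH]; first exact: commute1.
apply: commuteM => //; rewrite /sgb; case: e; [apply: commuteV|]; apply: sg_comm; lia.
Qed.

(** Takes the strand at position [m + l] past [l] others to position [m]. *)
Fixpoint run m l : braid n := if l is l'.+1 then sg (m + l') * run m l' else 1.

Lemma run_recl m l : run m l.+1 = run m.+1 l * sg m.
Proof.
elim: l => [|l IHl]; first by rewrite /= addn0 mulg1 mul1g.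
by rewrite [LHS]/= -/(run m l.+1) IHl /= mulgA addnS addSn.
Qed.

Lemma run_commute m l j : (m + l < j)%N -> commute (sg j) (run m l).
Proof.
elim: l => [|l IHl] h; first exact: commute1.
apply: commuteM; last by apply: IHl; lia.
by apply/commute_sym/sg_comm; lia.
Qed.

(** Far commutativity brings [sg j] to the place where the braid relation turns it into [sg j.+1],
    which commutes with the rest of the run. *)
Lemma run_shift m l j : (m <= j)%N -> (j.+1 < m + l)%N -> (m + l <= n.-1)%N ->
  sg j * run m l = run m l * sg j.+1.
Proof.
elim: l => [|l IHl] mj jl ln; first by lia.
rewrite /=; have [jl'|jl'] := ltnP j.+1 (m + l).
  have /sg_comm h := jl'.
  by rewrite mulgA h -mulgA IHl ?mulgA //; lia.
have -> : (m + l = j.+1)%N by lia.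
case: l => [|l] /= in IHl jl ln jl' *; first by lia.
have -> : (m + l = j)%N by lia.
rewrite !mulgA sg_braid; last by lia.
rewrite -!mulgA; congr (_ * (_ * _)); apply: run_commute; lia.
Qed.

Lemma run_pos m l k k' : (m + l <= n.-1)%N -> k = (m + l)%N :> nat -> k' = m :> nat ->
  braid_pos (run m l) k = k'.
Proof.
elim: l k => [|l IHl] k ln kE k'E.
  by rewrite braid_pos1; apply: ord_inj; rewrite kE k'E addn0.
rewrite /= braid_posM; apply: IHl => //; first by lia.
by rewrite braid_pos_sg; [split_lia; lia|lia].
Qed.

(* Modulo squares this is the normal form for the Coxeter presentation of the symmetric
   group: [run m l] represents the cosets of the subgroup generated above [m]. *)
Lemma above_decomp m v : (m <= n.-1)%N -> above m v ->
  exists l q h, [/\ sq_closure q, above m.+1 h, (m + l <= n.-1)%N & v = q * run m l * h].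
Proof.
move=> mn; elim=> {v} [|j e v mj jn _ [l [q [h [sq ah ln ->]]]]].
  by exists 0%N, 1, 1; rewrite addn0 !mulg1; split=> //; [exact: sq1|exact: above1].
suff [l' [q' [h' [sq' ah' ln' E]]]] : exists l' q' h', [/\ sq_closure q', above m.+1 h',
    (m + l' <= n.-1)%N & sgb j e * run m l = q' * run m l' * h'].
  exists l', (sgb j e * q * (sgb j e)^-1 * q'), (h' * h); split=> //.
  - by apply: sqM => //; apply: sqJ.
  - exact: aboveM.
  - have := congr1 (fun x => sgb j e * q * (sgb j e)^-1 * x * h) E.
    by rewrite !mulgA mulgKV.
(* The letter slides through the run, meets its top letter, commutes with the run or extends it. In
   the second and last case a letter of the wrong sign costs a square. *)
have [jl|jl|jl] := ltngtP j (m + l).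
- have [jl'|jl'] := ltnP j.+1 (m + l).
    exists l, 1, (sgb j.+1 e); rewrite mul1g; split=> //; [exact: sq1| |].
      by apply: above_sgb; lia.
    have E := run_shift mj jl' ln; case: e => //=.
    by rewrite /sgb; apply: (mulgI (sg j)); rewrite mulKVg mulgA E mulgK.
  case: l jl jl' ln => [|l] /= jl jl' ln; first by lia.
  have jE : (m + l = j)%N by lia.
  case: e; rewrite /sgb jE; last first.
    exists l, (sg j * sg j), 1; rewrite mulg1 mulgA; split=> //; try lia.
      exact: sq_sg.
    exact: above1.
  exists l, 1, 1; rewrite mulg1 mul1g mulKg; split=> //; try lia.
    exact: sq1.
  exact: above1.
- exists l, 1, (sgb j e); rewrite mul1g; split=> //; [exact: sq1| |].
    by apply: above_sgb => //; lia.
  have E := run_commute jl; rewrite /sgb; case: e => //.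
  exact/commute_sym/commuteV/commute_sym.
- case: e; rewrite /sgb.
    exists l.+1, ((sg j * sg j)^-1), 1; rewrite mulg1; split; try lia.
    + exact/sqV/sq_sg.
    + exact: above1.
    + by rewrite /= -jl invMg !mulgA mulgKV.
  exists l.+1, 1, 1; rewrite mulg1 mul1g /= -jl; split=> //; try lia.
    exact: sq1.
  exact: above1.
Qed.

(** The normal form sends position [m + l] to [m]; as [v] fixes [m], injectivity forces [l = 0]. *)
Lemma above_decomp_fix m v k : above m v -> k = m :> nat -> braid_pos v k = k ->
  exists q h, [/\ sq_closure q, above m.+1 h & v = q * h].
Proof.
move=> av kE vk; have kn := ltn_ord k.
have [|l [q [h [sq ah ln vE]]]] := above_decomp _ av; first by lia.
have kl : (m + l < n)%N by lia.
have : braid_pos v (Ordinal kl) = k.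
  rewrite vE !braid_posM (proj1 (pure_pos q)) ?(@run_pos m l _ k) //; last exact: pure_sq.
  by apply: above_pos ah _; lia.
move=> e; have /(congr1 val) /= lE := braid_pos_inj (etrans e (esym vk)).
have l0 : l = 0%N by lia.
by exists q, h; split=> //; rewrite vE l0 mulg1.
Qed.

(** Positions are peeled off from the left, each time up to squares, until no crossing is left. *)
Lemma sq_pure b : pure b -> sq_closure b.
Proof.
move=> /pure_pos; have := above0 b; move: {1}0%N => m.
have [d] := ubnP (n.-1 - m); elim: d m b => // d IHd m b md ab pb.
have [mn|mn] := ltnP m n.-1; last first.
  by case: ab => [|j e v mj jn]; [exact: sq1|lia].
have mn' : (m < n)%N by lia.
have [q [h [sq ah bE]]] := above_decomp_fix ab (erefl : Ordinal mn' = m :> nat) (pb _).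
rewrite bE; apply: sqM => //; apply: (IHd m.+1) => //; first by lia.
by move=> k; have := pb k; rewrite bE braid_posM (proj1 (pure_pos q)) //; exact: pure_sq.
Qed.

(** Two positions are peeled off; the remainder has crossings only from position 2 on, far from
    [sg 0]. *)
Lemma fix01_decomp b (k0 k1 : 'I_n) : k0 = 0%N :> nat -> k1 = 1%N :> nat ->
  braid_pos b k0 = k0 -> braid_pos b k1 = k1 ->
  exists r h, [/\ pure r, commute (sg 0) h & b = r * h].
Proof.
move=> k0E k1E b0 b1.
have [q [h [sq ah bE]]] := above_decomp_fix (above0 b) k0E b0.
have hk1 : braid_pos h k1 = k1.
  by move: b1; rewrite bE braid_posM (proj1 (pure_pos q)) //; exact: pure_sq.
have [q' [h' [sq' ah' hE]]] := above_decomp_fix ah k1E hk1.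
exists (q * q'), h'; split.
- by apply: pure_sq; apply: sqM.
- exact: above_commute ah' _.
- by rewrite bE hE mulgA.
Qed.

(** Says that [sqconj v i] twists the strands starting at [a] and [b] around each other. *)
Definition meets v i (a b : 'I_n) : Prop :=
  (braid_pos v a = i :> nat /\ braid_pos v b = i.+1 :> nat)
  \/ (braid_pos v b = i :> nat /\ braid_pos v a = i.+1 :> nat).

Lemma meets_sym v i (a b : 'I_n) : meets v i a b -> meets v i b a.
Proof. by case; [right|left]. Qed.

Lemma sqconj_sg v i : sqconj (v * sg i) i = sqconj v i.
Proof. by rewrite /sqconj invMg !mulgA mulgK. Qed.

Lemma sqconj_commute v h i : commute (sg i) h -> sqconj (v * h) i = sqconj v i.
Proof.
by move=> ih; apply: mulg_conj_eq; apply: commuteM; apply: commute_sym.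
Qed.

Lemma sqconj_shift v i : (i.+1 < n.-1)%N ->
  sqconj (v * sg i * sg i.+1) i = sqconj v i.+1.
Proof.
move=> ni; have E := sg_braid ni.
have E' : sg i * sg i.+1 * (sg i * sg i) = sg i.+1 * sg i.+1 * (sg i * sg i.+1).
  by rewrite mulgA E -!mulgA (mulgA (sg i)) E !mulgA.
by rewrite /sqconj -(mulgA v); apply: mulg_conj_eq.
Qed.

(** By [sqconj_shift] the twisted pair can slide to the left one place at a time; the conjugator
    changes but not the braid. *)
Lemma meets_base v i (k0 k1 a b : 'I_n) : k0 = 0%N :> nat -> k1 = 1%N :> nat ->
  meets v i a b -> exists v0, [/\ sqconj v0 0 = sqconj v i,
    braid_pos v0 a = k0 & braid_pos v0 b = k1].
Proof.
(* A further crossing [sg i] swaps the two strands and commutes with its own square. *)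
move=> k0E k1E; wlog [h1 h2] : v / braid_pos v a = i :> nat /\ braid_pos v b = i.+1 :> nat.
  move=> W h; have in1 : (i < n.-1)%N by case: h => -[_]; have := ltn_ord (braid_pos v a);
    have := ltn_ord (braid_pos v b); lia.
  case: h => [h|[h1 h2]]; first by apply: W => //; left.
  case: (W (v * sg i)).
  - by rewrite !braid_posM !braid_pos_sg // h1 h2 eqxx; split_lia; lia.
  - by left; rewrite !braid_posM !braid_pos_sg // h1 h2 eqxx; split_lia; lia.
  by move=> v0 [h3 h4 h5]; exists v0; rewrite h3 sqconj_sg.
move=> _; elim: i v h1 h2 => [|i IHi] v h1 h2.
  by exists v; split=> //; apply: ord_inj; rewrite ?k0E ?k1E.
have ni : (i.+1 < n.-1)%N by have := ltn_ord (braid_pos v b); lia.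
have [||v0 [e0 e1 e2]] := IHi (v * sg i * sg i.+1).
- by rewrite !braid_posM !braid_pos_sg ?h1; [split_lia; lia|lia|lia].
- by rewrite !braid_posM !braid_pos_sg ?h2; [split_lia; lia|lia|lia].
- by exists v0; rewrite e0 sqconj_shift.
Qed.

Lemma meets_exists (a b : 'I_n) : a != b -> exists v i, meets v i a b.
Proof.
rewrite -val_eqE /= => ab; have an := ltn_ord a; have bn := ltn_ord b.
have n0 : (0 < n)%N by lia.
have n1 : (1 < n)%N by lia.
pose k0 := Ordinal n0; pose k1 := Ordinal n1; pose y := braid_pos (run 0 a) b.
have r0 : braid_pos (run 0 a) a = k0 by apply: run_pos; rewrite ?add0n //; lia.
have y0 : y != 0%N :> nat.
  apply/eqP => yE; have : y = k0 by apply: ord_inj.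
  by rewrite -r0 => /braid_pos_inj E; move: ab; rewrite E eqxx.
have yn := ltn_ord y.
have ar l' : (1 + l' <= n.-1)%N -> above 1 (run 1 l').
  elim: l' => [|l' IHl'] hl; first exact: above1.
  by apply: (@above_cons 1 _ false); [lia|lia|apply: IHl'; lia].
(* The first run takes [a] to position 0; the second leaves position 0 alone and takes [b] from [y]
   to 1. *)
exists (run 0 a * run 1 y.-1), 0%N; left; rewrite !braid_posM r0 -/y; split.
  by rewrite (above_pos (ar _ _)) //; lia.
by rewrite (@run_pos 1 _ _ k1) //; lia.
Qed.

End BraidSquares.
(** * Characters of pure braid groups compatible with cloning *)

Section CloneBraid.
Context (n : nat).
Implicit Types (b v : braid n) (k : 'I_n).
Local Open Scope group_scope.

Lemma clone_braidM k b b' :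
  clone_braid k (b * b') = clone_braid k b * clone_braid (braid_pos b k) b'.
Proof.
rewrite -[b]of_wordK -[b']of_wordK -of_word_cat -!/(braid_word _) !clone_braidE.
by rewrite clone_word_cat /braid_word of_word_cat braid_posE.
Qed.

Lemma clone_braid1 k : clone_braid k (1 : braid n) = 1.
Proof. by rewrite -(@braid_word_nil n) clone_braidE. Qed.

Lemma clone_braidV k b : clone_braid (braid_pos b k) b^-1 = (clone_braid k b)^-1.
Proof.
by apply: (mulgI (clone_braid k b)); rewrite -clone_braidM !mulgV clone_braid1.
Qed.

Lemma clone_braid_sg k i : (i < n.-1)%N -> clone_braid k (sg n i) =
  if (k < i)%N then sg n.+1 i.+1
  else if k == i :> nat then sg n.+1 i.+1 * sg n.+1 i
  else if k == i.+1 :> nat then sg n.+1 i * sg n.+1 i.+1 else sg n.+1 i.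
Proof.
move=> ni; rewrite -[in LHS](_ : Ordinal ni = i :> nat) // sgE clone_braidE /= cats0.
have hiE : sg n.+1 i.+1 = @sigma n.+1 (ord_hi (Ordinal ni)) false by rewrite -sgE.
have loE : sg n.+1 i = @sigma n.+1 (ord_lo (Ordinal ni)) false by rewrite -sgE.
rewrite hiE loE /clone_letter /=.
by do ![case: ifP => _]; rewrite ?braid_word_cons ?braid_word_nil ?mulg1.
Qed.

Lemma clone_braid_lo k b : braid_pos (clone_braid k b) (@ord_lo n.+1 k)
  = @ord_lo n.+1 (braid_pos b k).
Proof.
by rewrite -[b]of_wordK -!/(braid_word _) clone_braidE !braid_posE clone_word_lo.
Qed.

Lemma clone_braid_hi k b : braid_pos (clone_braid k b) (@ord_hi n.+1 k)
  = @ord_hi n.+1 (braid_pos b k).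
Proof.
by rewrite -[b]of_wordK -!/(braid_word _) clone_braidE !braid_posE clone_word_hi.
Qed.

Lemma clone_braid_up k j b : j != k -> braid_pos (clone_braid k b) (ord_up k j)
  = ord_up (braid_pos b k) (braid_pos b j).
Proof.
by move=> jk; rewrite -[b]of_wordK -!/(braid_word _) clone_braidE !braid_posE clone_word_up.
Qed.

Lemma meets_bound v i (a b : 'I_n) : meets v i a b -> (i < n.-1)%N.
Proof.
by have := ltn_ord (braid_pos v a); have := ltn_ord (braid_pos v b); move=> ? ? [] []; lia.
Qed.

(** The doubled strand takes no part in the twist and only moves it by one position if it passes to
    its left. *)
Lemma clone_sqconj_other v i (a b k : 'I_n) : meets v i a b -> k != a -> k != b ->
  exists i', clone_braid k (sqconj v i) = sqconj (clone_braid k v) i'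
    /\ meets (clone_braid k v) i' (ord_up k a) (ord_up k b).
Proof.
move=> h ka kb; have ni := meets_bound h.
set k1 := braid_pos v k.
have k1i : (k1 != i :> nat) && (k1 != i.+1 :> nat).
  have pa : k1 != braid_pos v a :> nat by rewrite val_eqE (inj_eq (@braid_pos_inj _ v)).
  have pb : k1 != braid_pos v b :> nat by rewrite val_eqE (inj_eq (@braid_pos_inj _ v)).
  by case: h => -[<- <-]; rewrite pa pb.
have sk1 : braid_pos (sg n i) k1 = k1.
  by apply: ord_inj; rewrite braid_pos_sg //; split_lia; lia.
exists (if (k1 < i)%N then i.+1 else i); split.
  rewrite /sqconj !clone_braidM !braid_posM -/k1 !sk1 clone_braidV.
  rewrite clone_braid_sg //; by split_lia.
by rewrite /meets !clone_braid_up 1?eq_sym // !ord_up_val -/k1;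
  case: h => -[-> ->]; split_lia; lia.
Qed.

(** A full twist with a doubled strand is a full twist with each copy in turn: s_{i+1} s_i^2 s_{i+1}
    is a conjugate of s_i^2 times s_{i+1}^2. *)
Lemma clone_sqconj_left v (a b : 'I_n) i :
  braid_pos v a = i :> nat -> braid_pos v b = i.+1 :> nat ->
  [/\ clone_braid a (sqconj v i) = sqconj (clone_braid a v * sg n.+1 i.+1) i
        * sqconj (clone_braid a v) i.+1,
      meets (clone_braid a v * sg n.+1 i.+1) i (@ord_lo n.+1 a) (ord_up a b) &
      meets (clone_braid a v) i.+1 (@ord_hi n.+1 a) (ord_up a b)].
Proof.
move=> h1 h2; have ni : (i < n.-1)%N by have := ltn_ord (braid_pos v b); lia.
have ab : b != a by apply/eqP => ba; move: h2; rewrite ba h1; lia.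
split.
- rewrite /sqconj; have -> : v * (sg n i * sg n i) * v^-1 = v * sg n i * sg n i * v^-1.
    by rewrite !mulgA.
  rewrite !clone_braidM.
  have -> : braid_pos (v * sg n i * sg n i) a = braid_pos v a.
    by apply: ord_inj; rewrite !braid_posM !braid_pos_sg // h1; split_lia; lia.
  rewrite clone_braidV !clone_braid_sg // !braid_posM !braid_pos_sg // h1 !eqxx ltnn.
  have -> : (i.+1 < i)%N = false by lia.
  have -> : (i.+1 == i) = false by lia.
  by rewrite /= invMg !mulgA !mulgKV.
- by left; rewrite !braid_posM clone_braid_lo clone_braid_up // !braid_pos_sg /=;
    rewrite /bump ?h1 ?h2; split_lia; lia.
- by left; rewrite clone_braid_hi clone_braid_up // ord_up_val /= h1 h2; split_lia; lia.
Qed.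

End CloneBraid.

Section PureAdditive.
Context (R : realType).

Definition pure_additive n (f : braid n -> R) : Prop :=
  forall x y, pure x -> pure y -> f (x * y)%g = f x + f y.

Section OneLevel.
Context (n : nat) (f : braid n -> R).
Hypothesis fM : pure_additive f.

Lemma pure_additive1 : f 1%g = 0.
Proof. by have := fM (pure1 n) (pure1 n); rewrite mulg1; lra. Qed.

Lemma pure_additiveV p : pure p -> f p^-1%g = - f p.
Proof. by move=> pp; have := fM pp (pureV pp); rewrite mulgV pure_additive1; lra. Qed.

Lemma pure_additiveJ r p : pure r -> pure p -> f (r * p * r^-1)%g = f p.
Proof.
by move=> pr pp; rewrite !fM ?pure_additiveV ?pureM ?pureV //; lra.
Qed.

(** Once both twists are moved to positions 0 and 1, the conjugators differ by a braid fixing these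
    positions, hence by a pure braid up to a factor commuting with [sg 0]. Additivity makes [f]
    invariant under conjugation by pure braids. *)
Lemma sqconj_meets v i v' i' (a b : 'I_n) : meets v i a b -> meets v' i' a b ->
  f (sqconj v i) = f (sqconj v' i').
Proof.
move=> h h'; have ni := meets_bound h.
have n0 : (0 < n)%N by lia.
have n1 : (1 < n)%N by lia.
have [v0 [<- a0 b0]] := meets_base (erefl : Ordinal n0 = 0%N :> nat)
  (erefl : Ordinal n1 = 1%N :> nat) h.
have [v1 [<- a1 b1]] := meets_base (erefl : Ordinal n0 = 0%N :> nat)
  (erefl : Ordinal n1 = 1%N :> nat) h'.
have [||r [g [pr gs E]]] := @fix01_decomp n (v1^-1 * v0)%g (Ordinal n0) (Ordinal n1) erefl erefl.
- by rewrite braid_posM -a1 braid_posK a0.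
- by rewrite braid_posM -b1 braid_posK b0.
have -> : v0 = (v1 * r * v1^-1 * v1 * g)%g.
  by rewrite mulgKV -mulgA -E mulKVg.
rewrite sqconj_commute //.
have -> : sqconj (v1 * r * v1^-1 * v1)%g 0
    = ((v1 * r * v1^-1) * sqconj v1 0 * (v1 * r * v1^-1)^-1)%g.
  by rewrite /sqconj !invMg !mulgA.
apply: pure_additiveJ; first exact: pureJ.
by apply: pure_sqconj; lia.
Qed.

Lemma pure_additive_eq0 : (forall v i, (i < n.-1)%N -> f (sqconj v i) = 0) ->
  forall p, pure p -> f p = 0.
Proof.
move=> f0 p /sq_pure; elim=> {p} [|q q' sq IH sq' IH'|q sq IH|v i ni].
- exact: pure_additive1.
- by rewrite fM ?IH ?IH' ?addr0 //; apply: pure_sq.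
- by rewrite pure_additiveV ?IH ?oppr0 //; apply: pure_sq.
- exact: f0.
Qed.

(* Independent of the choice, by [sqconj_meets]. *)
Definition crossing_value (a b : 'I_n) : R :=
  if pselect (exists vi : braid n * nat, meets vi.1 vi.2 a b) is left e
  then f (sqconj (projT1 (cid e)).1 (projT1 (cid e)).2) else 0.

Lemma crossing_valueE v i a b : meets v i a b -> crossing_value a b = f (sqconj v i).
Proof.
move=> h; rewrite /crossing_value; case: pselect => [e|[]]; last by exists (v, i).
by case: cid => -[v' i'] /= h'; apply: sqconj_meets h' h.
Qed.

Lemma crossing_value_sym a b : a != b -> crossing_value a b = crossing_value b a.
Proof.
move=> /meets_exists[v [i h]].
by rewrite (crossing_valueE h) (crossing_valueE (meets_sym h)).
Qed.

End OneLevel.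

Section GapValues.
Context (Z : nat -> nat -> nat -> R).
Hypotheses (Zx : forall x y z, Z x.+2 y z = Z x.+1 y z)
  (Zy : forall x y z, Z x y.+2 z = Z x y.+1 z) (Zz : forall x y z, Z x y z.+2 = Z x y z.+1)
  (Zl : forall x y z, Z x y z = Z x y.+1 z + Z x.+1 y z)
  (Zr : forall x y z, Z x y z = Z x y z.+1 + Z x y.+1 z)
  (Z000 : Z 0 0 0 = 0) (Z001 : Z 0 0 1 = 0).

(** The rules for doubling a bystander reduce all arguments to 0 and 1. The splitting rules then
    express these eight values through [Z 0 0 0] and [Z 0 0 1]; for instance [Z 1 1 1] is twice
    itself. *)
Lemma gap_values_eq0 x y z : Z x y z = 0.
Proof.
have red (P : nat -> R) : (forall k, P k.+2 = P k.+1) -> P 0%N = 0 -> P 1%N = 0 ->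
    forall k, P k = 0.
  by move=> PS P0 P1; elim=> // -[|k] // IH; rewrite PS.
have k1 := Zl 0 0 0; have k2 := Zr 0 0 0; have k3 := Zl 0 0 1; have k4 := Zr 0 0 1.
have k5 := Zl 1 0 0; have k6 := Zl 1 1 1; have k7 := Zx 0 0 0.
have h1 := Zz 0 0 0; have h2 := Zy 1 0 1; have h3 := Zx 0 1 1.
move: k1 k2 k3 k4 k5 k6; rewrite h1 h2 h3 k7 Z000 Z001 add0r.
move=> + z010; rewrite -z010 !add0r => z100 + z011; rewrite -z011 -z100 add0r addr0.
move=> z101 z110 /(congr1 (fun u => u - Z 1 1 1)); rewrite subrr addrK => z111.
by apply: (red (fun x => Z x y z)) => [k //||];
  apply: (red (fun y => Z _ y z)) => [k //||]; apply: (red (fun z => Z _ _ z)) => [k //||].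
Qed.

End GapValues.

Section Family.
Context (f : forall n, braid n -> R).
Hypotheses (fM : forall n, pure_additive (@f n))
  (fC : forall n (k : 'I_n) p, pure p -> f (clone_braid k p) = f p).

Lemma crossing_value_up n (k a b : 'I_n) : a != b -> k != a -> k != b ->
  crossing_value (@f n.+1) (ord_up k a) (ord_up k b) = crossing_value (@f n) a b.
Proof.
move=> ab ka kb; have [v [i h]] := meets_exists ab.
have [i' [E h']] := clone_sqconj_other h ka kb.
rewrite (crossing_valueE (fM (n := n)) h) (crossing_valueE (fM (n := n.+1)) h') -E fC //.
exact: pure_sqconj (meets_bound h).
Qed.

Lemma crossing_value_split n (a b : 'I_n) : a != b -> crossing_value (@f n) a b
  = crossing_value (@f n.+1) (@ord_lo n.+1 a) (ord_up a b)
    + crossing_value (@f n.+1) (@ord_hi n.+1 a) (ord_up a b).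
Proof.
move=> /meets_exists[v0 [i h0]]; have ni := meets_bound h0.
have [v [h1 h2]] : exists v : braid n, braid_pos v a = i :> nat /\ braid_pos v b = i.+1 :> nat.
  case: h0 => [[h1 h2]|[h1 h2]]; first by exists v0.
  by exists (v0 * sg n i)%g; rewrite !braid_posM !braid_pos_sg // h1 h2 ?eqxx; split_lia; lia.
have h : meets v i a b by left.
have [E hl hr] := clone_sqconj_left h1 h2.
rewrite (crossing_valueE (fM (n := n)) h) (crossing_valueE (fM (n := n.+1)) hl).
rewrite (crossing_valueE (fM (n := n.+1)) hr) -fM -?E ?fC //.
- exact: pure_sqconj.
- exact: pure_sqconj (meets_bound hl).
- exact: pure_sqconj (meets_bound hr).
Qed.

(* [x], [y], [z] count the strands to the left of, between and to the right of the two
   crossing strands. *)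
Definition gap_value x y z : R :=
  crossing_value (@f (x + y + z).+2) (inord x) (inord (x + y).+1).

Lemma gap_valueE n (a b : 'I_n) x y z : n = (x + y + z).+2 -> a = x :> nat ->
  b = (x + y).+1 :> nat -> crossing_value (@f n) a b = gap_value x y z.
Proof.
move=> nE; subst n => aE bE; congr crossing_value; apply: ord_inj.
- by rewrite inordK //; lia.
- by rewrite inordK //; lia.
Qed.

Lemma pure_family_eq0 :
  f (sqconj (1 : braid 2)%g 0) = 0 -> f (sqconj (1 : braid 3)%g 0) = 0 ->
  forall n (p : braid n), pure p -> f p = 0.
Proof.
move=> f2 f3.
have upE x y z (k : 'I_(x + y + z).+2) x' y' z' :
    k != x :> nat -> k != (x + y).+1 :> nat ->
    (x' + y' + z' = (x + y + z).+1)%N ->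
    x' = (if (k <= x)%N then x.+1 else x) ->
    (x' + y').+1 = (if (k <= (x + y).+1)%N then (x + y).+2 else (x + y).+1) ->
    gap_value x' y' z' = gap_value x y z.
  move=> kx ky E xE yE; rewrite [RHS]/gap_value -(@crossing_value_up _ k).
  - apply/esym/gap_valueE; first by rewrite E.
      by rewrite ord_up_val inordK ?xE //; lia.
    by rewrite ord_up_val inordK ?yE //; lia.
  - by rewrite -val_eqE /= !inordK; lia.
  - by rewrite -val_eqE /= !inordK; lia.
  - by rewrite -val_eqE /= !inordK; lia.
have Z0 x y z : gap_value x y z = 0.
  apply: gap_values_eq0 => {x y z} [x y z|x y z|x y z|x y z|x y z||].
  (* A bystander is doubled in the left, middle and right gap in turn. *)
  - by apply: (@upE _ _ _ (inord 0)); rewrite ?inordK; split_lia; lia.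
  - by apply: (@upE _ _ _ (inord x.+1)); rewrite ?inordK; split_lia; lia.
  - by apply: (@upE _ _ _ (inord (x + y + z).+2)); rewrite ?inordK; split_lia; lia.
  (* The left copy has its twin as a new strand in between, the right copy has it as a new strand on
     the left. The right strand is treated likewise after exchanging roles. *)
  - rewrite {1}/gap_value crossing_value_split; last by rewrite -val_eqE /= !inordK; lia.
    by congr (_ + _); apply: gap_valueE; rewrite /= /bump ?inordK; split_lia; lia.
  - rewrite {1}/gap_value crossing_value_sym //; last by rewrite -val_eqE /= !inordK; lia.
    rewrite crossing_value_split; last by rewrite -val_eqE /= !inordK; lia.
    have ne (k k' : nat) : (k < (x + y + z).+3)%N -> (k' < (x + y + z).+3)%N -> k != k' ->
      inord k != inord k' :> 'I_(x + y + z).+3 by move=> *; rewrite -val_eqE /= !inordK.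
    congr (_ + _); rewrite crossing_value_sym //.
    + by apply: gap_valueE; rewrite /= /bump ?inordK; split_lia; lia.
    + by rewrite -val_eqE /= /bump !inordK; split_lia; lia.
    + by apply: gap_valueE; rewrite /= /bump ?inordK; split_lia; lia.
    + by rewrite -val_eqE /= /bump !inordK; split_lia; lia.
  - have h : meets (1 : braid 2)%g 0 (inord 0) (inord 1).
      by left; rewrite !braid_pos1 !inordK.
    by rewrite /gap_value (crossing_valueE (fM (n := 2)) h).
  - have h : meets (1 : braid 3)%g 0 (inord 0) (inord 1).
      by left; rewrite !braid_pos1 !inordK.
    by rewrite /gap_value (crossing_valueE (fM (n := 3)) h).
move=> n; apply: pure_additive_eq0 => // v i ni.
have in0 : (i < n)%N by lia.
have in1 : (i.+1 < n)%N by lia.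
pose a := braid_pos v^-1%g (Ordinal in0); pose b := braid_pos v^-1%g (Ordinal in1).
have h : meets v i a b by left; rewrite !braid_posKV.
rewrite -(crossing_valueE (fM (n := n)) h).
have ab : a != b by rewrite (inj_eq (@braid_pos_inj _ _)) -val_eqE /=; lia.
wlog lt_ab : a b {h} ab / (a < b)%N => [W|].
  move: (ab); rewrite -val_eqE /= neq_ltn => /orP[/W|/W h']; first exact.
  by rewrite crossing_value_sym // h' // eq_sym.
rewrite (@gap_valueE _ _ _ a (b - a.+1) (n - b.+1)) ?Z0 //; have := ltn_ord b; lia.
Qed.

End Family.
End PureAdditive.
(** * Linking numbers and the characters of the group *)

Section LinkingNumbers.
Context (n : nat).
Implicit Types (w : word 'I_n.-1) (a b : 'I_n).

Definition crosses (i a b : nat) : bool :=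
  ((a == i) && (b == i.+1)) || ((b == i) && (a == i.+1)).

Definition letter_sign (e : bool) : int := if e then -1 else 1.

Definition letter_lk (l : 'I_n.-1 * bool) a b : int :=
  if crosses l.1 a b then letter_sign l.2 else 0.

(* Signed, hence twice the linking number of the two strands of a pure braid. *)
Fixpoint word_lk w a b : int :=
  if w is l :: w' then letter_lk l a b + word_lk w' (letter_pos l.1 a) (letter_pos l.1 b)
  else 0.

Lemma word_lk_cat u v a b :
  word_lk (u ++ v) a b = word_lk u a b + word_lk v (word_pos u a) (word_pos u b).
Proof. by elim: u a b => [|l u IHu] a b /=; rewrite ?add0r // IHu addrA. Qed.

Lemma word_lk_pres u v a b : pres_eq (@braid_rel n) u v -> word_lk u a b = word_lk v a b.
Proof.
move=> uv; elim: uv a b => {u v} //.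
- by move=> u v w _ IH1 _ IH2 a b; rewrite IH1.
- move=> u u' v v' uu' IH1 _ IH2 a b.
  by rewrite !word_lk_cat IH1 IH2 !(word_pos_pres uu').
- move=> i e a b; rewrite /= /letter_lk /crosses /= !letter_pos_val.
  by rewrite /letter_sign; case: e => /=; split_lia; lia.
- move=> _ _ [] i j ij a b; rewrite /= /letter_lk /crosses /= !letter_pos_val;
  by split_lia; lia.
Qed.

Lemma word_lk_sym w a b : word_lk w a b = word_lk w b a.
Proof.
elim: w a b => //= l w IHw a b; rewrite IHw; congr (_ + _).
by rewrite /letter_lk /crosses orbC.
Qed.

Definition lk (x : braid n) a b : int := word_lk (generic_quotient.repr x) a b.

Lemma lkE w a b : lk (braid_word w) a b = word_lk w a b.
Proof. by apply: word_lk_pres; apply/of_wordP; rewrite of_wordK. Qed.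

Lemma lkM (x y : braid n) a b :
  lk (x * y)%g a b = lk x a b + lk y (braid_pos x a) (braid_pos x b).
Proof.
rewrite -[x]of_wordK -[y]of_wordK -of_word_cat -!/(braid_word _).
by rewrite !lkE !braid_posE word_lk_cat.
Qed.

Lemma lk_sym (x : braid n) a b : lk x a b = lk x b a.
Proof. exact: word_lk_sym. Qed.

Lemma lk1 a b : lk (1%g : braid n) a b = 0.
Proof. by rewrite -(@braid_word_nil n) lkE. Qed.

Lemma lk_sgb i e a b : (i < n.-1)%N ->
  lk (sgb n i e) a b = if crosses i a b then letter_sign e else 0.
Proof.
by move=> ni; rewrite -[i]/(nat_of_ord (Ordinal ni)) sgbE /sigma lkE /= addr0.
Qed.

End LinkingNumbers.

Section CloneLinking.
Context (n : nat).
Implicit Types (w : word 'I_n.-1) (l : 'I_n.-1 * bool) (a b k : 'I_n).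

Lemma clone_letter_lk_up l k a b : a != k -> b != k ->
  @word_lk n.+1 (clone_letter k l) (ord_up k a) (ord_up k b) = letter_lk l a b.
Proof.
case: l => i e; rewrite -!val_eqE /= => ak bk; rewrite /clone_letter /letter_lk /crosses /=.
by split_lia; rewrite /= /letter_lk /crosses /= ?letter_pos_val /= /bump;
  split_lia; lia.
Qed.

Lemma clone_letter_lk_lo l k b : b != k ->
  @word_lk n.+1 (clone_letter k l) (@ord_lo n.+1 k) (ord_up k b) = letter_lk l k b.
Proof.
case: l => i e; rewrite -!val_eqE /= => bk; rewrite /clone_letter /letter_lk /crosses /=.
by split_lia; rewrite /= /letter_lk /crosses /= ?letter_pos_val /= /bump;
  split_lia; lia.
Qed.

Lemma clone_letter_lk_hi l k b : b != k ->
  @word_lk n.+1 (clone_letter k l) (@ord_hi n.+1 k) (ord_up k b) = letter_lk l k b.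
Proof.
case: l => i e; rewrite -!val_eqE /= => bk; rewrite /clone_letter /letter_lk /crosses /=.
by split_lia; rewrite /= /letter_lk /crosses /= ?letter_pos_val /= /bump;
  split_lia; lia.
Qed.

Lemma clone_letter_lk_lo_hi l k :
  @word_lk n.+1 (clone_letter k l) (@ord_lo n.+1 k) (@ord_hi n.+1 k) = 0.
Proof.
case: l => i e; rewrite /clone_letter.
by split_lia; rewrite /= /letter_lk /crosses /= ?letter_pos_val /=;
  split_lia; lia.
Qed.

Lemma clone_lk_up (x : braid n) k a b : a != k -> b != k ->
  lk (clone_braid k x) (ord_up k a) (ord_up k b) = lk x a b.
Proof.
rewrite -[x]of_wordK -!/(braid_word _) clone_braidE !lkE.
elim: (generic_quotient.repr x) k a b => //= l w IHw k a b ak bk.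
by rewrite word_lk_cat clone_letter_lk_up // !clone_letter_up // IHw ?letter_pos_eq.
Qed.

Lemma clone_lk_lo (x : braid n) k b : b != k ->
  lk (clone_braid k x) (@ord_lo n.+1 k) (ord_up k b) = lk x k b.
Proof.
rewrite -[x]of_wordK -!/(braid_word _) clone_braidE !lkE.
elim: (generic_quotient.repr x) k b => //= l w IHw k b bk.
by rewrite word_lk_cat clone_letter_lk_lo // clone_letter_lo clone_letter_up // IHw ?letter_pos_eq.
Qed.

Lemma clone_lk_hi (x : braid n) k b : b != k ->
  lk (clone_braid k x) (@ord_hi n.+1 k) (ord_up k b) = lk x k b.
Proof.
rewrite -[x]of_wordK -!/(braid_word _) clone_braidE !lkE.
elim: (generic_quotient.repr x) k b => //= l w IHw k b bk.
by rewrite word_lk_cat clone_letter_lk_hi // clone_letter_hi clone_letter_up // IHw ?letter_pos_eq.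
Qed.

Lemma clone_lk_lo_hi (x : braid n) k :
  lk (clone_braid k x) (@ord_lo n.+1 k) (@ord_hi n.+1 k) = 0.
Proof.
rewrite -[x]of_wordK -!/(braid_word _) clone_braidE !lkE.
elim: (generic_quotient.repr x) k => //= l w IHw k.
by rewrite word_lk_cat clone_letter_lk_lo_hi clone_letter_lo clone_letter_hi IHw.
Qed.

End CloneLinking.

Definition outer_lk n (x : braid n) : int :=
  match n return braid n -> int with
  | m.+1 => fun x => lk x ord0 ord_max
  | 0 => fun _ => 0
  end x.

Definition adjacent_lk n (x : braid n) : int := \sum_(i < n.-1) lk x (ord_lo i) (ord_hi i).

Lemma outer_lk_clone n (k : 'I_n) (x : braid n) : outer_lk (clone_braid k x) = outer_lk x.
Proof.
case: n k x => [|n] k x /=; first by case: k.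
have [k0|k0] := eqVneq k ord0; have [kn|kn] := eqVneq k ord_max.
(* The only strand is doubled: its copies do not link, and a word on one strand has no letters. *)
- have n0 : n = 0%N by move: (congr1 val k0); rewrite kn.
  subst n; rewrite k0 in kn *.
  have -> : @ord0 1 = @ord_lo 2 (@ord0 0) by apply: ord_inj.
  have -> : @ord_max 1 = @ord_hi 2 (@ord0 0) by apply: ord_inj.
  by rewrite clone_lk_lo_hi /lk; case: (generic_quotient.repr x) => [|[[]]].
- rewrite k0 -(clone_lk_lo x) -?k0 1?eq_sym //.
  by congr lk; apply: ord_inj; rewrite ?k0 ?ord_up_val.
- rewrite lk_sym [RHS]lk_sym -kn -(@clone_lk_hi _ x k) 1?eq_sym //.
  move: k0; rewrite -val_eqE /= => k0.
  by congr lk; apply: ord_inj; rewrite ?ord_up_val /=; [rewrite kn|split_lia; lia].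
- rewrite -(@clone_lk_up _ x k) 1?eq_sym //.
  have k0' := k0; have kn' := kn; move: k0' kn'; rewrite -!val_eqE /= => k0' kn'.
  by congr lk; apply: ord_inj; rewrite ord_up_val /=; have := ltn_ord k; split_lia; lia.
Qed.

(** The two copies contribute 0, and every other adjacent pair comes from one old adjacent pair. *)
Lemma adjacent_lk_clone n (k : 'I_n) (x : braid n) :
  adjacent_lk (clone_braid k x) = adjacent_lk x.
Proof.
case: n k x => [|n] k x; first by case: k.
rewrite /adjacent_lk /= (bigD1_ord k) //= clone_lk_lo_hi add0r; apply: eq_bigr => i _.
have [ik|ik|ik] := ltngtP i k.
- have [ik'|ik'] := eqVneq i.+1 k.
    rewrite (_ : @ord_hi n.+1 i = k); last exact: ord_inj.
    rewrite [RHS]lk_sym -(@clone_lk_lo _ x k); last by rewrite -val_eqE /=; lia.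
    by rewrite [RHS]lk_sym; congr lk; apply: ord_inj; rewrite /= /bump; split_lia; lia.
  rewrite -(@clone_lk_up _ x k); try by rewrite -val_eqE /=; lia.
  by congr lk; apply: ord_inj; rewrite /= /bump; split_lia; lia.
- rewrite -(@clone_lk_up _ x k); try by rewrite -val_eqE /=; lia.
  by congr lk; apply: ord_inj; rewrite /= /bump; split_lia; lia.
- rewrite (_ : @ord_lo n.+1 i = k); last exact: ord_inj.
  rewrite -(@clone_lk_hi _ x k); last by rewrite -val_eqE /=; lia.
  by congr lk; apply: ord_inj; rewrite /= /bump; split_lia; lia.
Qed.

Lemma outer_lkM n (x y : braid n) : pure x -> outer_lk (x * y)%g = outer_lk x + outer_lk y.
Proof. by case: n x y => [|n] x y // /pure_pos px; rewrite /= lkM !px. Qed.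

Lemma adjacent_lkM n (x y : braid n) : pure x ->
  adjacent_lk (x * y)%g = adjacent_lk x + adjacent_lk y.
Proof.
move=> /pure_pos px; rewrite /adjacent_lk -big_split; apply: eq_bigr => i _.
by rewrite lkM !px.
Qed.

Section LinkingCharacters.
Context (R : realType).

Definition omega (x : Fbr) : R := (outer_lk (tbraid (generic_quotient.repr x)))%:~R.
Definition psi (x : Fbr) : R := (adjacent_lk (tbraid (generic_quotient.repr x)))%:~R.

Lemma triple_eqv_invariant (f : forall n, braid n -> int) :
  (forall n (k : 'I_n) x, f n.+1 (clone_braid k x) = f n x) ->
  forall t u, triple_eqv t u -> f _ (tbraid t) = f _ (tbraid u).
Proof. by move=> fC t u; elim=> {t u} [_ _ [t k]|//|t u _ //|t u v _ -> _ //]; rewrite /= fC. Qed.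

Lemma omegaE n (T : ntree n) p S : omega (Fbr_class (Triple T p S)) = (outer_lk p)%:~R.
Proof.
congr _%:~R; apply: (triple_eqv_invariant outer_lk_clone (u := Triple T p S)).
by apply/Fbr_classP; rewrite Fbr_classK.
Qed.

Lemma psiE n (T : ntree n) p S : psi (Fbr_class (Triple T p S)) = (adjacent_lk p)%:~R.
Proof.
congr _%:~R; apply: (triple_eqv_invariant adjacent_lk_clone (u := Triple T p S)).
by apply/Fbr_classP; rewrite Fbr_classK.
Qed.

Lemma omega_character : is_character omega.
Proof.
move=> x y; have [n [T [p [S [q [U [-> ->]]]]]]] := Fbr_composable x y.
by rewrite class_mul !omegaE outer_lkM ?intrD //; case: p.
Qed.

Lemma psi_character : is_character psi.
Proof.
move=> x y; have [n [T [p [S [q [U [-> ->]]]]]]] := Fbr_composable x y.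
by rewrite class_mul !psiE adjacent_lkM ?intrD //; case: p.
Qed.

Lemma outer_lk1 n : outer_lk (1%g : braid n) = 0.
Proof. by case: n => [|n] //=; rewrite lk1. Qed.

Lemma adjacent_lk1 n : adjacent_lk (1%g : braid n) = 0.
Proof. by rewrite /adjacent_lk big1 // => i _; rewrite lk1. Qed.

Lemma omega_tree_pair n (T S : ntree n) : omega (tree_pair T S) = 0.
Proof. by rewrite omegaE outer_lk1. Qed.

Lemma psi_tree_pair n (T S : ntree n) : psi (tree_pair T S) = 0.
Proof. by rewrite psiE adjacent_lk1. Qed.

(** Braids that are not pure go to 1, so that no proof of purity has to be carried in the term. *)
Definition to_pure n (x : braid n) : pure_braid n := insubd (1%g : pure_braid n) x.

Lemma to_pureK n (x : braid n) : pure x -> to_pure x = x :> braid n.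
Proof. by move=> px; rewrite /to_pure val_insubd px. Qed.

Lemma to_pureM n (x y : braid n) : pure x -> pure y -> to_pure (x * y)%g = (to_pure x * to_pure y)%g.
Proof. by move=> px py; apply: val_inj; rewrite valM /= !to_pureK //; apply: pureM. Qed.

Lemma braid_ofK n (p : pure_braid n) : to_pure p = p.
Proof. by apply: val_inj; rewrite /= to_pureK //; case: p. Qed.

Lemma to_pure_clone n (k : 'I_n) (x : braid n) : pure x ->
  to_pure (clone_braid k x) = clone k (to_pure x).
Proof.
move=> px; have pk : pure (clone_braid k x) by have := pure_clone k (to_pure x); rewrite to_pureK.
by apply: val_inj; rewrite /= !to_pureK.
Qed.

Definition twist n (T : ntree n) : Fbr := pure_elt T (to_pure (sqconj (1%g : braid n) 0)).

Lemma lk_sqconj1 n i (a b : 'I_n) : (i < n.-1)%N ->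
  lk (sqconj (1%g : braid n) i) a b = (crosses i a b)%:Z *+ 2.
Proof.
move=> ni; rewrite /sqconj mul1g invg1 mulg1 lkM !(@lk_sgb n i false) //.
have -> : crosses i (braid_pos (sg n i) a) (braid_pos (sg n i) b) = crosses i a b.
  by rewrite /crosses !braid_pos_sg //; split_lia; lia.
by case: crosses.
Qed.

Lemma omega_twist n (T : ntree n.+2) : omega (twist T) = if n == 0%N then 2 else 0.
Proof.
rewrite omegaE to_pureK /=; last exact: pure_sqconj.
by rewrite lk_sqconj1 // /crosses /= eqSS; case: eqP.
Qed.

Lemma psi_twist n (T : ntree n.+2) : psi (twist T) = 2.
Proof.
rewrite psiE to_pureK; last exact: pure_sqconj.
rewrite /adjacent_lk (bigD1 ord0) //= big1 ?addr0 => [|i]; first by rewrite lk_sqconj1.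
by rewrite lk_sqconj1 // -val_eqE /crosses /= => /negPf ->; split_lia; lia.
Qed.

(** An element of F conjugates one to the other. A character thus depends on the braid alone, which
    makes its values on K a family compatible with cloning. *)
Lemma pure_elt_character (chi : Fbr -> R) n (T S : ntree n) p : is_character chi ->
  chi (pure_elt T p) = chi (pure_elt S p).
Proof.
by move=> chiM; rewrite (pure_eltJ T S) !chiM characterV //; lra.
Qed.

Lemma character_eq0 (chi : Fbr -> R) : is_character chi ->
  chi (xgen 0) = 0 -> chi (xgen 1) = 0 -> chi (twist caret) = 0 -> chi (twist caret_right) = 0 ->
  forall x, chi x = 0.
Proof.
move=> chiM x0 x1 t2 t3.
(* No tree has 0 leaves, so the value there is a dummy. *)
pose g n : braid n -> R := match n return braid n -> R with
  | m.+1 => fun b => chi (pure_elt (right_comb m) (to_pure b)) | 0 => fun _ => 0 end.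
have gM n : pure_additive (@g n).
  rewrite /g; case: n => [|n] x y px py; first by rewrite addr0.
  by rewrite to_pureM // pure_eltM chiM.
have gC n (k : 'I_n) p : pure p -> g n.+1 (clone_braid k p) = g n p.
  rewrite /g; case: n k p => [|n] k p pp; first by case: k.
  rewrite to_pure_clone // (pure_elt_character _ (ngraft (right_comb n) k)) //.
  by rewrite pure_elt_graft.
have g0 : forall n (p : braid n), pure p -> g n p = 0.
  apply: pure_family_eq0 => //; rewrite /g.
    by rewrite (pure_elt_character _ caret).
  by rewrite (pure_elt_character _ caret_right).
apply: Fbr_ind => [u v|u|n T p|k].
- by rewrite chiM => -> ->; rewrite addr0.
- by rewrite characterV // => ->; rewrite oppr0.
- case: n T p => [|n] T p.
    by exfalso; have := nleaves_gt0 (val T); rewrite (eqP (valP T)).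
  rewrite (pure_elt_character _ (right_comb n)) // -[p]braid_ofK.
  by apply: (g0 n.+1); case: p.
- case: k => // k; elim: k => // k IHk.
  (* [xgen k.+2] is conjugate to [xgen k.+1], so all of these share the value at [xgen 1]. *)
  have := congr1 chi (@xgen_rel 0 k.+1 isT); rewrite !chiM x0 IHk; lra.
Qed.

Definition combination (a b c d : R) (x : Fbr) : R :=
  a * phi0 R x + b * phi1 R x + c * omega x + d * psi x.

Lemma combination_character a b c d : is_character (combination a b c d).
Proof.
move=> x y; rewrite /combination phi0_character phi1_character omega_character psi_character.
by lra.
Qed.

Lemma combination_xgen0 a b c d : combination a b c d (xgen 0) = b - a.
Proof. by rewrite /combination phi0_xgen phi1_xgen omega_tree_pair psi_tree_pair /=; lra. Qed.

Lemma combination_xgen1 a b c d : combination a b c d (xgen 1) = b.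
Proof. by rewrite /combination phi0_xgen phi1_xgen omega_tree_pair psi_tree_pair /=; lra. Qed.

Lemma combination_twist2 a b c d : combination a b c d (twist caret) = 2 * (c + d).
Proof. by rewrite /combination phi0_pure_elt phi1_pure_elt omega_twist psi_twist /=; lra. Qed.

Lemma combination_twist3 a b c d (T : ntree 3) : combination a b c d (twist T) = 2 * d.
Proof. by rewrite /combination phi0_pure_elt phi1_pure_elt omega_twist psi_twist /=; lra. Qed.

(** The coefficients solve the linear system given by the values on [xgen 0], [xgen 1] and the two
    twists; [character_eq0] kills the difference. *)
Lemma character_combination (chi : Fbr -> R) : is_character chi -> forall x,
  chi x = combination (chi (xgen 1) - chi (xgen 0)) (chi (xgen 1))
    ((chi (twist caret) - chi (twist caret_right)) / 2) (chi (twist caret_right) / 2) x.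
Proof.
move=> chiM x; set a := _ - _; set b := chi (xgen 1); set c := _ / 2; set d := _ / 2.
apply/eqP; rewrite -subr_eq0; apply/eqP.
apply: (@character_eq0 (fun x => chi x - combination a b c d x)).
- by move=> u v; rewrite chiM combination_character; lra.
- by rewrite combination_xgen0 /a /b; lra.
- by rewrite combination_xgen1 /b; lra.
- by rewrite combination_twist2 /c /d; lra.
- by rewrite combination_twist3 /d; lra.
Qed.

End LinkingCharacters.
(** * Characters in Sigma^1 *)

Section Center.
Context (a : nat).
Notation n := a.+2.
Implicit Types (b : braid n) (k x y : 'I_n).

Definition rotation : braid n := run n 0 a.+1.
Definition full_twist : braid n := (rotation ^+ n)%g.

Lemma rotation_shift j : (j < a)%N -> (sg n j * rotation = rotation * sg n j.+1)%g.
Proof. by move=> ja; apply: run_shift; lia. Qed.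

Lemma rotation_shiftX i j : (j + i <= a)%N ->
  (sg n j * rotation ^+ i = rotation ^+ i * sg n (j + i))%g.
Proof.
elim: i j => [|i IHi] j ja; first by rewrite mulg1 mul1g addn0.
by rewrite expgS mulgA rotation_shift -?mulgA ?IHi ?addSnnS //; lia.
Qed.

Lemma run_rotation l : (l <= a)%N -> (run n 0 l * rotation = rotation * run n 1 l)%g.
Proof.
elim: l => [|l IHl] la; first by rewrite mul1g mulg1.
rewrite /= add0n add1n -mulgA IHl; last exact: ltnW.
by rewrite mulgA rotation_shift // mulgA.
Qed.

(** One rotation would push the last crossing off the end; after two it reappears at position 0. *)
Lemma rotation_wrap : (sg n a * rotation ^+ 2 = rotation ^+ 2 * sg n 0)%g.
Proof.
rewrite expgS expg1 -{2}/rotation {2}/rotation run_recl.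
by rewrite [in LHS](mulgA rotation) -run_rotation // !mulgA.
Qed.

(** Passing through the [n] rotations takes [sg n j] to the last position in [a - j] of them, to
    position 0 in the next two and back to [j] in the remaining [j]. *)
Lemma full_twist_central b : commute b full_twist.
Proof.
elim/braid_ind: b => [|j e b jn IH]; first exact/commute_sym/commute1.
apply/commute_sym/commuteM; apply/commute_sym => //.
have h : commute (sg n j) full_twist.
  have ja : (j <= a)%N by [].
  have [Q [QE ->]] : exists Q : braid n, (sg n a * Q = Q * sg n 0)%g /\
      full_twist = (rotation ^+ (a - j) * (Q * rotation ^+ j))%g.
    exists (rotation ^+ 2)%g; split; first exact: rotation_wrap.
    by rewrite -!expgD /full_twist; congr (_ ^+ _)%g; lia.
  rewrite /commute mulgA rotation_shiftX ?subnKC // -!mulgA; congr (_ * _)%g.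
  by rewrite (mulgA (sg n a)) QE -(mulgA Q) rotation_shiftX.
by rewrite /sgb; case: e => //; apply/commute_sym/commuteV/commute_sym.
Qed.

Lemma run0_pos l k : (l <= a.+1)%N -> braid_pos (run n 0 l) k
  = (if (k < l)%N then k.+1 else if k == l :> nat then 0%N else k) :> nat.
Proof.
elim: l k => [|l IHl] k la; first by rewrite braid_pos1; case: eqP.
by rewrite /= braid_posM IHl ?braid_pos_sg; split_lia; lia.
Qed.

Lemma pure_full_twist : pure full_twist.
Proof.
have h i k : braid_pos (rotation ^+ i)%g k = ((k + i) %% n)%N :> nat.
  elim: i => [|i IHi]; first by rewrite braid_pos1 addn0 modn_small.
  rewrite expgSr braid_posM run0_pos // IHi.
  have -> : ((k + i.+1) %% n = ((k + i) %% n).+1 %% n)%N by rewrite addnS -addn1 -modnDml addn1.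
  have : ((k + i) %% n < n)%N by rewrite ltn_mod.
  move: ((k + i) %% n)%N => r rn; case: ltnP => h; first by rewrite modn_small.
  by have -> : r = a.+1 by [lia]; rewrite eqxx modnn.
by apply/pure_pos => k; apply: ord_inj; rewrite h modnDr modn_small.
Qed.

(** Comparing linking numbers on both sides of the centrality relation; hence all pairs of strands
    link equally. *)
Lemma lk_full_twist_pos b x y :
  lk full_twist (braid_pos b x) (braid_pos b y) = lk full_twist x y.
Proof.
have := full_twist_central b; move=> /(congr1 (fun z => lk z x y)).
by rewrite !lkM !(proj1 (pure_pos _) pure_full_twist) addrC => /addIr.
Qed.

Definition full_twist_lk : int := lk full_twist ord0 (inord 1).

Lemma lk_full_twist x y : x != y -> lk full_twist x y = full_twist_lk.
Proof.
move=> /meets_exists[v [i h]].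
have k1E : (inord 1 : 'I_n) = 1%N :> nat by rewrite inordK.
have [v0 [_ h0 h1]] := meets_base (erefl : @ord0 a.+1 = 0%N :> nat) k1E h.
by rewrite -(lk_full_twist_pos v0) h0 h1.
Qed.

Lemma full_twist_lk_gt0 : 0 < full_twist_lk.
Proof.
have sg_ge0 j x y : (j < n.-1)%N -> 0 <= lk (sg n j) x y.
  by move=> jn; rewrite (@lk_sgb n j false) //; case: ifP.
have run_ge0 l x y : (l <= a.+1)%N -> 0 <= lk (run n 0 l) x y.
  elim: l x y => [|l IHl] x y la; first by rewrite lk1.
  by rewrite /= lkM addr_ge0 ?sg_ge0 ?IHl //; lia.
have X_ge0 i x y : 0 <= lk (rotation ^+ i)%g x y.
  elim: i x y => [|i IHi] x y; first by rewrite lk1.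
  by rewrite expgS lkM addr_ge0 ?run_ge0.
(* All letters are positive, so it is enough that the first one crosses the last two strands. *)
pose x : 'I_n := inord a; pose y : 'I_n := inord a.+1.
have xE : x = a :> nat by rewrite inordK.
have yE : y = a.+1 :> nat by rewrite inordK.
rewrite -(@lk_full_twist x y); last by rewrite -val_eqE /= xE yE; lia.
rewrite /full_twist expgS lkM ltr_wpDr ?X_ge0 // /rotation /= lkM ltr_wpDr ?run_ge0 //.
by rewrite (@lk_sgb n _ false) // /crosses xE yE !eqxx.
Qed.

End Center.

Section Sigma1Members.
Context (R : realType) (S : set Fbr) (a b c d : R).
Hypothesis genS : generates S.
Local Notation chi := (combination a b c d).
Local Notation chiM := (combination_character a b c d).
Implicit Types (t : Fbr).

Definition central_elt n (T : ntree n.+2) : Fbr := pure_elt T (to_pure (full_twist n)).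

Lemma central_elt_commute n (T : ntree n.+2) p : commute (pure_elt T p) (central_elt T).
Proof.
rewrite /commute /central_elt -!pure_eltM; congr pure_elt; apply: val_inj.
rewrite !valM /= to_pureK; last exact: pure_full_twist.
exact: full_twist_central.
Qed.

(** On [n.+2] strands there are [n.+1] adjacent pairs and one outer pair, all linked equally. *)
Lemma combination_central_elt n (T : ntree n.+2) :
  chi (central_elt T) = (full_twist_lk n)%:~R * (c + n.+1%:R * d).
Proof.
rewrite /combination phi0_pure_elt phi1_pure_elt omegaE psiE to_pureK; last first.
  exact: pure_full_twist.
rewrite /= lk_full_twist // /adjacent_lk (eq_bigr (fun => full_twist_lk n)) => [|i _].
  by rewrite sumr_const card_ord rmorphMn /= -mulr_natr; ring.
by rewrite lk_full_twist // -val_eqE /=; lia.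
Qed.

Lemma stable_all t : 0 < chi t -> (forall n (T : ntree n) p, stable S chi t (pure_elt T p)) ->
  stable S chi t (xgen 0) -> stable S chi t (xgen 1) -> superlevel_connected S chi.
Proof.
move=> t0 sp s0 s1; apply: (stable_connected chiM genS t0); apply: Fbr_ind => //.
- by move=> g h; apply: (stableM chiM).
- by move=> g; apply: (stableV chiM).
case=> // k; rewrite -xgen_conj; apply: (stableM chiM) => //; last exact: (stableX chiM).
by apply: (stableM chiM) => //; apply: (stableV chiM) => //; apply: (stableX chiM).
Qed.

Lemma tree_pair_stable t : stable S chi t (xgen 0) -> stable S chi t (xgen 1) ->
  forall n (T U : ntree n), stable S chi t (tree_pair T U).
Proof.
move=> s0 s1; apply: tree_pair_ind.
- by move=> g h; apply: (stableM chiM).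
- by move=> g; apply: (stableV chiM).
case=> // k; rewrite -xgen_conj; apply: (stableM chiM) => //.
  apply: (stableM chiM) => //.
  by apply: (stableV chiM); apply: (stableX chiM).
by apply: (stableX chiM) => //.
Qed.

(** A kernel element commutes with the rotations below the first and the last leaf, and [chi] is
    non-zero on one of these. *)
Lemma xgen_stable_all t : 0 < chi t -> c = 0 -> d = 0 -> (a != 0) || (b != 0) ->
  stable S chi t (xgen 0) -> stable S chi t (xgen 1) -> superlevel_connected S chi.
Proof.
move=> t0 c0 d0 ab s0 s1; apply: (stable_all t0) => // n T p.
case: n T p => [|n] T p; first by exfalso; have := nleaves_gt0 (val T); rewrite (eqP (valP T)).
(* A caret is added so that the first leaf is not also the last one, and [phi1] vanishes on the
   rotation below it. *)
rewrite -(pure_elt_graft T p ord0); move: (ngraft T ord0) (clone _ p) => {}T {}p.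
have sT := tree_pair_stable s0 s1.
have [a0|a0] := eqVneq a 0; last first.
  apply: (stable_commute chiM genS t0 (y := leaf_rot T ord0)); first exact: sT.
    rewrite /combination phi0_leaf_rot0 phi1_leaf_rot0 omega_tree_pair psi_tree_pair.
    by rewrite !mulr0 !addr0 mulrN1 oppr_eq0.
  exact/commute_sym/leaf_rot_commute.
apply: (stable_commute chiM genS t0 (y := leaf_rot T ord_max)); first exact: sT.
  rewrite /combination phi1_leaf_rot_max omega_tree_pair psi_tree_pair a0.
  by move: ab; rewrite a0 eqxx /= mul0r add0r mulr1 !mulr0 !addr0.
exact/commute_sym/leaf_rot_commute.
Qed.

Lemma connected_of_F : c = 0 -> d = 0 -> (a != 0) && (b != 0) || (a < 0) || (b < 0) ->
  superlevel_connected S chi.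
Proof.
move=> c0 d0; have x0 := combination_xgen0 a b c d; have x1 := combination_xgen1 a b c d.
have [/andP[a0 b0] _|/=] := boolP ((a != 0) && (b != 0)).
  (* Stability spreads from [w], of height [- a], to [xgen 2] and [xgen 3], and from [xgen 3], of
     height [b], to [xgen 1 * (xgen 2)^-1]. *)
  pose w := (xgen 0 * (xgen 1)^-1)%g.
  have wE : chi w = - a by rewrite /w chiM characterV ?x0 ?x1 //; [lra|exact: chiM].
  have [|t t0 sw] := exists_stable chiM genS (y := w); first by rewrite wE oppr_eq0.
  have sx k : (1 < k)%N -> stable S chi t (xgen k).
    move=> k1; apply: (stable_commute chiM genS t0 sw); first by rewrite wE oppr_eq0.
    by apply: xgen_commute => //; lia.
  have x3 : chi (xgen 3) = b.
    by rewrite /combination phi0_xgen phi1_xgen omega_tree_pair psi_tree_pair /=; lra.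
  have su : stable S chi t (xgen 1 * (xgen 2)^-1)%g.
    apply: (stable_commute chiM genS t0 (sx 3 isT)); first by rewrite x3.
    exact/commute_sym/xgen_commute.
  have s1 : stable S chi t (xgen 1).
    by rewrite -[xgen 1](mulgKV (xgen 2)); apply: (stableM chiM) => //; exact: sx.
  have s0 : stable S chi t (xgen 0).
    by rewrite -[xgen 0](mulgKV (xgen 1)); apply: (stableM chiM) => //.
  by apply: (xgen_stable_all t0) => //; rewrite a0.
rewrite negb_and !negbK => ab0 ab.
have [a0|a0] := ltP a 0.
  have b0 : b = 0 by move: ab0; rewrite (lt_eqF a0) => /eqP.
  have t0 : 0 < chi (xgen 0) by rewrite x0; lra.
  apply: (xgen_stable_all t0) => //; first by rewrite lt_eqF.
    exact: (stable_self chiM genS t0).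
  apply: (stable_descending chiM genS t0) => //; first by rewrite x1.
  move=> n; rewrite xgen_conj; exact/commute_sym/xgen_commute.
have b0 : b < 0 by move: ab; rewrite ltNge a0.
have {ab0} a0' : a = 0 by move: ab0; rewrite (lt_eqF b0) orbF => /eqP.
(* The mirror image of the preceding case: by [xgen_pentagon], [y] is the inverse of
   [leaf_rot caret ord0]. *)
pose t := (xgen 0)^-1%g; pose y := (xgen 0 * xgen 1 * (xgen 0)^-1 * (xgen 0)^-1)%g.
have t0 : 0 < chi t by rewrite /t characterV ?x0; [lra|exact: chiM].
have st : stable S chi t t by apply: (stable_self chiM genS t0).
have s0 : stable S chi t (xgen 0) by rewrite -[xgen 0]invgK; apply: (stableV chiM) => //.
apply: (xgen_stable_all t0) => //; first by rewrite (lt_eqF b0) orbT.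
suff sy : stable S chi t y.
  have -> : xgen 1 = (t * y * xgen 0 * xgen 0)%g by rewrite /t /y !mulgA !mulgKV mulVg mul1g.
  by do 3?[apply: (stableM chiM) => //].
apply: (stable_descending chiM genS t0) => //.
  by rewrite /y !chiM !characterV ?x0 ?x1; [lra|exact: chiM..].
move=> n.
(* Both elements are conjugates by [xgen 0 ^+ n.+2] of elements that commute by [xgen_commute]. *)
have -> : (t * y^-1 = xgen 0 ^+ n.+2 * (xgen n.+2)^-1 * xgen 0 ^- n.+2)%g.
  by rewrite -(xgen_conj n.+1) (expgS _ n.+1) !invMg !invgK !mulgA mulVg mul1g !mulgK.
have -> : (t ^- n.+1 * y * t ^+ n.+1 = xgen 0 ^+ n.+2 * (xgen 1 * (xgen 0)^-1) * xgen 0 ^- n.+2)%g.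
  by rewrite /t /y !expVgn invgK (expgSr _ n.+1) invMg !mulgA.
have h : commute (xgen n.+2)^-1%g (xgen 1 * (xgen 0)^-1)%g.
  by apply/commute_sym/commuteV/commute_sym/xgen_commute.
exact: commute_conj.
Qed.

Lemma connected_of_K : (c != 0) || (d != 0) -> superlevel_connected S chi.
Proof.
move=> cd.
(* [c + n.+1%:R * d] is affine in [n] and not identically zero, so it has at most one root. *)
have [N NP] : exists N, forall n (T : ntree n.+2), (N <= n)%N -> chi (central_elt T) != 0.
  have [[N h]|h] := pselect (exists n, c + n.+1%:R * d = 0); last first.
    exists 0%N => n T _; rewrite combination_central_elt mulf_neq0 //.
      by rewrite intr_eq0 gt_eqF ?full_twist_lk_gt0.
    by apply/eqP => E; apply: h; exists n.
  exists N.+1 => n T Nn; rewrite combination_central_elt mulf_neq0 //.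
    by rewrite intr_eq0 gt_eqF ?full_twist_lk_gt0.
  have d0 : d != 0.
    by apply: contraTneq cd => d0; move: h; rewrite d0 mulr0 addr0 => ->; rewrite eqxx.
  apply/eqP => E; have : (n.+1%:R - N.+1%:R) * d = 0 by lra.
  move/eqP; rewrite mulf_eq0 (negPf d0) orbF subr_eq0 eqr_nat; lia.
pose z := central_elt (right_comb N.+1); have zn := NP _ (right_comb N.+1) (leqnn N).
have [t t0 sz] := exists_stable chiM genS zn.
(* Over a tree containing both [T] and the comb, [z] becomes a pure element. Its stability passes to
   the full twist over that tree and from there to every pure braid. *)
have sp n (T : ntree n) p : stable S chi t (pure_elt T p).
  have [V [TV zV]] := tree_join (val T) (val (right_comb N.+1)).
  have Vn : nleaves V == (nleaves V - 2).+2.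
    by have := tree_le_nleaves zV; rewrite (eqP (valP (right_comb N.+1))); lia.
  have VN : (N <= nleaves V - 2)%N.
    by have := tree_le_nleaves zV; rewrite (eqP (valP (right_comb N.+1))); lia.
  pose V' : ntree (nleaves V - 2).+2 := exist _ V Vn.
  have [p' ->] := pure_elt_le p TV (erefl : val V' = V).
  apply: (stable_commute chiM genS t0 (y := central_elt V')); last exact: central_elt_commute.
    apply: (stable_commute chiM genS t0 sz zn).
    have [q' E] := pure_elt_le (to_pure (full_twist N)) zV (erefl : val V' = V).
    rewrite /z {2}/central_elt E; exact/commute_sym/central_elt_commute.
  exact: NP.
have tw : 2 * (c + d) != 0 \/ 2 * d != 0.
  have [d0|d0] := eqVneq d 0; last by right; rewrite mulf_neq0.
  by left; move: cd; rewrite d0 eqxx orbF addr0 => c0; rewrite mulf_neq0.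
have s1 : stable S chi t (xgen 1).
  case: tw => h.
    apply: (stable_commute chiM genS t0 (y := twist caret)); first exact: sp.
      by rewrite combination_twist2.
    by rewrite xgen1_leaf_rot; apply: leaf_rot_commute.
  apply: (stable_commute chiM genS t0 (y := twist caret_left)); first exact: sp.
    by rewrite combination_twist3.
  by rewrite xgen1_leaf_rot3; apply: leaf_rot_commute.
(* By [xgen_pentagon], [xgen 0] is a conjugate of the rotation below the first leaf times [xgen 1].
   That conjugate commutes with the same conjugate of [y], which stays in K. *)
have sw (y : Fbr) : commute (leaf_rot caret ord0) y -> chi y != 0 ->
    (exists n (T : ntree n) p, y = pure_elt T p) -> stable S chi t (xgen 0).
  move=> fy y0 [n [T [p yE]]].
  have -> : xgen 0 = ((xgen 0)^-1 * leaf_rot caret ord0 * xgen 0 * xgen 1)%g.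
    by rewrite -!mulgA (mulgA (leaf_rot _ _)) xgen_pentagon mulKg.
  apply: (stableM chiM) => //.
  have [m [T' [p' E]]] := pure_elt_normal (xgen 0) T p.
  apply: (stable_commute chiM genS t0 (y := ((xgen 0)^-1 * y * xgen 0)%g)).
  - by rewrite yE E.
  - by rewrite !chiM characterV; [rewrite addrAC addNr add0r|exact: chiM].
  - by rewrite /commute !mulgA !mulgK -!(mulgA (xgen 0)^-1%g) fy.
apply: (stable_all t0) => //; case: tw => h.
  apply: (sw (twist caret)).
  - exact: leaf_rot_commute.
  - by rewrite combination_twist2.
  - by exists 2, caret, (to_pure (sqconj 1%g 0)).
apply: (sw (twist caret_right)).
- by rewrite leaf_rot0_3; apply: leaf_rot_commute.
- by rewrite combination_twist3.
- by exists 3, caret_right, (to_pure (sqconj 1%g 0)).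
Qed.

End Sigma1Members.
(** * The two characters outside Sigma^1 *)

Lemma superlevel_connected_scale (R : realType) (G : groupType) (S : set G) (chi psi : G -> R) c :
  0 < c -> (forall g, psi g = c * chi g) ->
  superlevel_connected S psi -> superlevel_connected S chi.
Proof.
move=> c0 E conn g h g0 h0.
have {conn} := conn g h; rewrite !E !pmulr_rge0 // => /(_ g0 h0).
elim=> [x y [hx hy xy]|x|x y _ IH|x y z _ IH1 _ IH2].
- by apply: rst_step; split=> //; [move: hx|move: hy]; rewrite E pmulr_rge0.
- exact: rst_refl.
- exact: rst_sym.
- exact: rst_trans IH1 IH2.
Qed.

(* [d] is the depth of the extremal leaf on one side, [corner N t] the number of
   leaves of [t] below the vertex of depth [N] on that side, and [inside n m k] tells
   whether the [k]-th of [n] leaves is one of the [m] extremal ones. *)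
Section DepthObstruction.
Context (R : realType) (phi : Fbr -> R) (d : tree -> nat) (corner : nat -> tree -> nat)
  (inside : nat -> nat -> nat -> bool).
Hypotheses (phiM : is_character phi)
  (phiE : forall n (T : ntree n) p S,
    phi (Fbr_class (Triple T p S)) = (d (val S))%:R - (d (val T))%:R)
  (d_graft : forall t k, (k < nleaves t)%N -> d (graft t k) = (d t + inside (nleaves t) 1 k)%N)
  (d_join : forall s t, exists V, [/\ tree_le s V, tree_le t V & d V = maxn (d s) (d t)])
  (d_leaf : d Leaf = 0%N)
  (corner_graft : forall N t k, (N <= d t)%N -> (k < nleaves t)%N ->
    corner N (graft t k) = (corner N t + inside (nleaves t) (corner N t) k)%N)
  (corner_depth : forall t, corner (d t) t = 1%N)
  (insideS : forall n m m' k, (m < m')%N -> inside n m k -> inside n m' k)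
  (witness : forall N, exists n (A B : ntree n),
    [/\ d (val A) = d (val B), (N < d (val A))%N & corner N.+1 (val A) != corner N.+1 (val B)]).

(* [g] acts linearly near the extremal point, on a neighbourhood of size [2^-N]. *)
Definition germ_linear N (g : Fbr) : Prop :=
  exists n (T : ntree n) p S, g = Fbr_class (Triple T p S) /\ (d (val T) <= N)%N.

Lemma germ_linear_le N N' g : (N <= N')%N -> germ_linear N g -> germ_linear N' g.
Proof.
by move=> NN' [n [T [p [S [gE TN]]]]]; exists n, T, p, S; split=> //; apply: leq_trans NN'.
Qed.

Lemma germ_linear_ex g : exists N, germ_linear N g.
Proof.
rewrite -[g]Fbr_classK; case: (generic_quotient.repr g) => n T p S.
by exists (d (val T)), n, T, p, S.
Qed.

Lemma germ_linear1 N : germ_linear N 1%g.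
Proof. by exists 1%N, leaf1, 1%g, leaf1; rewrite d_leaf. Qed.

(** Expansion adds equally to both depths of [g], and only as much as [V] is deeper than [S]. Since
    [T] is no deeper than [S], its depth stays within [N]. *)
Lemma germ_linearM N g h : 0 <= phi g -> germ_linear N g -> germ_linear N h ->
  germ_linear N (g * h)%g.
Proof.
move=> + [n [T [p [S [gE TN]]]]] [m [V [q [W [-> VN]]]]].
rewrite gE phiE subr_ge0 ler_nat => TS.
have [X [SX VX dX]] := d_join (val S) (val V).
have [u Tu uX] := @expansions_to (Triple T p S) X SX.
have [v Vv vX] := @expansions_to_minus (Triple V q W) X VX.
have uE : phi (Fbr_class u) = (d (val S))%:R - (d (val T))%:R.
  by have /Fbr_classP <- := expansions_eqv Tu; rewrite phiE.
have /Fbr_classP -> := expansions_eqv Tu; have /Fbr_classP -> := expansions_eqv Vv.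
have [|k [A [r [B [s [C [uE' vE']]]]]]] := @composable u v; first by rewrite uX vX.
rewrite uE' vE' class_mul; exists k, A, (r * s)%g, C; split=> //.
have BX : val B = X by rewrite -uX uE'.
move: uE; rewrite uE' phiE => E.
have : (d (val A) + d (val S))%:R = (d (val B) + d (val T))%:R :> R by rewrite !natrD; lra.
by move/eqP; rewrite eqr_nat BX dX => /eqP; lia.
Qed.

(** The trace, in leaf counts, of acting as the identity on a neighbourhood of size 2^-N; counts are
    compared only once the trees reach depth [N]. *)
Definition flat N (t : triple) : Prop :=
  d (val (tminus t)) = d (val (tplus t)) /\
  ((N <= d (val (tminus t)))%N -> corner N (val (tminus t)) = corner N (val (tplus t))).

Lemma d_ngraft n (T : ntree n) (k : 'I_n) : d (val (ngraft T k)) = (d (val T) + inside n 1 k)%N.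
Proof. by rewrite val_ngraft d_graft (eqP (valP T)). Qed.

Lemma corner_ngraft N n (T : ntree n) (k : 'I_n) : (N <= d (val T))%N ->
  corner N (val (ngraft T k)) = (corner N (val T) + inside n (corner N (val T)) k)%N.
Proof. by move=> NT; rewrite val_ngraft corner_graft ?(eqP (valP T)). Qed.

Lemma flat_expansions N t u : expansions t u -> flat N t -> flat N u.
Proof.
elim=> // {}t v {}u tv _ IH tflat; apply: IH.
case: tv tflat => {u v} [[n T p S]] k [dE cE].
rewrite -[val (tminus _)]/(val T) -[val (tplus _)]/(val S) in dE cE.
rewrite /flat -[val (tminus _)]/(val (ngraft T k)) -[val (tplus _)]/(val (ngraft S k)).
rewrite !d_ngraft dE; split=> // dN.
have [Nd|dN'] := leqP N (d (val S)).
  by rewrite !corner_ngraft ?dE // cE ?dE.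
(* The graft has just split the extremal leaf and reached depth [N], so both corners are single
   leaves. *)
have NE : N = (d (val S) + inside n 1 k)%N by move: dN; case: inside; lia.
by rewrite {1}NE -dE -d_ngraft corner_depth NE -d_ngraft corner_depth.
Qed.

(** The map is strictly increasing because corners are nested; so a graft never makes different
    corner counts equal. *)
Lemma inside_inj n k : injective (fun m => (m + inside n m k)%N).
Proof.
move=> m m' /=; wlog mm' : m m' / (m < m')%N => [W|].
  by case: (ltngtP m m') => // [/W|/W h /esym /h].
by case Em: (inside n m k); [rewrite (insideS mm' Em)|case: inside]; lia.
Qed.

Lemma not_flat_expansions N t u : expansions t u -> (N <= d (val (tminus t)))%N ->
  (N <= d (val (tplus t)))%N -> corner N (val (tminus t)) != corner N (val (tplus t)) ->
  (N <= d (val (tminus u)))%N /\ corner N (val (tminus u)) != corner N (val (tplus u)).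
Proof.
elim=> // {}t v {}u tv _ IH h1 h2 h3.
case: tv h1 h2 h3 IH => -[n T p S] k.
rewrite -[val (tminus _)]/(val T) -[val (tplus _)]/(val S).
rewrite -[val (tminus _)]/(val (ngraft T k)) -[val (tplus _)]/(val (ngraft S k)).
move=> h1 h2 h3; apply.
- by rewrite d_ngraft (leq_trans h1) // leq_addr.
- by rewrite d_ngraft (leq_trans h2) // leq_addr.
- by rewrite !corner_ngraft // (inj_eq (@inside_inj n k)).
Qed.

Lemma germ_linear_flat N g : germ_linear N g -> phi g = 0 ->
  exists t, g = Fbr_class t /\ flat N t.
Proof.
move=> [n [T [p [S [-> TN]]]]]; rewrite phiE => /eqP; rewrite subr_eq0 eqr_nat => /eqP ST.
exists (Triple T p S); split=> //; split=> [|NT]; first exact: esym.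
have NE : N = d (val T) by apply/eqP; rewrite eqn_leq TN andbT; exact: NT.
by rewrite -[val (tminus _)]/(val T) -[val (tplus _)]/(val S) NE corner_depth -ST corner_depth.
Qed.

Lemma depth_not_connected (S : set Fbr) : finite_set S -> generates S ->
  ~ superlevel_connected S phi.
Proof.
move=> /finite_seqP[l SE] genS conn.
(* Inverses are included because edges are followed in both directions. *)
have [N NP] : exists N, forall s, s \in l -> germ_linear N s /\ germ_linear N s^-1%g.
  elim: (l) => [|s l' [N IH]]; first by exists 0%N.
  have [N1 h1] := germ_linear_ex s; have [N2 h2] := germ_linear_ex s^-1%g.
  exists (maxn N (maxn N1 N2)) => x; rewrite inE => /orP[/eqP->|/IH[h3 h4]].
    by split; [apply: germ_linear_le h1|apply: germ_linear_le h2]; lia.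
  by split; [apply: germ_linear_le h3|apply: germ_linear_le h4]; lia.
have inv g h : clos_refl_sym_trans Fbr (superlevel_edge S phi) g h ->
    germ_linear N g <-> germ_linear N h.
  elim=> [x y [x0 y0 [s Ss yE]]|x|x y _ IH|x y z _ IH1 _ IH2]; last by rewrite IH1.
  - have [ls lsV] : germ_linear N s /\ germ_linear N s^-1%g by apply: NP; move: Ss; rewrite SE.
    split=> [lx|ly]; first by rewrite yE; apply: germ_linearM.
    by rewrite -[x](mulgK s) -yE; apply: germ_linearM.
  - by [].
  - by split=> /IH.
have [n [A [B [AB NA cAB]]]] := witness N.
have phi0 : phi (tree_pair A B) = 0 by rewrite phiE AB subrr.
(* The witness has height 0, so connectedness would join it to 1. *)
have lin : germ_linear N (tree_pair A B).
  apply/(inv 1%g); last exact: germ_linear1.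
  by apply: conn; rewrite ?phi0 // character1.
have [t [/Fbr_classP/triple_eqvP[u [Au tu]] ft]] :=
  germ_linear_flat (germ_linear_le (leqnSn N) lin) phi0.
have [_ h] := flat_expansions tu ft.
have [|Nu /eqP[]] := not_flat_expansions Au (N := N.+1) NA _ cAB.
  by rewrite /= -AB.
exact: h.
Qed.

End DepthObstruction.

(** * Corners of trees at the leftmost and the rightmost leaf *)

Fixpoint left_corner N t :=
  if N is N'.+1 then if t is Node l _ then left_corner N' l else 0%N else nleaves t.

Fixpoint right_corner N t :=
  if N is N'.+1 then if t is Node _ r then right_corner N' r else 0%N else nleaves t.

Lemma left_corner_le N t : (left_corner N t <= nleaves t)%N.
Proof.
by elim: N t => [|N IHN] // [|l r] //=; apply: leq_trans (IHN l) _; rewrite leq_addr.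
Qed.

Lemma right_corner_le N t : (right_corner N t <= nleaves t)%N.
Proof.
by elim: N t => [|N IHN] // [|l r] //=; apply: leq_trans (IHN r) _; rewrite leq_addl.
Qed.

Lemma left_corner_graft N t k : (N <= left_depth t)%N -> (k < nleaves t)%N ->
  left_corner N (graft t k) = (left_corner N t + (k < left_corner N t))%N.
Proof.
elim: N t k => [|N IHN] t k Nt kt; first by rewrite /= nleaves_graft // kt addn1.
case: t Nt kt => //= l r Nl kt; case: ifP => kl /=; first by rewrite IHN.
by have := left_corner_le N l; case: ltnP; lia.
Qed.

Lemma right_corner_graft N t k : (N <= right_depth t)%N -> (k < nleaves t)%N ->
  right_corner N (graft t k)
  = (right_corner N t + (nleaves t <= k + right_corner N t))%N.
Proof.
elim: N t k => [|N IHN] t k Nt kt; first by rewrite /= nleaves_graft // leq_addl addn1.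
case: t Nt kt => //= l r Nr kt; have := right_corner_le N r; case: ifP => kl /= h.
  by case: leqP; lia.
by rewrite IHN; [congr (_ + nat_of_bool _)%N; lia|lia|lia].
Qed.

Lemma left_corner_depth t : left_corner (left_depth t) t = 1%N.
Proof. by elim: t. Qed.

Lemma right_corner_depth t : right_corner (right_depth t) t = 1%N.
Proof. by elim: t. Qed.

Lemma join_depths s t : exists V, [/\ tree_le s V, tree_le t V,
  left_depth V = maxn (left_depth s) (left_depth t) &
  right_depth V = maxn (right_depth s) (right_depth t)].
Proof.
elim: s t => [|l IHl r IHr] t; first by exists t; rewrite tree_le_refl !max0n.
case: t => [|l' r']; first by exists (Node l r); rewrite tree_le_refl !maxn0.
have [L [h1 h2 h3 _]] := IHl l'; have [Q [h4 h5 _ h6]] := IHr r'.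
by exists (Node L Q); rewrite /= h1 h2 h3 h4 h5 h6 !maxnSS.
Qed.

Fixpoint left_comb_tree m := if m is m'.+1 then Node (left_comb_tree m') Leaf else Leaf.

Lemma nleaves_left_comb m : nleaves (left_comb_tree m) == m.+1.
Proof. by elim: m => //= m /eqP ->; rewrite addn1. Qed.

Definition left_comb m : ntree m.+1 := exist _ (left_comb_tree m) (nleaves_left_comb m).

Lemma left_depth_comb m : left_depth (left_comb_tree m) = m.
Proof. by elim: m => //= m ->. Qed.

Lemma right_depth_comb m : right_depth (right_comb_tree m) = m.
Proof. by elim: m => //= m ->. Qed.

Lemma left_corner_comb N : left_corner N (left_comb_tree N.+1) = 2%N.
Proof. by elim: N. Qed.

Lemma right_corner_comb N : right_corner N (right_comb_tree N.+1) = 2%N.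
Proof. by elim: N. Qed.

Lemma phi0_not_connected (R : realType) (S : set Fbr) : finite_set S -> generates S ->
  ~ superlevel_connected S (@phi0 R).
Proof.
apply: (@depth_not_connected R _ left_depth left_corner (fun _ m k => (k < m)%N)).
- exact: phi0_character.
- exact: phi0E.
- by move=> t k kt; rewrite left_depth_graft // ltnS leqn0.
- by move=> s t; have [V [h1 h2 h3 _]] := join_depths s t; exists V.
- by [].
- exact: left_corner_graft.
- exact: left_corner_depth.
- by move=> n m m' k mm' /ltn_trans; apply.
(* The corner of this comb at depth [N.+1] holds leaves 0 and 1, so one graft is inside it and the
   other outside. *)
move=> N; pose T : ntree N.+3 := left_comb N.+2.
exists N.+4, (ngraft T (inord 1)), (ngraft T (inord 2)).
have Tn := nleaves_left_comb N.+2; have dT := left_depth_comb N.+2.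
have cT := left_corner_comb N.+1.
rewrite !val_ngraft !inordK // -[val T]/(left_comb_tree N.+2).
by rewrite !left_depth_graft ?(eqP Tn) // !left_corner_graft ?(eqP Tn) ?dT // cT addn0; split=> //; lia.
Qed.

Lemma phi1_not_connected (R : realType) (S : set Fbr) : finite_set S -> generates S ->
  ~ superlevel_connected S (@phi1 R).
Proof.
apply: (@depth_not_connected R _ right_depth right_corner (fun n m k => (n <= k + m)%N)).
- exact: phi1_character.
- exact: phi1E.
- by move=> t k kt; rewrite right_depth_graft //; congr (_ + nat_of_bool _)%N; lia.
- by move=> s t; have [V [h1 h2 _ h3]] := join_depths s t; exists V.
- by [].
- exact: right_corner_graft.
- exact: right_corner_depth.
- by move=> n m m' k mm' h; apply: leq_trans h _; rewrite leq_add2l ltnW.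
move=> N; pose T : ntree N.+3 := right_comb N.+2.
exists N.+4, (ngraft T (inord N.+1)), (ngraft T (inord N)).
have Tn := nleaves_right_comb N.+2; have dT := right_depth_comb N.+2.
have cT := right_corner_comb N.+1.
rewrite !val_ngraft !inordK; try lia; rewrite -[val T]/(right_comb_tree N.+2).
rewrite !right_depth_graft ?(eqP Tn) ?dT; try lia.
rewrite !right_corner_graft ?(eqP Tn) ?dT; try lia.
by rewrite cT; split; lia.
Qed.
(** * The character sphere *)

Section Topology.
Context (R : realType).

Lemma continuous_matrix (T : topologicalType) m n (f : T -> 'M[R]_(m, n)) :
  (forall i j, continuous (fun t => f t i j)) -> continuous f.
Proof.
move=> fc t A [P Pnbhs PA]; apply: (filterS (P := [set u | forall i j, P i j (f u i j)]%classic)).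
  by move=> u Pu; apply: PA.
by apply: filter_forall => i; apply: filter_forall => j; apply: fc.
Qed.

Lemma continuous_ptws (T : topologicalType) (G : choiceType) (f : T -> {ptws G -> R}) :
  (forall g, continuous (fun t => f t g)) -> continuous f.
Proof.
move=> fc t; apply/cvg_sup => g; move: t.
by apply/(@continuousP _ (initial_topology (@^~ g))) => A [B oB <-]; apply: open_comp oB => + _.
Qed.

Lemma continuous_eval (G : choiceType) (g : G) : continuous (fun f : {ptws G -> R} => f g).
Proof.
move=> f U fU; have /cvg_sup/(_ g) : (nbhs f --> f)%classic by apply: cvg_id.
by apply; apply: initial_continuous fU.
Qed.

Lemma continuous_sum (T : topologicalType) (I : Type) (r : seq I) (F : I -> T -> R) x :
  (forall i, {for x, continuous (F i)}) -> {for x, continuous (fun t => \sum_(i <- r) F i t)}.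
Proof.
move=> Fc; elim: r => [|i r IHr].
  rewrite (_ : (fun t => _) = cst 0); first exact: cst_continuous.
  by apply/funext => t; rewrite big_nil.
rewrite (_ : (fun t => _) = F i + (fun t => \sum_(i <- r) F i t)); first exact: continuousD.
by apply/funext => t; rewrite big_cons.
Qed.

Lemma continuous_set_val (X : topologicalType) (A : set X) : continuous (set_val : A -> X).
Proof. exact: initial_continuous. Qed.

Definition basis (i : 'I_4) : Fbr -> R := tnth [tuple phi0 R; phi1 R; @omega R; @psi R] i.

(** The coordinates found in [character_combination]. They involve finitely many evaluations, hence
    are continuous for pointwise convergence. *)
Definition dual (chi : Fbr -> R) : 'rV[R]_4 := \row_i tnth [tuple
  chi (xgen 1) - chi (xgen 0); chi (xgen 1);
  (chi (twist caret) - chi (twist caret_right)) / 2; chi (twist caret_right) / 2] i.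

Definition char_of (x : 'rV[R]_4) (g : Fbr) : R := \sum_i x ord0 i * basis i g.

Lemma char_ofE x g : char_of x g = combination (x ord0 0) (x ord0 1) (x ord0 2%:R) (x ord0 3%:R) g.
Proof.
rewrite /char_of /combination !big_ord_recl big_ord0 addr0 !addrA.
by do !congr (_ + _); congr (x ord0 _ * _); apply: val_inj.
Qed.

Lemma dualE chi : [/\ dual chi ord0 0 = chi (xgen 1) - chi (xgen 0),
  dual chi ord0 1 = chi (xgen 1),
  dual chi ord0 2%:R = (chi (twist caret) - chi (twist caret_right)) / 2 &
  dual chi ord0 3%:R = chi (twist caret_right) / 2].
Proof. by split; rewrite mxE. Qed.

Lemma char_of_character x : is_character (char_of x).
Proof. by move=> g h; rewrite !char_ofE combination_character. Qed.

Lemma dualK (chi : Fbr -> R) : is_character chi -> forall g, char_of (dual chi) g = chi g.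
Proof.
move=> chiM g; rewrite char_ofE; have [-> -> -> ->] := dualE chi.
exact/esym/character_combination.
Qed.

Lemma char_ofK x : dual (char_of x) = x.
Proof.
have [h0 h1 h2 h3] := dualE (char_of x).
rewrite !char_ofE combination_xgen0 combination_xgen1 combination_twist2 !combination_twist3
  in h0 h1 h2 h3.
apply/rowP => i; have : (i < 4)%N := ltn_ord i.
case: i => -[|[|[|[|//]]]] ip _ /=.
- by rewrite (_ : Ordinal ip = 0) ?h0; [lra|exact: val_inj].
- by rewrite (_ : Ordinal ip = 1) ?h1; [lra|exact: val_inj].
- by rewrite (_ : Ordinal ip = 2%:R) ?h2; [lra|exact: val_inj].
- by rewrite (_ : Ordinal ip = 3%:R) ?h3; [lra|exact: val_inj].
Qed.

Lemma dualZ k (chi psi : Fbr -> R) : (forall g, psi g = k * chi g) -> dual psi = k *: dual chi.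
Proof.
move=> E; apply/rowP => i; rewrite !mxE; have : (i < 4)%N := ltn_ord i.
by case: i => -[|[|[|[|//]]]] ip _; rewrite /tnth /= !E; lra.
Qed.

Lemma continuous_dual : continuous (dual : {ptws Fbr -> R} -> 'rV[R]_4).
Proof.
apply: continuous_matrix => i j; have ev := @continuous_eval Fbr.
have : (j < 4)%N := ltn_ord j; case: j => -[|[|[|[|//]]]] jp _.
- rewrite (_ : (fun t => _) = fun t : {ptws Fbr -> R} => t (xgen 1) - t (xgen 0)); last first.
    by apply/funext => t; rewrite mxE.
  by move=> chi; apply: continuousB; apply: ev.
- rewrite (_ : (fun t => _) = fun t : {ptws Fbr -> R} => t (xgen 1)); first exact: ev.
  by apply/funext => t; rewrite mxE.
- rewrite (_ : (fun t => _)
    = fun t : {ptws Fbr -> R} => (t (twist caret) - t (twist caret_right)) / 2); last first.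
    by apply/funext => t; rewrite mxE.
  move=> chi; apply: (@continuousM R _ (fun t : {ptws Fbr -> R} => _ - _) (cst 2^-1)).
    by apply: continuousB; apply: ev.
  exact: cst_continuous.
- rewrite (_ : (fun t => _) = fun t : {ptws Fbr -> R} => t (twist caret_right) / 2); last first.
    by apply/funext => t; rewrite mxE.
  move=> chi; apply: (@continuousM R _ (fun t : {ptws Fbr -> R} => t _) (cst 2^-1)).
    exact: ev.
  exact: cst_continuous.
Qed.

(** [sphere] is cut out by a sum of squares, whereas the norm of row vectors is the maximum norm. *)
Definition euclid (x : 'rV[R]_4) : R := Num.sqrt (\sum_i x ord0 i ^+ 2).

Lemma euclid_gt0 x : x != 0 -> 0 < euclid x.
Proof.
move=> x0; rewrite sqrtr_gt0 lt_neqAle sumr_ge0 ?andbT => [|i _]; last exact: sqr_ge0.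
apply: contra x0; rewrite eq_sym psumr_eq0 => [|i _]; last exact: sqr_ge0.
move=> /allP h; apply/eqP/rowP => i; rewrite mxE; apply/eqP.
by have := h i (mem_index_enum i); rewrite /= sqrf_eq0.
Qed.

Lemma euclidZ k x : 0 <= k -> euclid (k *: x) = k * euclid x.
Proof.
move=> k0; rewrite /euclid -{2}(ger0_norm k0) -sqrtr_sqr -sqrtrM ?sqr_ge0 // mulr_sumr.
by congr Num.sqrt; apply: eq_bigr => i _; rewrite mxE exprMn.
Qed.

Lemma continuous_euclid : continuous euclid.
Proof.
move=> x; apply: continuous_comp; last exact: sqrt_continuous.
apply: continuous_sum => i; have h := @coord_continuous R 1 4 ord0 i x.
exact: continuousM.
Qed.

Definition normalize (x : 'rV[R]_4) : 'rV[R]_4 := (euclid x)^-1 *: x.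

Lemma normalizeZ k x : 0 < k -> normalize (k *: x) = normalize x.
Proof.
move=> k0; rewrite /normalize euclidZ ?ltW // scalerA invfM mulrAC mulVf ?mul1r //.
by rewrite gt_eqF.
Qed.

Lemma sphereE x : sphere R 3 x <-> euclid x = 1.
Proof.
rewrite /sphere /euclid /=; split=> [->|h]; first exact: sqrtr1.
have s0 : 0 <= \sum_i x ord0 i ^+ 2 by apply: sumr_ge0 => i _; apply: sqr_ge0.
by rewrite -(sqr_sqrtr s0) h expr1n.
Qed.

Lemma normalize_sphere x : x != 0 -> sphere R 3 (normalize x).
Proof.
move=> x0; have e0 := euclid_gt0 x0.
by apply/sphereE; rewrite euclidZ ?invr_ge0 ?ltW // mulVf ?gt_eqF.
Qed.

Lemma normalize_id x : sphere R 3 x -> normalize x = x.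
Proof. by move=> /sphereE h; rewrite /normalize h invr1 scale1r. Qed.

Lemma continuous_normalize x : x != 0 -> {for x, continuous normalize}.
Proof.
move=> x0; rewrite /normalize; apply: continuousZ; last exact: id.
apply: continuousV; [by rewrite gt_eqF ?euclid_gt0|exact: continuous_euclid].
Qed.

Local Notation nchars := (nontrivial_characters R Fbr).

Lemma nchar_character (chi : nchars) : is_character (val chi).
Proof. by have := set_mem (valP chi) => -[]. Qed.

Lemma dual_neq0 (chi : nchars) : dual (val chi) != 0.
Proof.
have [chiM [g g0]] := set_mem (valP chi); apply: contra g0 => /eqP E.
rewrite -(dualK chiM) E /char_of big1 // => i _; by rewrite mxE mul0r.
Qed.

Lemma char_of_nontrivial x : sphere R 3 x -> nchars (char_of x).
Proof.
move=> xS; split; first exact: char_of_character.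
apply: contrapT => /forallNP h; suff x0 : x = 0.
  by move: xS; rewrite /sphere /= x0 big1 => [/eqP|i _]; rewrite ?mxE ?expr0n // eq_sym oner_eq0.
rewrite -[x]char_ofK; have z g : char_of x g = 0 by apply/eqP/negPn/negP/h.
by apply/rowP => i; rewrite !mxE; have : (i < 4)%N := ltn_ord i;
  case: i => -[|[|[|[|//]]]] ip _; rewrite /tnth /= !z; lra.
Qed.

Definition direction (chi : nchars) : sphere R 3 :=
  exist _ (normalize (dual (val chi))) (mem_set (normalize_sphere (dual_neq0 chi))).

Definition char_point (x : sphere R 3) : nchars :=
  exist _ (char_of (val x)) (mem_set (char_of_nontrivial (set_mem (valP x)))).

Lemma continuous_direction : continuous direction.
Proof.
apply: continuous_comp_initial => chi.
apply: (@continuous_comp _ _ _ (fun chi : nchars => dual (val chi)) normalize).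
  apply: (@continuous_comp _ _ _ (set_val : nchars -> _) dual).
    exact: continuous_set_val.
  exact: continuous_dual.
by apply: continuous_normalize; apply: dual_neq0.
Qed.

Lemma continuous_char_point : continuous char_point.
Proof.
apply: continuous_comp_initial; apply: continuous_ptws => g x.
apply: continuous_sum => i; apply: continuousM; last exact: cst_continuous.
apply: (@continuous_comp _ _ _ (set_val : sphere R 3 -> _) (fun y : 'rV[R]_4 => y ord0 i)).
  exact: continuous_set_val.
exact: coord_continuous.
Qed.

Lemma direction_ray chi psi : ray chi = ray psi -> direction chi = direction psi.
Proof.
move=> /rayP[c c0 E]; apply: val_inj => /=.
by rewrite (dualZ E) normalizeZ.
Qed.

Lemma homeomorphic_sphere : homeomorphic (character_sphere R Fbr) (sphere R 3).
Proof.
(* By [direction_ray] the choice of representative does not matter, so the map is continuous on the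
   quotient. *)
exists (direction \o generic_quotient.repr), (fun x => ray (char_point x)); split.
- apply: repr_comp_continuous; first exact: continuous_direction.
  by move=> chi psi /eqP h; apply/eqP; apply: direction_ray.
- move=> x; apply: continuous_comp; first exact: continuous_char_point.
  exact: pi_continuous.
- move=> q /=; set chi := generic_quotient.repr q.
  transitivity (ray chi); last exact: reprK.
  have d0 := euclid_gt0 (dual_neq0 chi).
  apply/rayP; exists (euclid (dual (val chi))) => // g /=.
  rewrite -(dualK (nchar_character chi)) /char_of mulr_sumr; apply: eq_bigr => i _.
  by rewrite [in RHS]mxE !mulrA divff ?mul1r // gt_eqF.
- move=> x /=; have -> := @direction_ray _ (char_point x) (reprK _).
  by apply: val_inj => /=; rewrite char_ofK normalize_id //; apply: set_mem (valP x).
Qed.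

End Topology.

Theorem theorem3p4 (R : realType) :
  homeomorphic (character_sphere R Fbr) (sphere R 3) /\
  (forall S : set Fbr, finite_set S -> generates S ->
    Sigma1 R S = ([set: character_sphere R Fbr] `\` [set phi0_point R; phi1_point R])%classic).
Proof.
split; first exact: homeomorphic_sphere.
move=> S finS genS; apply/seteqP; split=> [_ [chi conn <-]|x [_ xn]].
  (* Connectedness depends only on the ray, so it would carry over to [phi0] or [phi1]. *)
  split=> // -[] /rayP[c c0 E].
    apply: (phi0_not_connected finS genS (R := R)).
    apply: (superlevel_connected_scale (c := c^-1)) conn; rewrite ?invr_gt0 // => g.
    by have /= -> := E g; rewrite mulKf // gt_eqF.
  apply: (phi1_not_connected finS genS (R := R)).
  apply: (superlevel_connected_scale (c := c^-1)) conn; rewrite ?invr_gt0 // => g.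
  by have /= -> := E g; rewrite mulKf // gt_eqF.
pose chi := generic_quotient.repr x; have chix : ray chi = x by apply: reprK.
exists chi => //=; have [chiM [g g0]] := set_mem (valP chi).
have [a [b [c [d E]]]] : exists a b c d, forall g, val chi g = @combination R a b c d g.
  by do 4!eexists; exact: character_combination.
have -> : val chi = @combination R a b c d by apply/funext.
have [cd|] := boolP ((c != 0) || (d != 0)); first exact: connected_of_K.
rewrite negb_or !negbK => /andP[/eqP c0 /eqP d0].
have [ab|] := boolP ((a != 0) && (b != 0) || (a < 0) || (b < 0)); first exact: connected_of_F.
(* There remain non-negative [a] and [b], one of them zero: a positive multiple of [phi1] or
   [phi0]. *)
rewrite !negb_or negb_and !negbK -!leNgt => /andP[/andP[ab a0] b0]; exfalso; apply: xn.
move: g0; rewrite E /combination c0 d0; case/orP: ab => /eqP z; rewrite z => g0.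
  have b1 : b != 0 by apply: contra g0 => /eqP ->; rewrite !mul0r !addr0.
  right; rewrite /= -chix; apply/rayP; exists b^-1.
    by rewrite invr_gt0 lt_neqAle b0 andbT eq_sym.
  by move=> h; rewrite E /combination c0 d0 z !mul0r add0r !addr0 mulKf.
have a1 : a != 0 by apply: contra g0 => /eqP ->; rewrite !mul0r !addr0.
left; rewrite /= -chix; apply/rayP; exists a^-1.
  by rewrite invr_gt0 lt_neqAle a0 andbT eq_sym.
by move=> h; rewrite E /combination c0 d0 z !mul0r !addr0 mulKf.
Qed.
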